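(* Suppose Assumptions 1, 2, 3, 4 of the context hold, and let $\{z_k\}_{k\ge1}$ be generated by the ZS-BCCG$'$ method described in the context for the composite problem $\min_{x\in X}\{\Phi(x)=f(x)+\chi(x)\}$, with $P_R(k)=\mathrm{Prob}\{R=k\}=\alpha_k/\sum_{k=1}^T\alpha_k$, $k=1,\dots,T$. Let $\bar g_X^k=\langle\nabla f(z_k),z_k-\theta(z_k)\rangle+\chi(z_k)-\chi(\theta(z_k))$, with $\theta(z_k)\in\arg\min_{y\in X}\{\langle\nabla f(z_k),y\rangle+\chi(y)\}$, be the generalized Frank–Wolfe gap. Then $$\mathbb E[\bar g_X^R]\le\frac{\Phi(z_1)-\Phi^*+\big(\sum_{s=1}^bp_sL_sD_{X_s}^2\big)\sum_{k=1}^T\alpha_k^2+\max_{s\in\mathcal B}\{p_s/L_s\}\sum_{k=1}^T\big[\frac{\tilde\sigma^2}{T_k}+\frac{\mu^2}4L_f^2(n+3)^3\big]}{(\min_sp_s)\sum_{k=1}^T\alpha_k},$$ where $\tilde\sigma^2=4(n+4)[2M^2+\sigma^2+\mu^2L_f^2(n+4)^2]$ and the expectation is over all the randomness of the method.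
   Context: Notation: $n=n_1+\dots+n_b$, $\mathcal B=\{1,\dots,b\}$, $U_s\in\mathbb R^{n\times n_s}$ with $(U_1,\dots,U_b)=I_n$; $x^{(s)}=U_s^Tx$, $\nabla_sf=U_s^T\nabla f$; $\|\cdot\|$, $\|\cdot\|_s$ are Euclidean norms on $\mathbb R^n$, $\mathbb R^{n_s}$. $X=X_1\times\cdots\times X_b$, each $X_s\subseteq\mathbb R^{n_s}$ closed convex. Problem: $\Phi=f+\chi$ with $f(x)=\mathbb E_\xi[F(x,\xi)]$ (possibly nonconvex), $\xi$ a random variable, $F$ Borel measurable and defined for all $x\in\mathbb R^n$; $\chi(x)=\sum_{s=1}^b\chi_s(x^{(s)})$ with $\chi_s:\mathbb R^{n_s}\to\mathbb R$ closed convex. $\Phi^*=\min_{x\in X}\Phi(x)$. Assumption 1: $\mathbb E[F(x,\xi)]=f(x)$ and $\mathbb E[\nabla F(x,\xi)]=\nabla f(x)$ for all $x$, and $\mathbb E[\|\nabla F(x,\xi)-\nabla f(x)\|^2]\le\sigma^2$ for all $x\in X$. Assumption 2: almost surely in $\xi$, $\|\nabla F(x,\xi)-\nabla F(y,\xi)\|\le L_f\|x-y\|$ for all $x,y$, and for each $s\in\mathcal B$, $\|\nabla_sF(x+U_sh,\xi)-\nabla_sF(x,\xi)\|_s\le L_s\|h\|_s$ for all $x$ and all $h\in\mathbb R^{n_s}$ ($L_f,L_s>0$). Assumption 3: $\|\nabla f(x)\|\le M$ for all $x\in X$. Assumption 4: each $X_s$ is bounded and $\max_{x,y\in X_s}\|x-y\|_s\le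 D_{X_s}$. Zeroth-order gradient: for $\mu>0$, $G_\mu(x,\xi,u)=\frac{F(x+\mu u,\xi)-F(x,\xi)}{\mu}u$. ZS-BCCG$'$ method: given $z_1\in X$, $\mu>0$, iteration count $T$, stepsizes $\alpha_k\in(0,1]$, batch sizes $T_k\ge1$, probabilities $p_s\in[0,1]$ with $\sum_sp_s=1$. Draw i.i.d. block indices $i_k$ with $\mathrm{Prob}\{i_k=s\}=p_s$ and $R\in\{1,\dots,T\}$ with probability mass function $P_R$. At step $k$ draw $u_{k,t}\sim N(0,I_n)$ and oracle samples $\xi_{k,t}$ distributed as $\xi$, $t=1,\dots,T_k$, set $\bar G_{\mu,k}^{(i_k)}=\frac1{T_k}\sum_{t=1}^{T_k}U_{i_k}^TG_\mu(z_k,\xi_{k,t},u_{k,t})$; set $z_{k+1}^{(s)}=z_k^{(s)}$ for $s\ne i_k$, and $x_{k+1}^{(i_k)}\in\arg\min_{y\in X_{i_k}}\{\langle\bar G_{\mu,k}^{(i_k)},y\rangle+\chi_{i_k}(y)\}$, $z_{k+1}^{(i_k)}=(1-\alpha_k)z_k^{(i_k)}+\alpha_kx_{k+1}^{(i_k)}$. Output $z_R$. All random quantities $i_k,\xi_{k,t},u_{k,t},R$ are mutually independent. *)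

(* Defs.v *)
From HB Require Import structures.
From mathcomp Require Export all_boot all_order all_algebra.
From mathcomp Require Export all_classical all_reals all_analysis.
Export Order.TTheory GRing.Theory Num.Theory.
Export numFieldNormedType.Exports.

Set Implicit Arguments.
Unset Strict Implicit.
Unset Printing Implicit Defensive.

Local Open Scope classical_set_scope.
Local Open Scope ring_scope.

(* The library norm on matrices is the sup norm, so the Euclidean structure is
   defined here; the two norms induce the same topology, Borel sets and
   derivatives. *)
Definition dotv {R : realType} {n : nat} (x y : 'cV[R]_n) : R :=
  \sum_(i < n) x i 0 * y i 0.

Definition norm2 {R : realType} {n : nat} (x : 'cV[R]_n) : R :=
  Num.sqrt (dotv x x).

Definition gradient {R : realType} {n : nat} (g : 'cV[R]_n -> R)
    (x : 'cV[R]_n) : 'cV[R]_n :=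
  \col_i 'D_(delta_mx i 0) g x.

Definition argmin {R : realType} {T : Type} (A : set T) (g : T -> R) : set T :=
  [set y | A y /\ forall y', A y' -> g y <= g y'].

Definition is_min {R : realType} {T : Type} (A : set T) (g : T -> R) (m : R) :=
  exists2 x, argmin A g x & m = g x.

Definition closed_function {R : realType} {n : nat} (g : 'cV[R]_n -> R) :=
  closed [set p : 'cV[R]_n * R | g p.1 <= p.2].

Section Blocks.
Context {R : realType} {b : nat} {ns : 'I_b -> nat}.

Local Notation n := (\sum_(s < b) ns s)%N.

Definition Ublock (s : 'I_b) : 'M[R]_(n, ns s) := submxrow 1%:M s.

Lemma mxrow_Ublock : \mxrow_s Ublock s = 1%:M.
Proof. exact: submxrowK. Qed.

Definition block (s : 'I_b) (x : 'cV[R]_n) : 'cV[R]_(ns s) :=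
  (Ublock s)^T *m x.

Definition prodset (X : forall s, set 'cV[R]_(ns s)) : set 'cV[R]_n :=
  [set x | forall s, X s (block s x)].

Definition sepsum (chi : forall s, 'cV[R]_(ns s) -> R) (x : 'cV[R]_n) : R :=
  \sum_(s < b) chi s (block s x).

(* Joint measurability, R^n carrying its Borel sigma-algebra. *)
Definition oracle_measurable {dXi} {Xi : measurableType dXi}
    (F : 'cV[R]_n -> Xi -> R) :=
  measurable_fun setT
    (fun q : g_sigma_algebraType (@open 'cV[R]_n) * Xi => F q.1 q.2).

Definition feasible_blocks (X : forall s, set 'cV[R]_(ns s)) :=
  forall s, closed (X s) /\ convex_set (X s).

Definition regularizers (chi : forall s, 'cV[R]_(ns s) -> R) :=
  forall s, closed_function (chi s) /\ convex_function setT (chi s).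

Section Assumptions.
Context {dXi : measure_display} {Xi : measurableType dXi}.
(* [Q] is the law of the random variable xi. *)
Variables (Q : probability Xi R) (F : 'cV[R]_n -> Xi -> R) (f : 'cV[R]_n -> R).
Variable X : forall s, set 'cV[R]_(ns s).
Arguments X : clear implicits.

(* [f] is differentiable and all the expectations of [F] and of the
   coordinates of its gradient are genuine, i.e. integrability is part of
   unbiasedness. *)
Definition unbiased_bounded_variance (sigma : R) : Prop :=
  [/\ forall x, Q.-integrable setT (EFin \o F x) /\ ('E_Q[F x] = (f x)%:E)%E,
      forall x, differentiable f x,
      forall x i,
        Q.-integrable setT (fun xi => (gradient (F^~ xi) x i 0)%:E) /\
        ('E_Q[fun xi => gradient (F^~ xi) x i 0%R]
           = (gradient f x i 0%R)%:E)%E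
    & forall x, prodset X x ->
        ('E_Q[fun xi => (norm2 (gradient (F^~ xi) x - gradient f x) ^+ 2)%R]
          <= (sigma ^+ 2)%:E)%E].

Definition lipschitz_gradients (Lf : R) (L : 'I_b -> R) : Prop :=
  [/\ 0 < Lf, forall s, 0 < L s &
   {ae Q, forall xi,
     [/\ forall x, differentiable (F^~ xi) x,
         forall x y, norm2 (gradient (F^~ xi) x - gradient (F^~ xi) y)
           <= Lf * norm2 (x - y)
       & forall s x (h : 'cV[R]_(ns s)),
           norm2 (block s (gradient (F^~ xi) (x + Ublock s *m h))
                  - block s (gradient (F^~ xi) x)) <= L s * norm2 h]}].

Definition bounded_gradient (M : R) : Prop :=
  forall x, prodset X x -> norm2 (gradient f x) <= M.

Definition bounded_blocks (D : 'I_b -> R) : Prop :=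
  forall s, bounded_set (X s) /\
    forall x y, X s x -> X s y -> norm2 (x - y) <= D s.

End Assumptions.

Definition zo_gradient {Xi : Type} (F : 'cV[R]_n -> Xi -> R) (mu : R)
    (x : 'cV[R]_n) (xi : Xi) (u : 'cV[R]_n) : 'cV[R]_n :=
  ((F (x + mu *: u) xi - F x xi) / mu) *: u.

(* [theta] is an arbitrary selection of minimizers; [fw_gap] does not depend on
   the selection at points of [prodset X]. *)
Definition fw_oracle (X : forall s, set 'cV[R]_(ns s)) (f : 'cV[R]_n -> R)
    (chi : forall s, 'cV[R]_(ns s) -> R) (theta : 'cV[R]_n -> 'cV[R]_n) :=
  forall x, prodset X x ->
    argmin (prodset X) (fun y => dotv (gradient f x) y + sepsum chi y)
           (theta x).

Definition fw_gap (f : 'cV[R]_n -> R) (chi : forall s, 'cV[R]_(ns s) -> R)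
    (theta : 'cV[R]_n -> 'cV[R]_n) (x : 'cV[R]_n) : R :=
  dotv (gradient f x) (x - theta x) + sepsum chi x - sepsum chi (theta x).

End Blocks.

Definition borelV (R : realType) (n : nat) : set (set 'cV[R]_n) :=
  <<s @open 'cV[R]_n >>.

(* The sigma-algebra generated by [Y : Omega -> T], [S] being the
   sigma-algebra carried by [T] (the powerset when [T] is discrete). *)
Definition sigma_of {Omega T : Type} (S : set (set T)) (Y : Omega -> T) :
    set (set Omega) :=
  preimage_set_system setT Y S.

Definition mutually_independent {R : realType} {d} {Omega : measurableType d}
    (P : probability Omega R) {J : Type} (V : set J)
    (G : J -> set (set Omega)) : Prop :=
  forall (m : nat) (j : 'I_m -> J) (E : 'I_m -> set Omega),
    injective j -> (forall a, V (j a)) -> (forall a, G (j a) (E a)) ->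
    P (\big[setI/setT]_(a < m) E a) = (\prod_(a < m) P (E a))%E.

Definition standard_gaussian {R : realType} {d} {Omega : measurableType d}
    (P : probability Omega R) {n : nat} (u : Omega -> 'cV[R]_n) : Prop :=
  forall A : 'I_n -> set R, (forall a, measurable (A a)) ->
    P [set w | forall a, A a (u w a 0)] =
    (\prod_(a < n) normal_prob 0%R 1%R (A a))%E.

Variant draw : Type :=
  | DrawOutput
  | DrawBlock of nat
  | DrawSample of nat & nat
  | DrawDirection of nat & nat.

Section Method.
Context {R : realType} {b : nat} {ns : 'I_b -> nat}.
Local Notation n := (\sum_(s < b) ns s)%N.
Context {dXi dO : measure_display}.
Context {Xi : measurableType dXi} {Omega : measurableType dO}.

(* Steps k run over 1, ..., T and the samples of step k over 1, ..., Tb k;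
   nothing is required of the sequences outside these ranges. *)
Definition batch (Tb : nat -> nat) (k t : nat) : bool := (1 <= t <= Tb k)%N.

(* The draws made at steps 1, ..., k - 1. *)
Definition drawn_before (Tb : nat -> nat) (k : nat) : set draw :=
  [set j | match j with
           | DrawOutput => False
           | DrawBlock l => (1 <= l < k)%N
           | DrawSample l t | DrawDirection l t =>
               (1 <= l < k)%N /\ batch Tb l t
           end].

Definition drawn (T : nat) (Tb : nat -> nat) : set draw :=
  DrawOutput |` drawn_before Tb T.+1.

Record randomness := Randomness {
  rout : Omega -> nat ;
  rblock : nat -> Omega -> 'I_b ;
  rsample : nat -> nat -> Omega -> Xi ;
  rdir : nat -> nat -> Omega -> 'cV[R]_n }.

Definition draw_sigma (r : randomness) (j : draw) : set (set Omega) :=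
  match j with
  | DrawOutput => sigma_of setT (rout r)
  | DrawBlock k => sigma_of setT (rblock r k)
  | DrawSample k t => sigma_of measurable (rsample r k t)
  | DrawDirection k t => sigma_of (@borelV R n) (rdir r k t)
  end.

Definition history (r : randomness) (Tb : nat -> nat) (k : nat) :
    set (set Omega) :=
  <<s \bigcup_(j in drawn_before Tb k) draw_sigma r j >>.

Variables (P : probability Omega R) (Q : probability Xi R).
Variables (F : 'cV[R]_n -> Xi -> R) (X : forall s, set 'cV[R]_(ns s)).
Variable chi : forall s, 'cV[R]_(ns s) -> R.
Arguments X : clear implicits.
Arguments chi : clear implicits.
Variables (mu : R) (T : nat) (alpha : nat -> R) (Tb : nat -> nat).
Variables (p : 'I_b -> R) (PR : nat -> R).

Definition zs_bccg_parameters : Prop :=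
  [/\ 0 < mu,
      forall k, (1 <= k <= T)%N -> 0 < alpha k <= 1,
      forall k, (1 <= k <= T)%N -> (1 <= Tb k)%N,
      forall s, 0 <= p s <= 1
    & \sum_(s < b) p s = 1].

Record zs_bccg_randomness (r : randomness) : Prop := {
  draw_measurable : forall j, drawn T Tb j -> draw_sigma r j `<=` measurable ;
  draw_independent : mutually_independent P (drawn T Tb) (draw_sigma r) ;
  rout_range : forall w, (1 <= rout r w <= T)%N ;
  rout_law : forall k, (1 <= k <= T)%N ->
    P (rout r @^-1` [set k]) = (PR k)%:E ;
  rblock_law : forall k s, (1 <= k <= T)%N ->
    P (rblock r k @^-1` [set s]) = (p s)%:E ;
  rsample_law : forall k t, (1 <= k <= T)%N -> batch Tb k t ->
    forall A, measurable A -> P (rsample r k t @^-1` A) = Q A ;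
  rdir_law : forall k t, (1 <= k <= T)%N -> batch Tb k t ->
    standard_gaussian P (rdir r k t) }.

Definition batch_gradient (r : randomness) (z : nat -> Omega -> 'cV[R]_n)
    (k : nat) (w : Omega) : 'cV[R]_(ns (rblock r k w)) :=
  (Tb k)%:R^-1 *: \sum_(1 <= t < (Tb k).+1)
    block (rblock r k w)
      (zo_gradient F mu (z k w) (rsample r k t w) (rdir r k t w)).

(* Only the block [rblock r k w] of [x k.+1 w] is constrained.  The subproblem
   may have several solutions; adaptedness says that the one retained at step k
   is a measurable function of the draws made up to that step. *)
Record zs_bccg_iterates (r : randomness) (z1 : 'cV[R]_n)
    (x z : nat -> Omega -> 'cV[R]_n) : Prop := {
  z_init : forall w, z 1%N w = z1 ;
  z_adapted : forall k, (1 <= k <= T)%N ->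
    sigma_of (@borelV R n) (z k) `<=` history r Tb k ;
  x_step : forall k w, (1 <= k <= T)%N ->
    argmin (X (rblock r k w))
      (fun y => dotv (batch_gradient r z k w) y + chi (rblock r k w) y)
      (block (rblock r k w) (x k.+1 w)) ;
  z_step : forall k w, (1 <= k <= T)%N ->
    block (rblock r k w) (z k.+1 w) =
      (1 - alpha k) *: block (rblock r k w) (z k w)
      + alpha k *: block (rblock r k w) (x k.+1 w) ;
  z_frozen : forall k w s, (1 <= k <= T)%N -> s != rblock r k w ->
    block s (z k.+1 w) = block s (z k w) }.

End Method.
Arguments randomness R {b} ns {dXi dO} Xi Omega.

(* Main.v *)
(** With g the mean over the batch of step k of the zeroth-order gradients at
    z_k, exact minimisation of the linearised block subproblem and the descent
    lemma along the drawn block i give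
      Phi(z_(k+1)) + alpha_k gap_i(z_k)
        <= Phi(z_k) + L_i D_i^2 alpha_k^2 + |g_i - grad_i f(z_k)|^2 / (2 L_i),
    where gap_i is the contribution of block i to the Frank-Wolfe gap.  Averaging
    over i bounds the left gap below by (min p) times the full gap, and the noise
    above by max (p / L) times half the second moment of the batch error.  That
    moment splits into a variance of order 1 / T_k and a squared bias: smoothness
    gives (F(x + mu u, xi) - F(x, xi)) / mu = <grad F(x, xi), u> + c with
    |c| <= mu L_f |u|^2 / 2, so both reduce to Gaussian moments of order at most
    six, the bias being E[c u] because E[u u^T] = I.  Summing over k telescopes,
    and drawing R with weights alpha_k turns the weighted sum of the gaps into
    E[gap(z_R)]. *)

From HB Require Import structures.
Require Import Defs.
From mathcomp Require Import measurable_realfun ring lra.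
Set Implicit Arguments.
Unset Strict Implicit.
Unset Printing Implicit Defensive.
Local Open Scope classical_set_scope.
Local Open Scope ring_scope.

(** * Independence of groups of draws *)

(** The noise bound concerns one fixed point, whereas [z k] is random. The passage rests on
    independence: a Dynkin argument turns mutual independence of the draws into independence of
    disjoint groups of them, so the past of step k and its batch are independent and Tonelli lets
    [z k] be frozen. The drawn block is independent of both, hence is averaged with the rest of the
    integrand held fixed. Nonnegativity organises the integrals: feasibility gives Phi(z_k) >= Phi*,
    every block gap is nonnegative, and the telescoping takes place in the extended reals. Two
    measurability obstacles shape the rest. The minimiser [theta] is an arbitrary selection, so the
    gap is shown measurable through the minimal value, which does not depend on the selection.
    Adaptedness of the iterates reaches only z_T, so the last step bounds Phi(z_(T+1)) - Phi* below
    by 0 instead of integrating it. The Gaussian constants obtained are smaller than the stated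
    ones; the two are compared only at the end, as polynomials in n whose differences have
    nonnegative coefficients. *)

Section GroupIndependence.
Context {R : realType} {d : measure_display} {Omega : measurableType d}.
Variables (P : probability Omega R) (J : Type) (V : set J).
Variable G : J -> set (set Omega).
Hypotheses (indepG : mutually_independent P V G)
  (GT : forall j, V j -> G j setT)
  (GI : forall j, V j -> setI_closed (G j))
  (mG : forall j, V j -> G j `<=` measurable).

(** The pi-system from which group independence is extended. [{classic J}] supplies the decidable
    equality behind [uniq] and [\in] for an arbitrary index type. *)
Definition cylinders (A : set J) : set (set Omega) :=
  [set E | exists (s : seq {classic J}) (H : J -> set Omega),
    [/\ uniq s, forall j, j \in s -> A j, forall j, A j -> G j (H j)
      & E = \big[setI/setT]_(j <- s) H j]].

Lemma cylindersI (A : set J) : A `<=` V -> setI_closed (cylinders A).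
Proof.
move=> AV _ _ [s [H [us sA HG ->]]] [s' [H' [us' sA' HG' ->]]].
(* Both families are padded by [setT] outside their supports, so one family on the union of the
   supports describes the intersection. *)
pose K := fun j : {classic J} =>
  (if j \in s then H j else setT) `&` (if j \in s' then H' j else setT).
exists (undup (s ++ s')), K; split; first exact: undup_uniq.
- by move=> j; rewrite mem_undup mem_cat => /orP[/sA|/sA'].
- move=> j Aj; apply: (GI (AV _ Aj)).
    by case: ifP => _; [exact: HG|exact/GT/AV].
  by case: ifP => _; [exact: HG'|exact/GT/AV].
- rewrite -!bigcap_seq; apply/seteqP; split => w.
    move=> [h h'] j /= _; split; case: ifP => // js; [exact: h|exact: h'].
  move=> h; split => j /= js.
    have /h[] : j \in undup (s ++ s') by rewrite mem_undup mem_cat js.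
    by rewrite js.
  have /h[] : j \in undup (s ++ s') by rewrite mem_undup mem_cat js orbT.
  by rewrite js.
Qed.

Lemma prob_cylinder (s : seq {classic J}) (H : J -> set Omega) :
  uniq s -> (forall j, j \in s -> V j) -> (forall j, j \in s -> G j (H j)) ->
  P (\big[setI/setT]_(j <- s) H j) = (\prod_(j <- s) P (H j))%E.
Proof.
move=> us sV sG.
rewrite (big_tnth _ _ s) [RHS](big_tnth _ _ s).
rewrite (indepG (j := tnth (in_tuple s))) //.
- by move=> a b /(tuple_uniqP (in_tuple s) us).
- by move=> a; apply: sV; exact: mem_tnth.
- by move=> a; apply: sG; exact: mem_tnth.
Qed.

(** Disjointness of [A] and [B] keeps the concatenation of the two supports duplicate-free, and the
    product over the concatenation splits in two. *)
Lemma indep_cylinders (A B : set J) : A `<=` V -> B `<=` V ->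
  A `&` B = set0 -> forall E F, cylinders A E -> cylinders B F ->
  P (E `&` F) = (P E * P F)%E.
Proof.
move=> AV BV AB0 _ _ [s [H [us sA HG ->]]] [s' [H' [us' sB HG' ->]]].
have dis j : j \in s' -> (j \in s) = false.
  move=> js'; apply/negP => js; have : (A `&` B) j by split; auto.
  by rewrite AB0.
pose K := fun j : {classic J} => if j \in s then H j else H' j.
have -> : \big[setI/setT]_(j <- s) H j = \big[setI/setT]_(j <- s) K j.
  by rewrite !big_seq; apply: eq_bigr => j js; rewrite /K js.
have -> : \big[setI/setT]_(j <- s') H' j = \big[setI/setT]_(j <- s') K j.
  by rewrite !big_seq; apply: eq_bigr => j js; rewrite /K dis.
rewrite -big_cat /= !prob_cylinder ?big_cat //.
- by move=> j js; exact/BV/sB.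
- by move=> j js; rewrite /K dis//; apply: HG'; exact: sB.
- by move=> j js; exact/AV/sA.
- by move=> j js; rewrite /K js; apply: HG; exact: sA.
- rewrite cat_uniq us us' andbT /=; apply/hasPn => j js'.
  by rewrite dis.
- by move=> j; rewrite mem_cat => /orP[/sA/AV|/sB/BV].
- move=> j; rewrite mem_cat /K; case: ifP => /= [/sA + _|_ /sB]; [exact: HG|exact: HG'].
Qed.

Lemma cylinders_measurable (A : set J) : A `<=` V -> cylinders A `<=` measurable.
Proof.
move=> AV _ [s [H [us sA HG ->]]]; rewrite big_seq.
by apply: bigsetI_measurable => j /sA Aj; apply: (mG (AV _ Aj)); exact: HG.
Qed.

Lemma sub_cylinders (A : set J) : A `<=` V ->
  \bigcup_(j in A) G j `<=` cylinders A.
Proof.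
move=> AV E [j Aj GjE].
exists [:: (j : {classic J})].
exists (fun i : {classic J} => if i == j then E else setT); split => //.
- by move=> i; rewrite inE => /eqP ->.
- by move=> i Ai; case: eqP => [->|_] //; exact/GT/AV.
- by rewrite big_seq1 eqxx.
Qed.

Lemma gsigma_cylinders (A : set J) : A `<=` V ->
  <<s \bigcup_(j in A) G j >> `<=` <<s cylinders A >>.
Proof. by move=> /sub_cylinders; exact: sub_smallest2r. Qed.

(** Dynkin's pi-lambda argument: for fixed [F], the measurable [B] that satisfy the product rule
    form a lambda-system containing the pi-system [S]. *)
Lemma indep_generated_l (S : set (set Omega)) (F : set Omega) :
  measurable F -> S `<=` measurable -> setI_closed S ->
  (forall E, S E -> P (E `&` F) = (P E * P F)%E) ->
  forall E, <<s S >> E -> P (E `&` F) = (P E * P F)%E.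
Proof.
move=> mF mS SI SF E SE.
have fP (B : set Omega) : measurable B -> P B \is a fin_num.
  by move=> mB; exact: fin_num_measure.
suff : <<s S >> `<=` [set B | measurable B /\ P (B `&` F) = (P B * P F)%E].
  by move=> /(_ _ SE)[].
apply: lambda_system_subset; [by []| | |by []]; last first.
  by move=> B SB; split; [exact: mS|exact: SF].
apply/dynkin_lambda_system; split => /=.
- by split => //; rewrite setTI probability_setT mul1e.
- move=> B [mB BF]; split; first exact: measurableC.
  rewrite probability_setC// muleBl ?fP// ?mul1e -?BF.
  rewrite setIC -setDE measureD//.
  - by rewrite setIC.
  - by rewrite ltey_eq fP.
- move=> B tB BP; have mB k : measurable (B k) by have [] := BP k.
  have mU : measurable (\bigcup_k B k) by exact: bigcup_measurable.
  split => //; rewrite setI_bigcupl.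
  rewrite measure_semi_bigcup//.
  + rewrite [in RHS]measure_semi_bigcup//.
    rewrite muleC -(fineK (fP _ mF)) -nneseriesZl//.
    by apply: eq_eseriesr => k _; rewrite fineK ?fP// muleC; exact: (BP k).2.
  + by move=> k; exact: measurableI.
  + exact: trivIset_setIr.
  + by apply: bigcup_measurable => k _; exact: measurableI.
Qed.

(** One side at a time: the left event is extended to its sigma-algebra against a fixed cylinder,
    then the right event against the extended left one. *)
Lemma indep_generated (A B : set J) : A `<=` V -> B `<=` V ->
  A `&` B = set0 ->
  forall E F, <<s \bigcup_(j in A) G j >> E -> <<s \bigcup_(j in B) G j >> F ->
  P (E `&` F) = (P E * P F)%E.
Proof.
move=> AV BV AB0 E F /(gsigma_cylinders AV) sE /(gsigma_cylinders BV) sF.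
have msub (C : set J) : C `<=` V -> <<s cylinders C >> `<=` measurable.
  move=> CV; apply: smallest_sub; first exact: sigma_algebra_measurable.
  exact: cylinders_measurable.
have EF B' : cylinders B B' -> P (E `&` B') = (P E * P B')%E.
  move=> cB'; apply: (@indep_generated_l (cylinders A)) => //.
  - exact: cylinders_measurable cB'.
  - exact: cylinders_measurable.
  - exact: cylindersI.
  - by move=> A' cA'; apply: indep_cylinders AB0 _ _ _ _.
rewrite setIC muleC; apply: (@indep_generated_l (cylinders B)) => //.
- exact: msub sE.
- exact: cylinders_measurable.
- exact: cylindersI.
- by move=> B' cB'; rewrite setIC muleC; exact: EF.
Qed.

End GroupIndependence.

(** * Decoupling independent maps *)

Definition independent_maps {R : realType} {d d1 d2}
    {Omega : measurableType d} {T1 : measurableType d1} {T2 : measurableType d2}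
    (P : probability Omega R) (Y : Omega -> T1) (Z : Omega -> T2) :=
  forall A B, measurable A -> measurable B ->
    P (Y @^-1` A `&` Z @^-1` B) = (P (Y @^-1` A) * P (Z @^-1` B))%E.

Section Decoupling.
Context {R : realType} {d d1 d2 : measure_display}.
Context {Omega : measurableType d} {T1 : measurableType d1} {T2 : measurableType d2}.
Variable P : probability Omega R.
Local Open Scope ereal_scope.

(** Independence is the agreement of the joint law with the product law on rectangles, and a product
    measure is determined there. *)
Lemma distribution_pair (Y : {mfun Omega >-> T1}) (Z : {mfun Omega >-> T2})
    (YZ : {mfun Omega >-> (T1 * T2)%type}) :
  independent_maps P Y Z -> (forall w, YZ w = (Y w, Z w)) ->
  forall A, measurable A ->
    (distribution P Y \x distribution P Z) A = distribution P YZ A.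
Proof.
move=> ind YZE A mA; apply: product_measure_unique => // A1 A2 mA1 mA2.
transitivity (P (Y @^-1` A1 `&` Z @^-1` A2)); last exact: ind.
by congr (P _); apply/seteqP; split => w /=; rewrite YZE.
Qed.

(** Tonelli for the product of the two laws, pulled back to [Omega]: [Z] is resampled at a second
    point [w'], so [Y w] is frozen in the inner integral. *)
Lemma ge0_decouple (Y : Omega -> T1) (Z : Omega -> T2) (h : T1 * T2 -> \bar R) :
  measurable_fun setT Y -> measurable_fun setT Z -> independent_maps P Y Z ->
  measurable_fun setT h -> (forall q, 0 <= h q) ->
  \int[P]_w h (Y w, Z w) = \int[P]_w \int[P]_w' h (Y w, Z w').
Proof.
move=> mY mZ ind mh h0.
pose Yp : {mfun Omega >-> T1} := HB.pack Y (isMeasurableFun.Build _ _ _ _ _ mY).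
pose Zp : {mfun Omega >-> T2} := HB.pack Z (isMeasurableFun.Build _ _ _ _ _ mZ).
have mYZ : measurable_fun setT (fun w => (Y w, Z w)).
  exact/measurable_fun_pairP.
pose YZp : {mfun Omega >-> (T1 * T2)%type} :=
  HB.pack (fun w => (Y w, Z w)) (isMeasurableFun.Build _ _ _ _ _ mYZ).
transitivity (\int[distribution P YZp]_q h q).
  by rewrite ge0_integral_distribution.
transitivity (\int[(distribution P Yp \x distribution P Zp)]_q h q).
  apply: eq_measure_integral => A mA _; symmetry; exact: distribution_pair.
rewrite fubini_tonelli1// ge0_integral_distribution; last 2 first.
- exact: measurable_fun_fubini_tonelli_F.
- by move=> y; exact: integral_ge0.
apply: eq_integral => w _ /=.
rewrite /fubini_F ge0_integral_distribution//.
exact: measurableT_comp.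
Qed.

(** This is how a bound valid for every frozen value of [Y] passes to the joint expectation. *)
Lemma ge0_decouple_le (Y : Omega -> T1) (Z : Omega -> T2) (h : T1 * T2 -> \bar R)
    (c : \bar R) :
  measurable_fun setT Y -> measurable_fun setT Z -> independent_maps P Y Z ->
  measurable_fun setT h -> (forall q, 0 <= h q) ->
  (forall w, \int[P]_w' h (Y w, Z w') <= c) ->
  \int[P]_w h (Y w, Z w) <= c.
Proof.
move=> mY mZ ind mh h0 hc; rewrite ge0_decouple//.
have PT : P setT = 1 by exact: probability_setT.
(* A space of total mass 1 has a point, where [c] dominates a nonnegative integral. *)
have c0 : 0 <= c.
  have [w|T0] := pselect (exists w : Omega, True).
    by case: w => w _; apply: le_trans (hc w); exact: integral_ge0.
  have : P setT = 0 by rewrite (_ : setT = set0) ?measure0//; apply/seteqP; split => w // _;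
    apply: T0; exists w.
  by rewrite PT => /eqP; rewrite onee_eq0.
apply: (@le_trans _ _ (\int[P]_w cst c w)); last by rewrite integral_cst//= PT mule1.
apply: ge0_le_integral => //; first by move=> w _; exact: integral_ge0.
pose Zp : {mfun Omega >-> T2} := HB.pack Z (isMeasurableFun.Build _ _ _ _ _ mZ).
(* The inner integral depends on [w] only through [Y w], so it is a Tonelli partial integral
   composed with [Y]. *)
rewrite (_ : (fun w => _) = (fun y => \int[distribution P Zp]_z h (y, z)) \o Y).
  apply: measurableT_comp => //.
  exact: measurable_fun_fubini_tonelli_F.
apply/funext => w /=; rewrite ge0_integral_distribution//.
exact: measurableT_comp.
Qed.
End Decoupling.

Section IndependentProducts.
Context {R : realType} {d : measure_display} {Omega : measurableType d}.
Variable P : probability Omega R.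
Local Open Scope ereal_scope.

Lemma ge0_expectationM (X Y : Omega -> R) :
  measurable_fun setT X -> measurable_fun setT Y -> independent_maps P X Y ->
  (forall w, 0 <= X w)%R -> (forall w, 0 <= Y w)%R ->
  \int[P]_w (X w * Y w)%:E = \int[P]_w (X w)%:E * \int[P]_w (Y w)%:E.
Proof.
move=> mX mY ind X0 Y0.
(* Truncation at 0 makes the integrand nonnegative on the whole plane and changes nothing at the
   values taken by [X] and [Y]. *)
pose h := fun q : R * R => (Num.max q.1 0 * Num.max q.2 0)%:E.
have mh : measurable_fun setT h.
  apply/measurable_EFinP/measurable_funM.
    by apply: measurable_maxr => //; exact: measurable_fst.
  by apply: measurable_maxr => //; exact: measurable_snd.
have h0 q : 0 <= h q by rewrite lee_fin mulr_ge0// le_max lexx orbT.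
transitivity (\int[P]_w h (X w, Y w)).
  by apply: eq_integral => w _; rewrite /h /= !max_l.
rewrite ge0_decouple//.
rewrite -ge0_integralZr//; last 3 first.
- exact/measurable_EFinP.
- by move=> w _; rewrite lee_fin.
- by apply: integral_ge0 => w _; rewrite lee_fin.
apply: eq_integral => w _; rewrite -ge0_integralZl//; last 3 first.
- exact/measurable_EFinP.
- by move=> w' _; rewrite lee_fin.
- by rewrite lee_fin.
by apply: eq_integral => w' _; rewrite /h /= !max_l.
Qed.

Lemma independent_maps_comp {d1 d2 d1' d2'} {T1 : measurableType d1}
    {T2 : measurableType d2} {U1 : measurableType d1'} {U2 : measurableType d2'}
    (Y : Omega -> T1) (Z : Omega -> T2) (f : T1 -> U1) (g : T2 -> U2) :
  independent_maps P Y Z -> measurable_fun setT f -> measurable_fun setT g ->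
  independent_maps P (f \o Y) (g \o Z).
Proof.
move=> ind mf mg A B mA mB; 
rewrite (_ : _ `&` _ = Y @^-1` (f @^-1` A) `&` Z @^-1` (g @^-1` B))//; apply: ind.
  by rewrite -[X in measurable X]setTI; exact: mf.
by rewrite -[X in measurable X]setTI; exact: mg.
Qed.

Lemma independent_integrableM (X Y : Omega -> R) : independent_maps P X Y ->
  P.-integrable setT (EFin \o X) -> P.-integrable setT (EFin \o Y) ->
  P.-integrable setT (EFin \o (X \* Y)%R).
Proof.
move=> ind /integrableP[/measurable_EFinP mX iX] /integrableP[/measurable_EFinP mY iY].
apply/integrableP; split; first exact/measurable_EFinP/measurable_funM.
under eq_integral do rewrite /= normrM.
rewrite ge0_expectationM ?lte_mul_pinfty//.
- by apply: integral_ge0 => w _; rewrite lee_fin.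
- by rewrite ge0_fin_numE//; apply: integral_ge0 => w _; rewrite lee_fin.
- exact: measurableT_comp.
- exact: measurableT_comp.
- by apply: independent_maps_comp ind _ _; exact: normr_measurable.
Qed.

(** Fubini instead of Tonelli, since the factors are signed; integrability for the product law is
    that of the product variable, transported through the joint law. *)
Lemma independent_expectationM (X Y : Omega -> R) : independent_maps P X Y ->
  P.-integrable setT (EFin \o X) -> P.-integrable setT (EFin \o Y) ->
  \int[P]_w (X w * Y w)%:E = \int[P]_w (X w)%:E * \int[P]_w (Y w)%:E.
Proof.
move=> ind iX iY; have iXY := independent_integrableM ind iX iY.
have mX : measurable_fun setT X by apply/measurable_EFinP; apply: measurable_int iX.
have mY : measurable_fun setT Y by apply/measurable_EFinP; apply: measurable_int iY.
pose Xp : {mfun Omega >-> R} := HB.pack X (isMeasurableFun.Build _ _ _ _ _ mX).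
pose Yp : {mfun Omega >-> R} := HB.pack Y (isMeasurableFun.Build _ _ _ _ _ mY).
have mXY : measurable_fun setT (fun w => (X w, Y w)).
  exact/measurable_fun_pairP.
pose XYp : {mfun Omega >-> (R * R)%type} :=
  HB.pack (fun w => (X w, Y w)) (isMeasurableFun.Build _ _ _ _ _ mXY).
pose h : R * R -> \bar R := fun q => (q.1 * q.2)%:E.
have mh : measurable_fun setT h.
  by apply/measurable_EFinP/measurable_funM.
pose m := (distribution P Xp \x distribution P Yp).
have ih : m.-integrable setT h.
  apply/integrableP; split => //.
  rewrite [ltLHS](_ : _ = \int[distribution P XYp]_q `|h q|).
    rewrite ge0_integral_distribution//; last exact: measurableT_comp.
    by move/integrableP : iXY => [].
  by apply: eq_measure_integral => A mA _; exact: distribution_pair.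
transitivity (\int[distribution P XYp]_q h q).
  by rewrite integral_distribution.
transitivity (\int[m]_q h q).
  by apply: eq_measure_integral => A mA _; symmetry; exact: distribution_pair.
rewrite -integral12_prod_meas1//.
have iYfin : \int[P]_w (Y w)%:E \is a fin_num by exact: integrable_fin_num.
have iY' : (distribution P Yp).-integrable setT EFin.
  by apply: integrable_pushforward => //; exact/measurable_EFinP.
have iX' : (distribution P Xp).-integrable setT EFin.
  by apply: integrable_pushforward => //; exact/measurable_EFinP.
have YE : \int[distribution P Yp]_y y%:E = \int[P]_w (Y w)%:E.
  by rewrite integral_distribution//; exact/measurable_EFinP.
transitivity (\int[distribution P Xp]_x (\int[P]_w (Y w)%:E * x%:E)).
  apply: eq_integral => x _; rewrite /fubini_F /h /=.
  under eq_integral do rewrite EFinM.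
  by rewrite integralZl// YE muleC.
rewrite -(fineK iYfin) integralZl// muleC; congr (_ * _).
by rewrite integral_distribution//; exact/measurable_EFinP.
Qed.
End IndependentProducts.

(** * Moments of the standard Gaussian *)

Section GaussianMoments.
Context {R : realType}.
Notation mu := (@lebesgue_measure R).
Local Notation N01 := (@normal_prob R 0 1).
Local Notation pdf := (@normal_pdf R 0 1).

(** The change of variables below is expressed with the Radon-Nikodym derivative; it integrates like
    the density over every measurable set, so the two agree almost everywhere. *)
Lemma sigma_finite_RN_normal :
  ae_eq mu setT (Radon_Nikodym_SigmaFinite.f N01 mu) (EFin \o pdf).
Proof.
have dom := @normal_prob_dominates R 0 1.
have mp : measurable_fun setT (EFin \o pdf).
  by apply/measurable_EFinP; exact: measurable_normal_pdf.
apply: integral_ae_eq => //.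
- exact: Radon_Nikodym_SigmaFinite.f_integrable.
- by move=> A _ mA; rewrite -Radon_Nikodym_SigmaFinite.f_integral.
Qed.

Lemma ge0_integral_normal_prob (h : R -> \bar R) :
  measurable_fun setT h -> (forall x, 0 <= h x)%E ->
  (\int[N01]_x h x = \int[mu]_x (h x * (pdf x)%:E))%E.
Proof.
move=> mh h0; have dom := @normal_prob_dominates R 0 1.
rewrite -(Radon_Nikodym_SigmaFinite.change_of_variables dom)//.
have mp : measurable_fun setT (EFin \o pdf).
  by apply/measurable_EFinP; exact: measurable_normal_pdf.
have mhp : measurable_fun setT (fun x => h x * (pdf x)%:E)%E.
  exact: emeasurable_funM.
apply: ae_eq_integral => //.
- apply: emeasurable_funM => //.
  apply: measurable_int; exact: Radon_Nikodym_SigmaFinite.f_integrable.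
- apply: filterS sigma_finite_RN_normal => x /= + _; by move=> ->.
Qed.

Lemma integrable_normal_prob (h : R -> R) : measurable_fun setT h ->
  N01.-integrable setT (EFin \o h) <->
  mu.-integrable setT (fun x => (h x * pdf x)%:E).
Proof.
move=> mh; have e : (\int[N01]_x `|(h x)%:E| = \int[mu]_x `|(h x * pdf x)%:E|)%E.
  rewrite ge0_integral_normal_prob//; last first.
    by apply: measurableT_comp => //; exact/measurable_EFinP.
  apply: eq_integral => x _ /=.
  by rewrite normrM (ger0_norm (normal_pdf_ge0 _ _ _)).
have mhp : measurable_fun setT (fun x => (h x * pdf x)%:E).
  by apply/measurable_EFinP/measurable_funM => //; exact: measurable_normal_pdf.
split => /integrableP[_ l]; apply/integrableP; split => //.
- by rewrite -e.
- exact/measurable_EFinP.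
- by rewrite /= e.
Qed.

Lemma integral_normal_prob (h : R -> R) : measurable_fun setT h ->
  N01.-integrable setT (EFin \o h) ->
  (\int[N01]_x (h x)%:E = \int[mu]_x (h x * pdf x)%:E)%E.
Proof.
move=> mh ih; have ihp := (integrable_normal_prob mh).1 ih.
rewrite [LHS]integralE [RHS]integralE.
have pM (b c : R) : 0 <= c -> (Num.max (b * c) 0 = Num.max b 0 * c)%R.
  by move=> c0; rewrite maxr_pMl// mul0r.
congr (_ - _)%E; rewrite ge0_integral_normal_prob//.
- by apply: eq_integral => x _; rewrite !funeposE /= -!EFin_max -EFinM -pM// normal_pdf_ge0.
- exact/measurable_funepos/measurable_EFinP.
- apply: eq_integral => x _.
  by rewrite !funenegE /= -!EFin_max -EFinM -pM ?normal_pdf_ge0// mulNr.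
- exact/measurable_funeneg/measurable_EFinP.
Qed.

(** The exponential series dominates each of its terms t^k / k!. *)
Lemma powM_expR_le (k : nat) (t : R) : 0 <= t -> t ^+ k * expR (- t) <= k`!%:R.
Proof.
move=> t0; rewrite expRN ler_pdivrMr ?expR_gt0//.
case: k => [|k]; first by rewrite expr0 fact0 mul1r -expR0 ler_expR.
have := expR_ge1Dxn k t0; have f0 : 0 < (k.+1)`!%:R :> R by rewrite ltr0n fact_gt0.
move=> h; rewrite mulrC -ler_pdivrMr//; apply: le_trans h.
by rewrite lerDr.
Qed.

Lemma normal_pdf01E (x : R) : pdf x = normal_peak 1 * expR (- (x ^+ 2 / 2)).
Proof.
rewrite normal_pdfE ?oner_eq0// /normal_fun subr0 expr1n; congr (_ * expR _).
by rewrite mulNr.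
Qed.

(** Half of the Gaussian exponent absorbs the power; the remaining half is, up to a constant, the
    density of variance 2. *)
Lemma integrable_pow_normal (k : nat) : N01.-integrable setT (fun x => (x ^+ k)%:E).
Proof.
apply/(integrable_normal_prob (h := fun x => x ^+ k)).
  exact: exprn_measurable.
have s0 : Num.sqrt 2 != 0 :> R by rewrite sqrtr_eq0 -ltNge.
(* With t = x^2 / 4, the bounds |x^k| <= 1 + 4^k t^k and t^k exp(-t) <= k! give the factor 1 + 4^k
   k!; the quotient of peaks changes the normalisation. *)
pose C : R := normal_peak 1 * (1 + 4 ^+ k * k`!%:R) / normal_peak (Num.sqrt 2).
have i2 : mu.-integrable setT (fun x => (C * normal_pdf 0 (Num.sqrt 2) x)%:E).
  have := integrable_normal_pdf (0 : R) (Num.sqrt 2).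
  by move=> /(integrableZl measurableT C).
apply: (le_integrable measurableT _ _ i2).
  apply/measurable_EFinP/measurable_funM; first exact: exprn_measurable.
  exact: measurable_normal_pdf.
move=> x _ /=; rewrite lee_fin normrM (ger0_norm (normal_pdf_ge0 _ _ _)).
have pk0 : 0 < normal_peak (1 : R) by rewrite normal_peak_gt0// oner_eq0.
have pk2 : 0 < normal_peak (Num.sqrt 2 : R) by rewrite normal_peak_gt0.
rewrite [leRHS]ger0_norm; last first.
  by rewrite mulr_ge0 ?normal_pdf_ge0// /C !mulr_ge0 ?invr_ge0 ?addr_ge0 ?mulr_ge0 ?exprn_ge0// ltW.
rewrite normal_pdf01E normal_pdfE// /C /normal_fun subr0 sqr_sqrtr//.
have -> : - x ^+ 2 / (2 *+ 2) = - (x ^+ 2 / 4) by rewrite mulNr; congr (- (_ / _)); ring.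
rewrite [leRHS](_ : _ = normal_peak 1 *
    ((1 + 4 ^+ k * k`!%:R) * expR (- (x ^+ 2 / 4)))); last first.
  by field; rewrite gt_eqF.
rewrite mulrCA ler_pM2l//.
set t := x ^+ 2 / 4.
have t0 : 0 <= t by rewrite /t divr_ge0// sqr_ge0.
have -> : - (x ^+ 2 / 2) = - t + - t by rewrite /t; field.
rewrite expRD mulrA ler_wpM2r ?expR_ge0//.
have h : `|x ^+ k| <= 1 + 4 ^+ k * t ^+ k.
  rewrite /t -exprMn mulrCA divff// mulr1 -exprM mulnC exprM.
  by rewrite -[x ^+ k ^+ 2]real_normK ?num_real//; nra.
apply: le_trans (ler_wpM2r (expR_ge0 _) h) _.
rewrite mulrDl mul1r lerD//.
  by rewrite -expR0 ler_expR oppr_le0.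
by rewrite -mulrA ler_wpM2l ?exprn_ge0// powM_expR_le.
Qed.

Lemma continuous_normal_pdf01 : continuous pdf.
Proof. apply: continuous_normal_pdf; exact: oner_neq0. Qed.

Lemma is_derive_normal_pdf01 (x : R) : is_derive x 1 pdf (- (x * pdf x)).
Proof.
have -> : pdf = cst (normal_peak 1) * (expR \o (cst (- 2^-1) * (@idfun R) ^+ 2))
    :> (R -> R).
  apply/funext => y; rewrite normal_pdf01E /= !fctE; congr (_ * expR _).
  by rewrite mulNr mulrC.
apply: is_derive_eq; rewrite !fctE /= !scaler0 !addr0 /GRing.scale /= expr1.
by field.
Qed.

(** The identity behind the moment recursion. At j = 0 the factor [j%:R] annihilates the term in
    which [j.-1] takes its default value. *)
Lemma is_derive_pow_normal_pdf01 (j : nat) (x : R) :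
  is_derive x 1 (fun y => y ^+ j * pdf y)
    (j%:R * (x ^+ j.-1 * pdf x) - x ^+ j.+1 * pdf x).
Proof.
have dp := is_derive_normal_pdf01 x.
case: j => [|j].
  rewrite (_ : (fun y => y ^+ 0 * pdf y) = pdf); last first.
    by apply/funext => y; rewrite expr0 mul1r.
  by apply: is_derive_eq; rewrite mul0r sub0r expr1.
have -> : (fun y => y ^+ j.+1 * pdf y) = (@idfun R) ^+ j.+1 * pdf.
  by apply/funext => y; rewrite !fctE.
apply: is_derive_eq; rewrite !fctE /GRing.scale /=.
by rewrite !exprS; ring.
Qed.

Lemma cvg_pow_normal_pdf01 (j : nat) :
  (n%:R : R) ^+ j * pdf n%:R @[n --> \oo] --> (0 : R).
Proof.
(* With t = n^2 / 2, n^(j+1) <= (2 t)^(j+1) and t^(j+1) exp(-t) <= (j+1)!; the one power of n in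
   excess of j leaves the factor 1/n. *)
pose C : R := normal_peak 1 * 2 ^+ j.+1 * (j.+1)`!%:R.
apply/norm_cvg0P; apply: (@squeeze_cvgr _ _ _ _ (cst 0) (fun n => C * (n%:R)^-1)).
- near=> n; rewrite normr_ge0 /=.
  have n0 : 0 < n%:R :> R by rewrite ltr0n; near: n; exact: nbhs_infty_gt.
  rewrite ger0_norm ?mulr_ge0 ?normal_pdf_ge0// ler_pdivlMr//.
  rewrite normal_pdf01E; set t := n%:R ^+ 2 / 2.
  have t0 : 0 <= t by rewrite /t divr_ge0// sqr_ge0.
  have h := powM_expR_le j.+1 t0.
  apply: (@le_trans _ _ (normal_peak 1 * 2 ^+ j.+1 * (t ^+ j.+1 * expR (- t)))).
    have -> : 2 ^+ j.+1 = 2 ^+ j.+1 :> R by [].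
    rewrite [leRHS](_ : _ = normal_peak 1 * ((2 * t) ^+ j.+1 * expR (- t))); last first.
      by rewrite [(2 * t) ^+ _]exprMn !mulrA.
    rewrite [leLHS](_ : _ = normal_peak 1 * (n%:R ^+ j.+1 * expR (- t))); last first.
      by rewrite exprS; ring.
    rewrite ler_wpM2l ?normal_peak_ge0// ler_wpM2r ?expR_ge0//.
    rewrite /t mulrCA divff// mulr1 -exprM; apply: ler_weXn2l.
      by rewrite ler1n -(ltr_nat R).
    by rewrite mul2n -addnn leq_addr.
  by rewrite /C ler_wpM2l// mulr_ge0 ?normal_peak_ge0 ?exprn_ge0.
- exact: cvg_cst.
- rewrite -[X in _ --> X](mulr0 C); apply: cvgMr.
  by rewrite -(cvg_shiftS (fun n : nat => (n%:R : R)^-1)); exact: cvg_harmonic.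
Unshelve. all: by end_near. Qed.

(** The fundamental theorem of calculus on [-n, n] leaves two vanishing boundary terms, and
    dominated convergence by |h| lets n tend to infinity. *)
Lemma integral_derive_eq0 (F h : R -> R) :
  (forall x : R, is_derive x (1 : R) F (h x)) -> continuous h ->
  mu.-integrable setT (EFin \o h) ->
  F n%:R @[n --> \oo] --> (0 : R) -> F (- n%:R) @[n --> \oo] --> (0 : R) ->
  (\int[mu]_x (h x)%:E = 0)%E.
Proof.
move=> dF ch ih F1 F2.
pose h_ n x : \bar R := ((EFin \o h) \_ `[- n%:R, n%:R]) x.
have mh : measurable_fun setT (EFin \o h) by exact: measurable_int ih.
have int_n n : (0 < n)%N -> (\int[mu]_x h_ n x = (F n%:R - F (- n%:R))%:E)%E.
  move=> n0; rewrite /h_ -integral_mkcond.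
  have lt : - n%:R < n%:R :> R by rewrite gtrN// ltr0n.
  have dd x : derivable F x 1 by have [] := dF x.
  have cF x : {for x, continuous F} by exact/differentiable_continuous/derivable1_diffP.
  rewrite /= (continuous_FTC2 lt (F := F)) ?EFinB//.
  - exact: continuous_subspaceT.
  - split; [by []|apply: cvg_at_right_filter|apply: cvg_at_left_filter]; exact: cF.
  - by move=> x _; rewrite derive1E; exact: derive_val.
have mh_ n : measurable_fun setT (h_ n).
  apply/(measurable_restrictT _ _).1 => //; exact: measurable_funTS.
have [] := @dominated_convergence _ _ _ mu setT measurableT h_ (EFin \o h)
  (abse \o (EFin \o h)) mh_ mh.
- apply: aeW => x _; apply: cvg_near_cst; near=> n.
  rewrite /h_ patchE mem_set//= in_itv /=.
  by rewrite -ler_norml; near: n; exact: nbhs_infty_ger.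
- exact: integrable_abse.
- apply: aeW => x n _; rewrite /h_ patchE; case: ifP => //= _.
  by rewrite normr0 lee_fin.
move=> _ _ cv.
have cv0 : (\int[mu]_x h_ n x)%E @[n --> \oo] --> (0 : \bar R)%E.
  have FF : (F n%:R - F (- n%:R))%:E @[n --> \oo] --> (0 : \bar R)%E.
    by apply: cvg_EFin; [exact: nearW|rewrite -[X in _ --> X](subr0 (0 : R)); exact: cvgB].
  apply: cvg_trans FF; apply: near_eq_cvg; near=> n; rewrite int_n//.
  by near: n; exact: nbhs_infty_gt.
by have := cvg_unique _ cv cv0; apply.
Unshelve. all: by end_near. Qed.

(** Integration by parts: the derivative of x^j times the density integrates to zero. The case j = 0
    gives the vanishing mean. *)
Lemma normal_moment_rec (j : nat) :
  (\int[N01]_x (x ^+ j.+1)%:E = j%:R%:E * \int[N01]_x (x ^+ j.-1)%:E)%E.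
Proof.
have iX k := integrable_pow_normal k.
have mX k : measurable_fun setT (fun x : R => x ^+ k) by exact: exprn_measurable.
rewrite !integral_normal_prob//; try exact: iX.
have iXp k := (integrable_normal_prob (mX k)).1 (iX k).
pose g k x := x ^+ k * pdf x.
have cg k : continuous (g k).
  by move=> x; apply: cvgM; [exact: exprn_continuous|exact: continuous_normal_pdf01].
have : (\int[mu]_x (j%:R * g j.-1 x - g j.+1 x)%:E = 0)%E.
  apply: (integral_derive_eq0 (is_derive_pow_normal_pdf01 j)).
  - by move=> x; apply: cvgB; [apply: cvgM; [exact: cvg_cst|exact: cg]|exact: cg].
  - have := integrableB measurableT (integrableZl measurableT j%:R (iXp j.-1)) (iXp j.+1).
    by apply: eq_integrable => // x _; rewrite /= EFinB EFinM.
  - exact: cvg_pow_normal_pdf01.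
  - have -> : (fun n : nat => (- n%:R) ^+ j * pdf (- n%:R)) =
        (fun n => (-1) ^+ j * (n%:R ^+ j * pdf n%:R)).
      by apply/funext => n; rewrite exprNn -mulrA !normal_pdf01E sqrrN.
    rewrite -[X in _ --> X](mulr0 ((-1) ^+ j)); apply: cvgMr.
    exact: cvg_pow_normal_pdf01.
under eq_integral do rewrite EFinB EFinM.
rewrite (integralB measurableT (integrableZl measurableT j%:R (iXp j.-1)) (iXp j.+1)).
rewrite (integralZl measurableT (iXp j.-1)).
move/eqP; rewrite sube_eq ?add0e => [/eqP <-//| |].
  rewrite fin_numM//; apply: integrable_fin_num => //; exact: iXp.
by rewrite fin_num_adde_defl//; apply: integrable_fin_num => //; exact: iXp.
Qed.

Lemma normal_moment1 : (\int[N01]_x x%:E = 0)%E.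
Proof. by have := normal_moment_rec 0; rewrite mul0e. Qed.

Lemma normal_moment2 : (\int[N01]_x (x ^+ 2)%:E = 1)%E.
Proof.
rewrite normal_moment_rec /= mul1e; under eq_integral do rewrite expr0.
rewrite integral_cst// mul1e; exact: (probability_setT N01).
Qed.

Lemma normal_moment4 : (\int[N01]_x (x ^+ 4)%:E = 3%:E)%E.
Proof. by rewrite normal_moment_rec /= normal_moment2 mule1. Qed.

Lemma normal_moment6 : (\int[N01]_x (x ^+ 6)%:E = 15%:E)%E.
Proof.
by rewrite normal_moment_rec /= normal_moment4 -EFinM; congr _%:E; ring.
Qed.

End GaussianMoments.

(** * Random variables with moments of all orders *)

Section AllMoments.
Context {R : realType} {d : measure_display} {Omega : measurableType d}.
Variable P : probability Omega R.

Definition integrableR (X : Omega -> R) := P.-integrable setT (EFin \o X).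

Lemma integrableR_le (X Y : Omega -> R) : measurable_fun setT X ->
  integrableR Y -> (forall w, `|X w| <= Y w) -> integrableR X.
Proof.
move=> mX iY XY; apply: (le_integrable measurableT _ _ iY).
  exact/measurable_EFinP.
by move=> w _ /=; rewrite lee_fin (le_trans (XY w))// ler_norm.
Qed.

Lemma integrableR_cst (c : R) : integrableR (cst c).
Proof.
apply/integrableP; split; first exact/measurable_EFinP.
under eq_integral do rewrite /=.
by rewrite integral_cst// [X in (_ * X)%E](probability_setT P) mule1 ltry.
Qed.

Lemma integrableRD (X Y : Omega -> R) :
  integrableR X -> integrableR Y -> integrableR (fun w => X w + Y w).
Proof. by move=> iX iY; have := integrableD measurableT iX iY. Qed.

Lemma integrableRZ (c : R) (X : Omega -> R) :
  integrableR X -> integrableR (fun w => c * X w).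
Proof. by move=> iX; have := integrableZl measurableT c iX. Qed.

Lemma integrableR_measurable (X : Omega -> R) :
  integrableR X -> measurable_fun setT X.
Proof. by move=> iX; apply/measurable_EFinP; exact: measurable_int iX. Qed.

(** An algebra of random variables: closure under sums and products makes every polynomial in
    Gaussian coordinates integrable without a separate estimate. *)
Definition all_moments (X : Omega -> R) :=
  measurable_fun setT X /\ forall k, integrableR (fun w => X w ^+ k).

Lemma all_moments_integrable (X : Omega -> R) : all_moments X -> integrableR X.
Proof. by move=> [_ /(_ 1%N)]. Qed.

Lemma all_moments_cst (c : R) : all_moments (cst c).
Proof. by split=> // k; exact: (integrableR_cst (c ^+ k)). Qed.

Lemma all_momentsM (X Y : Omega -> R) :
  all_moments X -> all_moments Y -> all_moments (fun w => X w * Y w).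
Proof.
move=> [mX aX] [mY aY]; have mXY : measurable_fun setT (fun w => X w * Y w).
  exact: measurable_funM.
split=> // k; apply: integrableR_le (integrableRD (aX (k * 2)%N) (aY (k * 2)%N)) _.
  exact: measurable_funX.
move=> w; rewrite exprMn normrM !exprM -(real_normK (num_real (X w ^+ k))).
rewrite -(real_normK (num_real (Y w ^+ k))).
by have := sqr_ge0 (`|X w ^+ k| - `|Y w ^+ k|); have := normr_ge0 (X w ^+ k);
  have := normr_ge0 (Y w ^+ k); nra.
Qed.

Lemma all_momentsD (X Y : Omega -> R) :
  all_moments X -> all_moments Y -> all_moments (fun w => X w + Y w).
Proof.
move=> [mX aX] [mY aY]; have mXY : measurable_fun setT (fun w => X w + Y w).
  exact: measurable_funD.
split=> // k.
apply: integrableR_le (integrableRZ (2 ^+ k) (integrableRD (integrableR_cst 2)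
  (integrableRD (aX (k * 2)%N) (aY (k * 2)%N)))) _.
  exact: measurable_funX.
move=> w; rewrite normrX.
have le1 : `|X w + Y w| <= 2 * Num.max `|X w| `|Y w|.
  apply: le_trans (ler_normD _ _) _.
  by rewrite mulr_natl mulr2n lerD// le_max lexx ?orbT.
apply: (@le_trans _ _ ((2 * Num.max `|X w| `|Y w|) ^+ k)).
  by apply: lerXn2r => //; rewrite nnegrE mulr_ge0// le_max normr_ge0.
rewrite exprMn ler_wpM2l ?exprn_ge0//.
have sq (a : R) : `|a| ^+ k <= 1 + a ^+ (k * 2).
  rewrite -normrX exprM -(real_normK (num_real (a ^+ k))).
  by have := sqr_ge0 (`|a ^+ k| - 1); have := normr_ge0 (a ^+ k); nra.
have p (a : R) : 0 <= a ^+ (k * 2) by rewrite exprM sqr_ge0.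
have := sq (X w); have := sq (Y w); have := p (X w); have := p (Y w).
by case: (lerP `|X w| `|Y w|) => _ /=; lra.
Qed.

Lemma all_moments_sum (I : Type) (s : seq I) (X : I -> Omega -> R) :
  (forall i, all_moments (X i)) -> all_moments (fun w => \sum_(i <- s) X i w).
Proof.
move=> aX; elim: s => [|i s IH].
  by under eq_fun do rewrite big_nil; exact: all_moments_cst.
by under eq_fun do rewrite big_cons; exact: all_momentsD.
Qed.

Lemma all_momentsX (X : Omega -> R) (k : nat) :
  all_moments X -> all_moments (fun w => X w ^+ k).
Proof.
move=> [mX aX]; split; first exact: measurable_funX.
by move=> j; under eq_fun do rewrite -exprM; exact: aX.
Qed.

Lemma expectD (X Y : Omega -> R) : integrableR X -> integrableR Y ->
  \int[P]_w (X w + Y w) = \int[P]_w X w + \int[P]_w Y w.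
Proof. by move=> iX iY; exact: RintegralD. Qed.

Lemma expectZ (c : R) (X : Omega -> R) : integrableR X ->
  \int[P]_w (c * X w) = c * \int[P]_w X w.
Proof. by move=> iX; exact: RintegralZl. Qed.

Lemma expect_indepM (X Y : Omega -> R) : independent_maps P X Y ->
  integrableR X -> integrableR Y ->
  \int[P]_w (X w * Y w) = \int[P]_w X w * \int[P]_w Y w.
Proof.
move=> ind iX iY; rewrite /Rintegral independent_expectationM// fineM//;
exact: integrable_fin_num.
Qed.

Lemma expect_cst (c : R) : \int[P]_w (cst c) w = c.
Proof. by rewrite Rintegral_cst// [X in fine X](probability_setT P) mulr1. Qed.

Lemma EFin_expect (X : Omega -> R) : integrableR X ->
  (\int[P]_w X w)%:E = (\int[P]_w (X w)%:E)%E.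
Proof. by move=> iX; rewrite /Rintegral fineK//; exact: integrable_fin_num. Qed.

End AllMoments.

Lemma measurable_sum_seq {R : realType} {d} {T : measurableType d} (I : eqType)
    (s : seq I) (X : I -> T -> R) :
  (forall i, i \in s -> measurable_fun setT (X i)) ->
  measurable_fun setT (fun w => \sum_(i <- s) X i w).
Proof.
elim: s => [|i s IH] mX.
  by under eq_fun do rewrite big_nil; exact: measurable_cst.
under eq_fun do rewrite big_cons.
apply: measurable_funD; first by apply: mX; rewrite mem_head.
by apply: IH => j js; apply: mX; rewrite inE js orbT.
Qed.

(** * Maps measurable for a generated sigma-algebra *)

Section GeneratedMaps.
Context {R : realType} {d : measure_display} {Omega : measurableType d}.

(** [g_sigma_algebraType S] re-equips [Omega] with the sigma-algebra generated by [S], so the usual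
    closure properties of measurable functions show that a map depends only on the draws behind
    [S]. *)
Definition gmeasurable {d1} {T1 : measurableType d1} (S : set (set Omega))
    (f : Omega -> T1) : Prop :=
  @measurable_fun _ _ (g_sigma_algebraType S) T1 setT f.

Lemma gmeasurableP {d1} {T1 : measurableType d1} (S : set (set Omega))
    (f : Omega -> T1) :
  gmeasurable S f <-> forall A, measurable A -> <<s S >> (f @^-1` A).
Proof.
split=> [mf A mA|mf _ A mA]; first by have := mf measurableT A mA; rewrite setTI.
by rewrite setTI; exact: mf.
Qed.

Lemma gmeasurable_sub {d1} {T1 : measurableType d1} (S S' : set (set Omega))
    (f : Omega -> T1) : S `<=` <<s S' >> -> gmeasurable S f -> gmeasurable S' f.
Proof.
move=> SS' /gmeasurableP mf; apply/gmeasurableP => A /mf.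
by apply: smallest_sub => //; exact: smallest_sigma_algebra.
Qed.

Lemma gmeasurable_measurable {d1} {T1 : measurableType d1} (S : set (set Omega))
    (f : Omega -> T1) : S `<=` measurable -> gmeasurable S f ->
  measurable_fun setT f.
Proof.
move=> Sm /gmeasurableP mf _ A mA; rewrite setTI.
have := mf _ mA; apply: smallest_sub => //; exact: sigma_algebra_measurable.
Qed.

Variables (P : probability Omega R) (J : Type) (V : set J).
Variable G : J -> set (set Omega).
Hypotheses (indepG : mutually_independent P V G)
  (GT : forall j, V j -> G j setT)
  (GI : forall j, V j -> setI_closed (G j))
  (mG : forall j, V j -> G j `<=` measurable).

Lemma gmeasurable_independent {d1 d2} {T1 : measurableType d1}
    {T2 : measurableType d2} (A B : set J) (f : Omega -> T1) (g : Omega -> T2) :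
  A `<=` V -> B `<=` V -> A `&` B = set0 ->
  gmeasurable (\bigcup_(j in A) G j) f -> gmeasurable (\bigcup_(j in B) G j) g ->
  independent_maps P f g.
Proof.
move=> AV BV AB /gmeasurableP mf /gmeasurableP mg E F mE mF.
by apply: (indep_generated indepG GT GI mG AV BV AB); [exact: mf|exact: mg].
Qed.
End GeneratedMaps.

Section SigmaOf.
Context {Omega T : Type}.

Lemma sigma_of_setT (S : set (set T)) (Y : Omega -> T) : S setT -> sigma_of S Y setT.
Proof. by move=> ST; exists setT => //; rewrite preimage_setT setTI. Qed.

Lemma sigma_of_setI (S : set (set T)) (Y : Omega -> T) :
  setI_closed S -> setI_closed (sigma_of S Y).
Proof.
move=> SI _ _ [A SA <-] [B SB <-]; exists (A `&` B); first exact: SI.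
by rewrite preimage_setI !setTI.
Qed.

Lemma sigma_ofP (S : set (set T)) (Y : Omega -> T) (A : set T) :
  S A -> sigma_of S Y (Y @^-1` A).
Proof. by move=> SA; exists A => //; rewrite setTI. Qed.
End SigmaOf.

(** * Moments of a standard Gaussian vector *)

Section GaussianVector.
Context {R : realType} {d : measure_display} {Omega : measurableType d}.
Variables (P : probability Omega R) (n : nat) (u : Omega -> 'cV[R]_n).
Hypotheses (gu : standard_gaussian P u)
  (mu_ : forall i, measurable_fun setT (fun w => u w i 0 : R)).

Let v (i : 'I_n) (w : Omega) : R := u w i 0.
Let G i := sigma_of measurable (v i).

Lemma gaussian_coord_law i A : measurable A -> P (v i @^-1` A) = normal_prob 0 1 A.
Proof.
move=> mA; pose B (j : 'I_n) := if j == i then A else setT.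
have mB j : measurable (B j) by rewrite /B; case: ifP.
have <- : [set w | forall a, B a (u w a 0)] = v i @^-1` A.
  apply/seteqP; split => w /=; first by move=> /(_ i); rewrite /B eqxx.
  by move=> Aw a; rewrite /B; case: eqP => // ->.
rewrite gu// (bigD1 i)//= {1}/B eqxx big1 ?mule1// => j /negbTE ji.
by rewrite /B ji; exact: (probability_setT (normal_prob 0 1)).
Qed.

Lemma gaussian_coord_indep : mutually_independent P setT G.
Proof.
move=> m j E jinj _ GE.
have [A mA AE] : exists2 A : 'I_m -> set R, forall a, measurable (A a) &
    forall a, E a = v (j a) @^-1` (A a).
  have /choice[A AP] : forall a, exists A : set R, measurable A /\ E a = v (j a) @^-1` A.
    by move=> a; have [A mA <-] := GE a; exists A; rewrite setTI.
  by exists A => a; have [] := AP a.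
(* The events are regrouped by coordinate; as [j] is injective at most one contributes, and a
   coordinate outside its image receives [setT]. *)
pose B (i : 'I_n) := \big[setI/setT]_(a < m | j a == i) A a.
have mB i : measurable (B i) by apply: bigsetI_measurable.
have BE a : B (j a) = A a.
  rewrite /B (eq_bigl (pred1 a)) ?big_pred1_eq// => a' /=.
  by apply/eqP/eqP => [/jinj|->].
have -> : \big[setI/setT]_(a < m) E a = [set w | forall i, B i (u w i 0)].
  rewrite -bigcap_seq; apply/seteqP; split => w /=.
    move=> h i; rewrite /B -bigcap_seq_cond => a /= /andP[_ /eqP <-].
    by have := h a (mem_index_enum _); rewrite AE.
  by move=> h a _; rewrite AE /=; have := h (j a); rewrite BE.
rewrite gu//.
have -> : (\prod_(a < m) P (E a) = \prod_(a < m) normal_prob 0 1 (B (j a)))%E.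
  by apply: eq_bigr => a _; rewrite AE gaussian_coord_law// BE.
rewrite (bigID (fun i => i \in [set j a | a in [set: 'I_m]%SET]%SET))/=.
rewrite [X in (_ * X)%E]big1 ?mule1; last first.
  move=> i inj; rewrite /B big_pred0 => [|a].
    exact: (probability_setT (normal_prob 0 1)).
  by apply/negP => /eqP ja; move: inj; rewrite -ja imset_f// inE.
rewrite big_imset /=; last by move=> a b _ _; exact: jinj.
by apply: eq_bigl => a; rewrite inE.
Qed.

Let vp i : {mfun Omega >-> measurableTypeR R} :=
  HB.pack (v i) (@isMeasurableFun.Build _ _ Omega (measurableTypeR R) (v i) (mu_ i)).

Let distribution_vp i A : measurable A -> distribution P (vp i) A = normal_prob 0 1 A.
Proof. exact: gaussian_coord_law. Qed.

Let integral_vp i (h : R -> \bar R) :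
  (\int[distribution P (vp i)]_y h y = \int[normal_prob 0 1]_y h y)%E.
Proof.
apply: eq_measure_integral; by move=> A mA _; exact: distribution_vp.
Qed.


Lemma gaussian_coord_moments i : all_moments P (v i).
Proof.
split; [exact: mu_|move=> k; have iN := @integrable_pow_normal R k].
have mX : measurable_fun setT (fun w => v i w ^+ k).
  by apply: measurable_funX; exact: mu_.
apply/integrableP; split; first exact/measurable_EFinP.
have mk : measurable_fun setT (fun x : R => `|(x ^+ k)%:E|%E).
  by apply: measurableT_comp => //; apply/measurable_EFinP; exact: exprn_measurable.
have := ge0_integral_distribution (P := P) (vp i) mk (fun=> abse_ge0 _).
move=> /= <-; rewrite integral_vp.
by have /integrableP[] := iN.
Qed.

Lemma gaussian_coord_moment i k :
  (\int[P]_w (v i w ^+ k)%:E = \int[normal_prob 0 1]_x (x ^+ k)%:E)%E.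
Proof.
have mk : measurable_fun setT (fun x : R => (x ^+ k)%:E).
  by apply/measurable_EFinP; exact: exprn_measurable.
rewrite -[LHS](integral_distribution (X := vp i) mk); last first.
  by have [_] := gaussian_coord_moments i; exact.
exact: integral_vp.
Qed.

Lemma gaussian_coord_expect i : [/\ \int[P]_w v i w = 0,
  \int[P]_w (v i w ^+ 2) = 1, \int[P]_w (v i w ^+ 4) = 3 &
  \int[P]_w (v i w ^+ 6) = 15].
Proof.
rewrite /Rintegral !gaussian_coord_moment.
by rewrite normal_moment2 normal_moment4 normal_moment6
  -[X in fine X]/(\int[P]_w (v i w ^+ 1)%:E)%E gaussian_coord_moment normal_moment1.
Qed.

(** Partial sums of |u|^2 and <g, u> over a list of coordinates: the full moments follow by adding
    one independent coordinate at a time. *)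
Let SS (s : seq 'I_n) w := \sum_(i <- s) v i w ^+ 2.
Let DD (g : 'cV[R]_n) (s : seq 'I_n) w := \sum_(i <- s) g i 0 * v i w.

Let am_SS s : all_moments P (SS s).
Proof. by apply: all_moments_sum => i; exact/all_momentsX/gaussian_coord_moments. Qed.

Let am_DD g s : all_moments P (DD g s).
Proof.
apply: all_moments_sum => i.
by apply: all_momentsM; [exact: all_moments_cst|exact: gaussian_coord_moments].
Qed.

Let coord_gmeasurable (A : set 'I_n) i : A i ->
  gmeasurable (\bigcup_(j in A) G j) (v i).
Proof.
move=> Ai; apply/gmeasurableP => B mB; apply: sub_gen_smallest.
by exists i => //; exact: sigma_ofP.
Qed.

(** The sums are kept as a pair because the mixed moment of [DD] and [SS] needs them jointly
    independent of the new coordinate. *)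
Let pair_indep g s i : i \notin s ->
  independent_maps P (fun w => (DD g s w, SS s w)) (v i).
Proof.
move=> si; apply: (gmeasurable_independent gaussian_coord_indep _ _ _
  (A := [set` s]) (B := [set i])) => //.
- by move=> j _; exact: sigma_of_setT.
- by move=> j _; apply: sigma_of_setI => A B; exact: measurableI.
- by move=> j _ _ [A mA <-]; exact: mu_.
- by apply/seteqP; split => // j /= [js ji]; move: si; rewrite -ji js.
- apply/measurable_fun_pairP; split; apply: measurable_sum_seq => j js.
    by apply: measurable_funM; [exact: measurable_cst|exact: coord_gmeasurable].
  by apply: measurable_funX; exact: coord_gmeasurable.
- exact: coord_gmeasurable.
Qed.

Let indep g s i (f : R * R -> R) k : i \notin s -> measurable_fun setT f ->
  independent_maps P (fun w => f (DD g s w, SS s w)) (fun w => v i w ^+ k).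
Proof.
move=> si mf.
exact: (independent_maps_comp (g := fun x : R => x ^+ k) (pair_indep g si) mf
  (@exprn_measurable _ _ k)).
Qed.

Let expM g s i (X : Omega -> R) (f : R * R -> R) k : i \notin s ->
  measurable_fun setT f -> (forall w, X w = f (DD g s w, SS s w)) ->
  all_moments P X ->
  \int[P]_w (X w * v i w ^+ k) = \int[P]_w X w * \int[P]_w (v i w ^+ k).
Proof.
move=> si mf XE aX; apply: expect_indepM; last 2 first.
- exact: all_moments_integrable.
- exact/all_moments_integrable/all_momentsX/gaussian_coord_moments.
by have := indep g k si mf; under eq_fun do rewrite -XE.
Qed.

(** Induction on the list: powers of the enlarged sums are expanded and each mixed term factors by
    independence. The moments of [SS] are those of a chi-square variable with m degrees of
    freedom. *)
Let partial_moments g (s : seq 'I_n) : uniq s -> let m := (size s)%:R in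
  [/\ \int[P]_w SS s w = m, \int[P]_w (SS s w ^+ 2) = m * (m + 2) &
      \int[P]_w (SS s w ^+ 3) = m * (m + 2) * (m + 4)] /\
  [/\ \int[P]_w DD g s w = 0, \int[P]_w (DD g s w ^+ 2) = \sum_(i <- s) g i 0 ^+ 2 &
      \int[P]_w (DD g s w ^+ 2 * SS s w) = (m + 2) * \sum_(i <- s) g i 0 ^+ 2].
Proof.
elim: s => [_|i s IH] /=.
  have z k : \int[P]_w (SS [::] w ^+ k.+1) = 0.
    under eq_Rintegral do rewrite /SS big_nil expr0n.
    exact: expect_cst.
  have zD k : \int[P]_w (DD g [::] w ^+ k.+1) = 0.
    under eq_Rintegral do rewrite /DD big_nil expr0n.
    exact: expect_cst.
  rewrite !z !zD (z 0%N) (zD 0%N) big_nil !mul0r mulr0; split => //; split => //.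
  under eq_Rintegral do rewrite /SS big_nil mulr0.
  exact: expect_cst.
move=> /andP[si us]; have [[S1 S2 S3] [D1 D2 DS]] := IH us.
have [v1 v2 v4 v6] := gaussian_coord_expect i.
have aV := gaussian_coord_moments i; have aS := am_SS s; have aD := am_DD g s.
have mfst := @measurable_fst _ _ R R; have msnd := @measurable_snd _ _ R R.
have aSk k := all_momentsX k aS; have aVk k := all_momentsX k aV.
have aDk k := all_momentsX k aD.
have iSV k l : integrableR P (fun w => SS s w ^+ k * v i w ^+ l).
  exact/all_moments_integrable/all_momentsM.
have iDV k l : integrableR P (fun w => DD g s w ^+ k * v i w ^+ l).
  exact/all_moments_integrable/all_momentsM.
have iV k := all_moments_integrable (aVk k).
have iS k := all_moments_integrable (aSk k).
have iD k := all_moments_integrable (aDk k).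
have eSV k l : \int[P]_w (SS s w ^+ k * v i w ^+ l) =
    \int[P]_w (SS s w ^+ k) * \int[P]_w (v i w ^+ l).
  exact: (expM (g := g) (f := fun q => q.2 ^+ k) l si (measurable_funX k msnd) (fun=> erefl) (aSk k)).
have eDV k l : \int[P]_w (DD g s w ^+ k * v i w ^+ l) =
    \int[P]_w (DD g s w ^+ k) * \int[P]_w (v i w ^+ l).
  exact: (expM (g := g) (f := fun q => q.1 ^+ k) l si (measurable_funX k mfst) (fun=> erefl) (aDk k)).
have aDS : all_moments P (fun w => DD g s w * SS s w) by exact: all_momentsM.
have aD2S : all_moments P (fun w => DD g s w ^+ 2 * SS s w) by exact: all_momentsM.
have iDSV : integrableR P (fun w => DD g s w * SS s w * v i w ^+ 1).
  exact/all_moments_integrable/all_momentsM.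
have eDSV : \int[P]_w (DD g s w * SS s w * v i w ^+ 1) =
    \int[P]_w (DD g s w * SS s w) * \int[P]_w (v i w ^+ 1).
  exact: (expM (g := g) (f := fun q => q.1 * q.2) 1 si (measurable_funM mfst msnd) (fun=> erefl) aDS).
have SE w : SS (i :: s) w = SS s w + v i w ^+ 2 by rewrite /SS big_cons addrC.
have DE w : DD g (i :: s) w = DD g s w + g i 0 * v i w by rewrite /DD big_cons addrC.
have sz : (size s).+1%:R = (size s)%:R + 1 :> R by rewrite -natr1.
rewrite big_cons sz.
split; split.
- under eq_Rintegral do rewrite SE.
  by rewrite expectD//= ?S1 ?v2//; exact: all_moments_integrable.
- transitivity (\int[P]_w (SS s w ^+ 2 + (2 * (SS s w ^+ 1 * v i w ^+ 2) + v i w ^+ 4))).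
    by apply: eq_Rintegral => w _; rewrite SE; ring.
  rewrite !expectD ?expectZ ?eSV ?S1 ?S2 ?v2 ?v4; try by repeat first [exact: iSV|exact: iDV|exact: iV|exact: iS|exact: iD|exact: iDSV|assumption|apply: integrableRD|apply: integrableRZ].
  ring.
- transitivity (\int[P]_w (SS s w ^+ 3 + (3 * (SS s w ^+ 2 * v i w ^+ 2)
    + (3 * (SS s w ^+ 1 * v i w ^+ 4) + v i w ^+ 6)))).
    by apply: eq_Rintegral => w _; rewrite SE; ring.
  rewrite !expectD ?expectZ ?eSV ?S2 ?S3 ?v2 ?v4 ?v6; try by repeat first [exact: iSV|exact: iDV|exact: iV|exact: iS|exact: iD|exact: iDSV|assumption|apply: integrableRD|apply: integrableRZ].
  rewrite ?S1; ring.
- under eq_Rintegral do rewrite DE.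
  rewrite expectD ?expectZ ?D1 ?v1 ?mulr0 ?addr0//;
  try exact: all_moments_integrable; apply: integrableRZ; exact: all_moments_integrable.
- transitivity (\int[P]_w (DD g s w ^+ 2 + (2 * g i 0 * (DD g s w ^+ 1 * v i w ^+ 1)
    + g i 0 ^+ 2 * v i w ^+ 2))).
    by apply: eq_Rintegral => w _; rewrite DE; ring.
  rewrite !expectD ?expectZ ?eDV ?D2 ?v2; try by repeat first [exact: iSV|exact: iDV|exact: iV|exact: iS|exact: iD|exact: iDSV|assumption|apply: integrableRD|apply: integrableRZ].
  rewrite ?v1 ?D1; ring.
(* Two factors are never evaluated: E[D S] is multiplied by E[v_i] = 0, and E[v_i^3] by E[D] = 0. *)
- transitivity (\int[P]_w (DD g s w ^+ 2 * SS s w + (DD g s w ^+ 2 * v i w ^+ 2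
    + (2 * g i 0 * (DD g s w * SS s w * v i w ^+ 1)
    + (2 * g i 0 * (DD g s w ^+ 1 * v i w ^+ 3)
    + (g i 0 ^+ 2 * (SS s w ^+ 1 * v i w ^+ 2)
    + g i 0 ^+ 2 * v i w ^+ 4)))))).
    by apply: eq_Rintegral => w _; rewrite SE DE; ring.
  have iD2S := all_moments_integrable aD2S.
  rewrite !expectD ?expectZ ?eDV ?eSV ?eDSV ?DS ?D2 ?v2 ?v4; try by repeat first [exact: iSV|exact: iDV|exact: iV|exact: iS|exact: iD|exact: iDSV|assumption|apply: integrableRD|apply: integrableRZ].
  rewrite ?v1 ?D1 ?S1.
  ring.
Qed.

Lemma norm_sq_sum w : dotv (u w) (u w) = SS (index_enum 'I_n) w.
Proof. by apply: eq_bigr => i _; rewrite expr2. Qed.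

Lemma gaussian_norm2_moments (g : 'cV[R]_n) :
  all_moments P (fun w => dotv (u w) (u w)) /\ all_moments P (fun w => dotv g (u w)).
Proof.
split; last exact: am_DD.
by under eq_fun do rewrite norm_sq_sum; exact: am_SS.
Qed.

Lemma gaussian_dotv_moment3 :
  \int[P]_w (dotv (u w) (u w) ^+ 3) = n%:R * (n%:R + 2) * (n%:R + 4).
Proof.
have [[_ _]] := partial_moments 0 (index_enum_uniq 'I_n).
rewrite [size _](_ : _ = n); last by rewrite -[RHS]card_ord cardE enumT.
by move=> <- _; apply: eq_Rintegral => w _; rewrite norm_sq_sum.
Qed.

Lemma gaussian_quadratic_moment (g : 'cV[R]_n) :
  \int[P]_w (dotv g (u w) ^+ 2 * dotv (u w) (u w)) = (n%:R + 2) * dotv g g.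
Proof.
have [_ [_ _]] := partial_moments g (index_enum_uniq 'I_n).
rewrite [size _](_ : _ = n); last by rewrite -[RHS]card_ord cardE enumT.
rewrite (_ : \sum_(i <- _) _ = dotv g g); last first.
  by apply: eq_bigr => i _; rewrite expr2.
by move=> <-; apply: eq_Rintegral => w _; rewrite norm_sq_sum.
Qed.

Lemma gaussian_cov i j : \int[P]_w (v i w * v j w) = (i == j)%:R.
Proof.
have [<-|ij] := eqVneq i j; first by have [] := gaussian_coord_expect i.
have si : j \notin [:: i] by rewrite inE eq_sym.
(* With all coefficients 1 and the single index i, the linear form [DD] is the coordinate [v i]. *)
have := expM (g := const_mx 1) (f := fst) 1 si (@measurable_fst _ _ R R) (fun=> erefl) (am_DD _ _).
have [vi _ _ _] := gaussian_coord_expect i.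
have e w : DD (const_mx 1) [:: i] w = v i w by rewrite /DD big_seq1 mxE mul1r.
under eq_Rintegral do rewrite e.
under [X in _ = X * _ -> _]eq_Rintegral do rewrite e.
by rewrite vi mul0r.
Qed.

End GaussianVector.

(** * Borel measurability and Euclidean algebra on column vectors *)

Lemma countable_bigcup_measurable d (T : measurableType d) (K : countType)
    (I : set K) (A : K -> set T) :
  (forall i, I i -> measurable (A i)) -> measurable (\bigcup_(i in I) A i).
Proof.
move=> mA; pose B m := if unpickle m is Some i then
  if asbool (I i) then A i else set0 else set0.
have -> : \bigcup_(i in I) A i = \bigcup_m B m.
  apply/seteqP; split => [w [i Ii Aw]|w [m _]].
    by exists (pickle i) => //; rewrite /B pickleK asboolT.
  rewrite /B; case: unpickle => // i; case: asboolP => // Ii Aw.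
  by exists i.
apply: bigcupT_measurable => m; rewrite /B.
by case: unpickle => // i; case: asboolP => // /mA.
Qed.

Section BorelVectors.
Context {R : realType}.

Definition BV (n : nat) := g_sigma_algebraType (@open 'cV[R]_n).

Lemma continuous_BV_measurable n (g : 'cV[R]_n -> R) : continuous g ->
  measurable_fun setT (g : BV n -> R).
Proof.
move=> /continuousP cg; apply: (measurability _ (RGenOpens.measurableE R)).
by move=> _ [_ [a [b ->] <-]]; rewrite setTI; apply: sub_sigma_algebra; exact/cg/interval_open.
Qed.

Lemma coord_continuous_cV n (i : 'I_n) : continuous (fun x : 'cV[R]_n => x i 0 : R).
Proof. exact: coord_continuous. Qed.

(** Open sets are countable unions of sup-norm balls with rational centres and radii 1/(k+1), and
    the preimage of such a ball is a finite intersection of coordinate conditions. *)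
Lemma measurable_BV d (T : measurableType d) n (phi : T -> 'cV[R]_n) :
  (forall i, measurable_fun setT (fun w => phi w i 0 : R)) ->
  measurable_fun setT (phi : T -> BV n).
Proof.
move=> mphi; apply: (@measurability _ _ _ (BV n) _ _ (@open 'cV[R]_n)) => //.
move=> _ [U oU <-]; rewrite setTI.
pose q2 (q : 'cV[rat]_n) : 'cV[R]_n := map_mx ratr q.
pose I : set ('cV[rat]_n * nat) := [set p | ball (q2 p.1) p.2.+1%:R^-1 `<=` U].
have -> : U = \bigcup_(p in I) ball (q2 p.1) p.2.+1%:R^-1.
  apply/seteqP; split => [x Ux|x [p Ip]]; last exact: Ip.
  have [e /= e0 xeU] : exists2 e : R, 0 < e & ball x e `<=` U.
    by have /nbhs_ballP[e ? ?] := open_nbhs_nbhs (conj oU Ux); exists e.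
  (* A ball of radius below e/2 whose centre is closer to x than that radius contains x and stays
     inside the ball of radius e around x. *)
  have [k ke] : exists k : nat, k.+1%:R^-1 < e / 2.
    near \oo => k; exists k.
    by near: k; apply: near_infty_natSinv_lt (PosNum (divr_gt0 e0 (ltr0n R 2)));
      rewrite divr_gt0.
  have k0 : 0 < k.+1%:R^-1 :> R by rewrite invr_gt0.
  have /choice[q qP] : forall ij : 'I_n * 'I_1, exists q : rat,
      `|ratr q - x ij.1 ij.2| < k.+1%:R^-1.
    move=> [i j]; have : x i j - k.+1%:R^-1 < x i j + k.+1%:R^-1.
      by rewrite ltrBlDr -addrA ltrDl addr_gt0.
    move=> /rat_in_itvoo[q]; rewrite in_itv /= => /andP[q1 q2'].
    by exists q; rewrite ltr_norml ltrBlDr ltrBrDr addrC [_ + x i j]addrC q2' q1.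
  pose Q : 'cV[rat]_n := \matrix_(i, j) q (i, j).
  exists (Q, k) => /=; last first.
    by split => // i j; rewrite !mxE; exact: (qP (i, j)).
  move=> y [_ Qy]; apply: xeU; split => // i j.
  have := Qy i j; have := qP (i, j); rewrite /q2 !mxE /ball /= => h1 h2.
  rewrite (_ : x i j - y i j = (ratr (q (i, j)) - y i j) - (ratr (q (i, j)) - x i j)); last by ring.
  apply: le_lt_trans (ler_normB _ _) _; apply: lt_trans (ltrD h2 h1) _.
  by rewrite [ltRHS]splitr ltrD.
rewrite preimage_bigcup; apply: countable_bigcup_measurable => -[q k] _.
rewrite [X in measurable X](_ : _ = \big[setI/setT]_(i < n)
   [set w | `|q2 q i 0 - phi w i 0| < k.+1%:R^-1]); last first.
  rewrite -bigcap_seq; apply/seteqP; split => [w [_ h] i _|w h]; first exact: h.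
  split; first by rewrite /= invr_gt0.
  by move=> i j; rewrite ord1; apply: h; rewrite /= mem_index_enum.
apply: bigsetI_measurable => i _.
rewrite -[X in measurable X]setTI.
have mg : measurable_fun setT (fun w => `|q2 q i 0 - phi w i 0|).
  by apply: measurableT_comp => //; apply: measurable_funB.
rewrite (_ : [set w | _] = (fun w => `|q2 q i 0 - phi w i 0|) @^-1` `]-oo, k.+1%:R^-1[).
  by apply: mg => //; exact: measurable_itv.
by apply/seteqP; split => w /=; rewrite in_itv.
Unshelve. all: by end_near. Qed.

End BorelVectors.

Section Euclidean.
Context {R : realType}.

Lemma dotvC n (x y : 'cV[R]_n) : dotv x y = dotv y x.
Proof. by apply: eq_bigr => i _; rewrite mulrC. Qed.

Lemma dotvDl n (x y z : 'cV[R]_n) : dotv (x + y) z = dotv x z + dotv y z.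
Proof. by rewrite -big_split /=; apply: eq_bigr => i _; rewrite mxE mulrDl. Qed.

Lemma dotvDr n (x y z : 'cV[R]_n) : dotv z (x + y) = dotv z x + dotv z y.
Proof. by rewrite ![dotv z _]dotvC dotvDl. Qed.

Lemma dotvZl n (c : R) (x y : 'cV[R]_n) : dotv (c *: x) y = c * dotv x y.
Proof. by rewrite /dotv mulr_sumr; apply: eq_bigr => i _; rewrite mxE mulrA. Qed.

Lemma dotvZr n (c : R) (x y : 'cV[R]_n) : dotv y (c *: x) = c * dotv y x.
Proof. by rewrite ![dotv y _]dotvC dotvZl. Qed.

Lemma dotvNl n (x y : 'cV[R]_n) : dotv (- x) y = - dotv x y.
Proof. by rewrite -scaleN1r dotvZl mulN1r. Qed.

Lemma dotvNr n (x y : 'cV[R]_n) : dotv y (- x) = - dotv y x.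
Proof. by rewrite ![dotv y _]dotvC dotvNl. Qed.

Lemma dotvBl n (x y z : 'cV[R]_n) : dotv (x - y) z = dotv x z - dotv y z.
Proof. by rewrite dotvDl dotvNl. Qed.

Lemma dotvBr n (x y z : 'cV[R]_n) : dotv z (x - y) = dotv z x - dotv z y.
Proof. by rewrite dotvDr dotvNr. Qed.

Lemma dotvv_ge0 n (x : 'cV[R]_n) : 0 <= dotv x x.
Proof. by apply: sumr_ge0 => i _; rewrite -expr2 sqr_ge0. Qed.

Lemma norm2_ge0 n (x : 'cV[R]_n) : 0 <= norm2 x.
Proof. exact: sqrtr_ge0. Qed.

Lemma sqr_norm2 n (x : 'cV[R]_n) : norm2 x ^+ 2 = dotv x x.
Proof. by rewrite sqr_sqrtr ?dotvv_ge0. Qed.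

Lemma norm2Z n (c : R) (x : 'cV[R]_n) : norm2 (c *: x) = `|c| * norm2 x.
Proof.
rewrite /norm2 dotvZl dotvZr mulrA -expr2 sqrtrM ?sqr_ge0//.
by rewrite sqrtr_sqr.
Qed.

(** Expand the squared norm of x - c y and divide by 2 c. *)
Lemma dotv_young n (x y : 'cV[R]_n) (c : R) : 0 < c ->
  dotv x y <= dotv x x / (2 * c) + c / 2 * dotv y y.
Proof.
move=> c0; have := dotvv_ge0 (x - c *: y).
rewrite dotvBl !dotvBr !dotvZl !dotvZr (dotvC y x) => h.
rewrite -(ler_pM2l (mulr_gt0 (ltr0n R 2) c0)) mulrDr mulrCA divff ?mulr1; last first.
  by rewrite mulf_neq0// gt_eqF.
rewrite [2 * c * (c / 2 * _)](_ : _ = c * (c * dotv y y)); last by field.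
lra.
Qed.

Lemma dotv_cauchy n (x y : 'cV[R]_n) : `|dotv x y| <= norm2 x * norm2 y.
Proof.
rewrite -sqrtr_sqr /norm2 -sqrtrM ?dotvv_ge0// ler_wsqrtr//.
have quad t : 0 <= dotv x x - 2 * t * dotv x y + t ^+ 2 * dotv y y.
  have := dotvv_ge0 (x - t *: y).
  rewrite dotvBl !dotvBr !dotvZl !dotvZr (dotvC y x).
  by rewrite [in X in _ -> X](_ : _ + _ = dotv x x - t * dotv x y -
    (t * dotv x y - t * (t * dotv y y))); last by ring.
have := dotvv_ge0 y; rewrite le_eqVlt => /predU1P[y0|y0].
  have [->|c0] := eqVneq (dotv x y) 0; first by rewrite expr0n -y0 mulr0.
  (* If y has zero norm but the product is nonzero, this t makes the quadratic equal to -1. *)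
  have := quad ((dotv x x + 1) / (2 * dotv x y)); rewrite -y0 mulr0 addr0.
  rewrite [X in X * _](_ : _ = (dotv x x + 1) / dotv x y); last by field.
  by rewrite divfK//; lra.
have := quad (dotv x y / dotv y y).
have -> : dotv x x - 2 * (dotv x y / dotv y y) * dotv x y
    + (dotv x y / dotv y y) ^+ 2 * dotv y y
  = (dotv x x * dotv y y - dotv x y ^+ 2) / dotv y y by field; rewrite gt_eqF.
by rewrite pmulr_lge0 ?invr_gt0// subr_ge0.
Qed.

(** * Gradients and the descent lemma *)

Section Gradient.
Variable n : nat.
Implicit Types (g : 'cV[R]_n -> R) (x h : 'cV[R]_n).

Lemma cV_sum_delta x : x = \sum_(i < n) x i 0 *: delta_mx i 0.
Proof. by rewrite [LHS]matrix_sum_delta; apply: eq_bigr => i _; rewrite big_ord1. Qed.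

Lemma derive_gradient g x h : differentiable g x -> 'D_h g x = dotv (gradient g x) h.
Proof.
move=> dg; rewrite deriveE// {1}(cV_sum_delta h) linear_sum /dotv.
by apply: eq_bigr => i _; rewrite linearZ /= mxE -deriveE// mulrC.
Qed.

Lemma is_derive_line g x h (t : R) : differentiable g (x + t *: h) ->
  is_derive t (1 : R) (fun s : R => g (x + s *: h)) (dotv (gradient g (x + t *: h)) h).
Proof.
move=> dg; rewrite -derive_gradient//.
(* Both difference quotients are the same function of s, so the derivative of [g] along h transfers
   to the line. *)
have E : (fun s : R => s^-1 *: (((fun s : R => g (x + s *: h)) \o shift t) (s *: (1 : R))
      - g (x + t *: h))) =
    (fun s : R => s^-1 *: ((g \o shift (x + t *: h)) (s *: h) - g (x + t *: h))).
  apply/funext => s /=; congr (_ *: (g _ - _)).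
  by rewrite /shift /= [_ *: (1 : R)]mulr1 scalerDl addrCA.
have := diff_derivable (v := h) dg; rewrite /derivable => cvE.
by apply: DeriveDef; rewrite /derivable /derive E.
Qed.

(** [K] stands for L |h|^2. The function [psi] subtracts the quadratic model along the segment; its
    derivative is nonpositive on [0, 1], and the mean value theorem gives psi(1) <= psi(0). *)
Lemma descent g x h (K : R) : (forall y, differentiable g y) ->
  (forall t, 0 <= t <= 1 ->
    dotv (gradient g (x + t *: h) - gradient g x) h <= t * K) ->
  g (x + h) <= g x + dotv (gradient g x) h + K / 2.
Proof.
move=> dg gK.
pose psi (t : R) := g (x + t *: h) - t * dotv (gradient g x) h - t ^+ 2 * (K / 2).
have dpsi t : is_derive t (1 : R) psi
    (dotv (gradient g (x + t *: h)) h - dotv (gradient g x) h - t * K).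
  have dl := is_derive_line (dg (x + t *: h)).
  have -> : psi = (fun s : R => g (x + s *: h)) - (@idfun R) * cst (dotv (gradient g x) h)
      - (@idfun R) ^+ 2 * cst (K / 2).
    by apply/funext => s; rewrite /psi !fctE.
  apply: is_derive_eq; rewrite !fctE /GRing.scale /= expr1.
  by field.
suff : psi 1 <= psi 0.
  by rewrite /psi scale1r scale0r addr0 expr1n expr0n /=; lra.
have cpsi t : {for t, continuous psi}.
  apply/differentiable_continuous/derivable1_diffP; by have [] := dpsi t.
have [c] := MVT_segment (@ler01 R) (fun t _ => dpsi t) (continuous_subspaceT cpsi).
rewrite in_itv /= subr0 mulr1 => c01 e; rewrite -subr_le0 e.
have := gK c c01; rewrite dotvBl; lra.
Qed.

End Gradient.

(** * Block decomposition of vectors *)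

Section BlockAlgebra.
Context {b : nat} {ns : 'I_b -> nat}.
Local Notation n := (\sum_(s < b) ns s)%N.
Local Notation U := (@Ublock R b ns).
Implicit Types (x y : 'cV[R]_n) (s : 'I_b).

Lemma blockD s x y : block s (x + y) = block s x + block s y.
Proof. by rewrite /block mulmxDr. Qed.

Lemma blockB s x y : block s (x - y) = block s x - block s y.
Proof. by rewrite /block mulmxBr. Qed.

Lemma blockZ s (c : R) x : block s (c *: x) = c *: block s x.
Proof. by rewrite /block -scalemxAr. Qed.

Lemma block_sum s (I : Type) (r : seq I) (P : pred I) (x : I -> 'cV[R]_n) :
  block s (\sum_(i <- r | P i) x i) = \sum_(i <- r | P i) block s (x i).
Proof. by rewrite /block mulmx_sumr. Qed.

Lemma sum_Ublock x : x = \sum_(s < b) U s *m block s x.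
Proof.
transitivity ((\sum_(s < b) U s *m (U s)^T) *m x); last first.
  by rewrite mulmx_suml; apply: eq_bigr => s _; rewrite /block mulmxA.
rewrite -[LHS]mul1mx; congr (_ *m _).
by rewrite -mul_mxrow_mxcol -tr_mxrow mxrow_Ublock trmx1 mulmx1.
Qed.

(** [tagnat.Rank s i] is the position of coordinate i of block s among all n coordinates. *)
Lemma Ublock_entry s (k : 'I_n) (i : 'I_(ns s)) :
  U s k i = (k == tagnat.Rank s i)%:R.
Proof. by rewrite /Ublock !mxE. Qed.

Lemma Ublock_mul s s' (i : 'I_(ns s)) (j : 'I_(ns s')) :
  ((U s)^T *m U s') i j = ((s == s') && (i == j :> nat))%:R.
Proof.
rewrite mxE -tagnat.eq_Rank (bigD1 (tagnat.Rank s i))//= mxE !Ublock_entry eqxx mul1r.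
rewrite [X in _ + X]big1 ?addr0// => k /negbTE ki.
by rewrite mxE Ublock_entry ki mul0r.
Qed.

Lemma block_Ublock s (h : 'cV[R]_(ns s)) : block s (U s *m h) = h.
Proof.
rewrite /block mulmxA -[RHS]mul1mx; congr (_ *m _).
by apply/matrixP => i j; rewrite Ublock_mul eqxx mxE.
Qed.

Lemma block_Ublock_neq s s' (h : 'cV[R]_(ns s')) : s != s' -> block s (U s' *m h) = 0.
Proof.
move=> ss'; rewrite /block mulmxA -(mul0mx _ h); congr (_ *m _).
by apply/matrixP => i j; rewrite Ublock_mul (negbTE ss') mxE.
Qed.

Lemma dotvE m (x y : 'cV[R]_m) : dotv x y = (x^T *m y) 0 0.
Proof. by rewrite mxE; apply: eq_bigr => i _; rewrite mxE. Qed.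

Lemma dotv_block x y : dotv x y = \sum_(s < b) dotv (block s x) (block s y).
Proof.
rewrite {1}(sum_Ublock y) dotvE mulmx_sumr summxE; apply: eq_bigr => s _.
by rewrite dotvE /block trmx_mul trmxK -!mulmxA.
Qed.

Lemma dotv_Ublock s (h : 'cV[R]_(ns s)) y : dotv y (U s *m h) = dotv (block s y) h.
Proof. by rewrite !dotvE /block trmx_mul trmxK mulmxA. Qed.

End BlockAlgebra.
End Euclidean.

(** * The zeroth-order oracle *)

Section ExpectationInequalities.
Context {R : realType} {d : measure_display} {Omega : measurableType d}.
Variable P : probability Omega R.

Lemma ae_ge0_expect (X : Omega -> R) : integrableR P X ->
  {ae P, forall w, 0 <= X w} -> 0 <= \int[P]_w X w.
Proof.
move=> iX X0; have mX := integrableR_measurable iX.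
have mX' : measurable_fun setT (fun w => Num.max (X w) 0) by exact: measurable_maxr.
rewrite /Rintegral (ae_eq_integral (EFin \o (fun w => Num.max (X w) 0)))//.
- by apply: fine_ge0; apply: integral_ge0 => w _; rewrite lee_fin le_max lexx orbT.
- exact/measurable_EFinP.
- exact/measurable_EFinP.
- by apply: filterS X0 => w X0 _ /=; rewrite max_l.
Qed.

Lemma ae_le_expect (X Y : Omega -> R) : integrableR P X -> integrableR P Y ->
  {ae P, forall w, X w <= Y w} -> \int[P]_w X w <= \int[P]_w Y w.
Proof.
move=> iX iY XY; rewrite -subr_ge0.
have -> : \int[P]_w Y w - \int[P]_w X w = \int[P]_w (Y w - X w).
  by rewrite RintegralB.
apply: ae_ge0_expect; last by apply: filterS XY => w; rewrite subr_ge0.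
by have := integrableB measurableT iY iX.
Qed.

Lemma le_expect (X Y : Omega -> R) : integrableR P X -> integrableR P Y ->
  (forall w, X w <= Y w) -> \int[P]_w X w <= \int[P]_w Y w.
Proof. by move=> iX iY XY; apply: ae_le_expect => //; exact: aeW. Qed.

Lemma ae_integrableR_le (X Y : Omega -> R) : measurable_fun setT X ->
  integrableR P Y -> {ae P, forall w, `|X w| <= Y w} -> integrableR P X.
Proof.
move=> mX iY XY; apply/integrableP; split; first exact/measurable_EFinP.
apply: (@le_lt_trans _ _ (\int[P]_w `|(Y w)%:E|)%E); last by have /integrableP[] := iY.
apply: ae_ge0_le_integral => //.
- exact/measurableT_comp/measurable_EFinP.
- exact/measurableT_comp/measurable_EFinP/integrableR_measurable/iY.
- by apply: filterS XY => w h _ /=; rewrite lee_fin (le_trans h)// ler_norm.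
Qed.

Lemma integrableR_sum (I : Type) (s : seq I) (X : I -> Omega -> R) :
  (forall i, integrableR P (X i)) -> integrableR P (fun w => \sum_(i <- s) X i w).
Proof.
move=> iX; elim: s => [|i s IH].
  by under eq_fun do rewrite big_nil; exact: integrableR_cst.
by under eq_fun do rewrite big_cons; exact: integrableRD.
Qed.

Lemma expect_sum (I : Type) (s : seq I) (X : I -> Omega -> R) :
  (forall i, integrableR P (X i)) ->
  \int[P]_w (\sum_(i <- s) X i w) = \sum_(i <- s) \int[P]_w X i w.
Proof.
move=> iX; elim: s => [|i s IH].
  by rewrite big_nil; under eq_Rintegral do rewrite big_nil; exact: expect_cst.
rewrite big_cons -IH; under eq_Rintegral do rewrite big_cons.
by apply: expectD => //; exact: integrableR_sum.
Qed.

Lemma integrableR_sqr (X : Omega -> R) : measurable_fun setT X ->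
  integrableR P (fun w => X w ^+ 2) -> integrableR P X.
Proof.
move=> mX iX; apply: integrableR_le (integrableRD (integrableR_cst P 1) iX) _ => // w.
have := sqr_ge0 (`|X w| - 1); rewrite sqrrB real_normK ?num_real//.
by have := sqr_ge0 (X w); rewrite /=; lra.
Qed.

(** Jensen for the square, from E[(X - m)^2] >= 0 with m the mean. *)
Lemma sqr_expect_le (X : Omega -> R) : measurable_fun setT X ->
  integrableR P (fun w => X w ^+ 2) ->
  (\int[P]_w X w) ^+ 2 <= \int[P]_w (X w ^+ 2).
Proof.
move=> mX iX2; have iX := integrableR_sqr mX iX2; set m := \int[P]_w X w.
have : 0 <= \int[P]_w (X w ^+ 2 + (- (2 * m) * X w + m ^+ 2)).
  apply: Rintegral_ge0 => w _.
  by rewrite (_ : _ + _ = (X w - m) ^+ 2) ?sqr_ge0//; ring.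
rewrite expectD//; last by apply: integrableRD; [exact: integrableRZ|exact: integrableR_cst].
rewrite expectD; [|exact: integrableRZ|exact: integrableR_cst].
have -> : \int[P]_w (m ^+ 2) = m ^+ 2 by exact: expect_cst.
by rewrite expectZ// -/m; lra.
Qed.

Lemma integrableRM2 (X Y : Omega -> R) : measurable_fun setT X ->
  measurable_fun setT Y -> integrableR P (fun w => X w ^+ 2) ->
  integrableR P (fun w => Y w ^+ 2) -> integrableR P (fun w => X w * Y w).
Proof.
move=> mX mY iX iY; apply: integrableR_le (integrableRD iX iY) _.
  exact: measurable_funM.
move=> w; rewrite normrM -(real_normK (num_real (X w))) -(real_normK (num_real (Y w))).
by have := sqr_ge0 (`|X w| - `|Y w|); have := normr_ge0 (X w);
  have := normr_ge0 (Y w); nra.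
Qed.

End ExpectationInequalities.

(** * Transfer to the law of the samples *)

Section LawTransfer.
Context {R : realType} {d dXi : measure_display}.
Context {Omega : measurableType d} {Xi : measurableType dXi}.
Variables (P : probability Omega R) (Q : probability Xi R) (xi : Omega -> Xi).
Hypotheses (mxi : measurable_fun setT xi)
  (lawxi : forall A, measurable A -> P (xi @^-1` A) = Q A).

Lemma ge0_integral_law (h : Xi -> \bar R) : measurable_fun setT h ->
  (forall x, 0 <= h x)%E -> (\int[P]_w h (xi w) = \int[Q]_x h x)%E.
Proof.
move=> mh h0.
pose xip : {mfun Omega >-> Xi} := HB.pack xi (isMeasurableFun.Build _ _ _ _ _ mxi).
rewrite -[LHS](ge0_integral_distribution xip mh h0).
by apply: eq_measure_integral => A mA _; exact: lawxi.
Qed.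

Lemma integrableR_law (h : Xi -> R) : integrableR Q h ->
  integrableR P (fun w => h (xi w)).
Proof.
move=> /integrableP[/measurable_EFinP mh ih]; apply/integrableP; split.
  exact/measurable_EFinP/measurableT_comp.
rewrite [ltLHS](ge0_integral_law (h := fun x => `|(h x)%:E|%E))//.
exact/measurableT_comp/measurable_EFinP.
Qed.

Lemma expect_law (h : Xi -> R) : integrableR Q h ->
  \int[P]_w h (xi w) = \int[Q]_x h x.
Proof.
move=> ih; have iPh := integrableR_law ih.
have mh := integrableR_measurable ih.
pose xip : {mfun Omega >-> Xi} := HB.pack xi (isMeasurableFun.Build _ _ _ _ _ mxi).
rewrite /Rintegral -[X in fine X = _](integral_distribution (X := xip) (f := EFin \o h))//.
  by congr fine; apply: eq_measure_integral => A mA _; exact: lawxi.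
exact/measurable_EFinP.
Qed.

Lemma ae_law (S : Xi -> Prop) : {ae Q, forall x, S x} -> {ae P, forall w, S (xi w)}.
Proof.
move=> [N [mN QN SN]]; exists (xi @^-1` N); split.
- by rewrite -[X in measurable X]setTI; exact: mxi.
- by rewrite lawxi.
- by move=> w; apply: SN.
Qed.
End LawTransfer.

(** * The smooth oracle and a single zeroth-order sample *)

Section Oracle.
Context {R : realType} {b : nat} {ns : 'I_b -> nat}.
Local Notation n := (\sum_(s < b) ns s)%N.
Context {dXi : measure_display} {Xi : measurableType dXi}.
Variables (Q : probability Xi R) (F : 'cV[R]_n -> Xi -> R) (f : 'cV[R]_n -> R).
Variable X : forall s, set 'cV[R]_(ns s).
Arguments X : clear implicits.
Variables (sigma Lf M : R) (L : 'I_b -> R).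
Hypotheses (mF : oracle_measurable F)
  (unbiased : unbiased_bounded_variance Q F f X sigma)
  (lip : lipschitz_gradients Q F Lf L)
  (gradM : bounded_gradient f X M).

Let gF x xi := gradient (F^~ xi) x.

Lemma integrable_oracle x : integrableR Q (F x).
Proof. by have [/(_ x)[]] := unbiased. Qed.

Lemma expect_oracle x : \int[Q]_xi F x xi = f x.
Proof.
have [/(_ x)[_]] := unbiased; rewrite unlock => e _ _ _.
by rewrite /Rintegral e.
Qed.

Lemma integrable_oracle_gradient x i : integrableR Q (fun xi => gF x xi i 0).
Proof. by have [_ _ /(_ x i)[]] := unbiased. Qed.

Lemma expect_oracle_gradient x i : \int[Q]_xi (gF x xi i 0) = gradient f x i 0.
Proof.
have [_ _ /(_ x i)[_]] := unbiased; rewrite unlock => e _.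
by rewrite /Rintegral e.
Qed.

Lemma integrable_oracle_directional x h : integrableR Q (fun xi => dotv (gF x xi) h).
Proof.
apply: integrableR_sum => i; under eq_fun do rewrite mulrC.
exact/integrableRZ/integrable_oracle_gradient.
Qed.

Lemma expect_oracle_directional x h :
  \int[Q]_xi dotv (gF x xi) h = dotv (gradient f x) h.
Proof.
rewrite expect_sum; last first.
  move=> i; under eq_fun do rewrite mulrC.
  exact/integrableRZ/integrable_oracle_gradient.
apply: eq_bigr => i _; under eq_Rintegral do rewrite mulrC.
by rewrite expectZ ?expect_oracle_gradient 1?mulrC//; exact: integrable_oracle_gradient.
Qed.

(* The descent inequality holds for almost every sample, hence for the mean. *)
Lemma block_descent s x (h : 'cV[R]_(ns s)) :
  f (x + Ublock s *m h) <=
    f x + dotv (block s (gradient f x)) h + L s / 2 * dotv h h.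
Proof.
rewrite -dotv_Ublock -!expect_oracle -expect_oracle_directional.
have iF := integrable_oracle; have iG := integrable_oracle_directional.
rewrite -(expect_cst Q (L s / 2 * dotv h h)) -!expectD//; last first.
- exact: integrableR_cst.
- exact: integrableRD.
apply: ae_le_expect => //; first by apply: integrableRD; [exact: integrableRD|exact: integrableR_cst].
have [_ L0 ae] := lip; apply: filterS ae => xi [dF _ lipb] /=.
rewrite (_ : L s / 2 * dotv h h = L s * dotv h h / 2); last by rewrite mulrAC.
apply: (descent (g := F^~ xi)) => // t /andP[t0 t1].
rewrite dotv_Ublock blockB scalemxAr.
apply: le_trans (ler_norm _) _; apply: le_trans (dotv_cauchy _ _) _.
rewrite -sqr_norm2 expr2 !mulrA ler_wpM2r ?norm2_ge0//.
apply: le_trans (lipb s x (t *: h)) _.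
by rewrite norm2Z ger0_norm// mulrCA mulrA.
Qed.

(** Two-sided, by applying the descent lemma to [F] and to its opposite. The null set precedes the
    quantifier on [h], so that [h] may later be the random direction. *)
Lemma smooth_oracle_remainder x : {ae Q, forall xi, forall h : 'cV[R]_n,
  `|F (x + h) xi - F x xi - dotv (gF x xi) h| <= Lf / 2 * dotv h h}.
Proof.
have [Lf0 _ ae] := lip; apply: filterS ae => xi [dF lipf _] h /=.
have bd t : 0 <= t <= 1 -> `|dotv (gF (x + t *: h) xi - gF x xi) h| <= t * (Lf * dotv h h).
  move=> /andP[t0 t1]; apply: le_trans (dotv_cauchy _ _) _.
  rewrite -sqr_norm2 expr2 !mulrA ler_wpM2r ?norm2_ge0//.
  apply: le_trans (lipf _ _) _.
  by rewrite addrAC subrr add0r norm2Z ger0_norm// mulrCA mulrA.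
rewrite (_ : Lf / 2 * _ = Lf * dotv h h / 2); last by rewrite mulrAC.
rewrite ler_norml; apply/andP; split; last first.
  have := @descent R n (F^~ xi) x h (Lf * dotv h h) dF _; move=> H.
  have := H (fun t t01 => le_trans (ler_norm _) (bd t t01)); rewrite /gF; lra.
have dF' y : differentiable (- F^~ xi) y by exact: differentiableN.
have gN y : gradient (- F^~ xi) y = - gF y xi.
  by apply/matrixP => i j; rewrite !mxE deriveN//; exact: diff_derivable.
have H : (- F^~ xi) (x + h) <= (- F^~ xi) x + dotv (gradient (- F^~ xi) x) h
    + Lf * dotv h h / 2.
  apply: descent => // t t01; rewrite !gN -opprB opprK addrC -opprB dotvNl.
  rewrite opprB; apply: le_trans (bd t t01).
  by rewrite -normrN ler_norm.
by move: H; rewrite gN dotvNl !fctE /gF; lra.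
Qed.

Section SingleSample.
Context {d : measure_display} {Omega : measurableType d}.
Variables (P : probability Omega R) (mu : R).
Variables (xi : Omega -> Xi) (u : Omega -> 'cV[R]_n).
Hypotheses (mu0 : 0 < mu) (mxi : measurable_fun setT xi)
  (lawxi : forall A, measurable A -> P (xi @^-1` A) = Q A)
  (gu : standard_gaussian P u)
  (mu_ : forall i, measurable_fun setT (fun w => u w i 0 : R))
  (xiu : independent_maps P xi (u : Omega -> @BV R n)).
Variable y : 'cV[R]_n.
Hypothesis Xy : prodset X y.

(** The oracle vector is [(D w + c w) *: u w], where [D] is the linear part and [c] the Taylor
    remainder divided by mu. *)
Let D w := dotv (gF y (xi w)) (u w).
Let c w := (F (y + mu *: u w) (xi w) - F y (xi w)) / mu - D w.
Let S w := dotv (u w) (u w).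
Let N : R := n%:R.

Let m_gF i : measurable_fun setT (fun w => gF y (xi w) i 0 : R).
Proof.
apply: (measurableT_comp (f := fun z => gF y z i 0 : R)) => //.
exact/integrableR_measurable/integrable_oracle_gradient.
Qed.

Let mD : measurable_fun setT D.
Proof. by apply: measurable_sum => i; exact: measurable_funM. Qed.

Let mS : measurable_fun setT S.
Proof. by apply: measurable_sum => i; exact: measurable_funM. Qed.

Let mc : measurable_fun setT c.
Proof.
have mFu (h : Omega -> 'cV[R]_n) : (forall i, measurable_fun setT (fun w => h w i 0 : R)) ->
    measurable_fun setT (fun w => F (h w) (xi w)).
  move=> mh; have mhx : measurable_fun setT (fun w => (h w : @BV R n, xi w)).
    by apply/measurable_fun_pairP; split => //; exact: measurable_BV.
  exact: (measurableT_comp mF mhx).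
apply: measurable_funB => //; apply: measurable_funM => //.
apply: measurable_funB; apply: mFu => i //.
under eq_fun do rewrite !mxE.
by apply: measurable_funD => //; exact: measurable_funM.
Qed.

Let c_bound : {ae P, forall w, `|c w| <= mu * Lf / 2 * S w}.
Proof.
have h : {ae Q, forall x, forall v : 'cV[R]_n,
    `|F (y + mu *: v) x - F y x - dotv (gF y x) (mu *: v)|
      <= Lf / 2 * dotv (mu *: v) (mu *: v)}.
  by apply: filterS (smooth_oracle_remainder y) => x + v; apply.
have := ae_law mxi lawxi h; apply: filterS => w /(_ (u w)).
rewrite !dotvZr dotvZl /c /D /S => h1.
rewrite -(ler_pM2l mu0) -{1}(gtr0_norm mu0) -normrM.
rewrite mulrBr mulrCA divff ?gt_eqF// mulr1; apply: le_trans h1 _.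
rewrite le_eqVlt; apply/orP; left; apply/eqP; ring.
Qed.

Let S3 : integrableR P (fun w => S w ^+ 3) /\
  \int[P]_w (S w ^+ 3) = N * (N + 2) * (N + 4).
Proof.
split; last exact: gaussian_dotv_moment3.
by have [[_ aS] _] := gaussian_norm2_moments gu mu_ 0.
Qed.

Let S_ge0 w : 0 <= S w. Proof. exact: dotvv_ge0. Qed.

(** The bound on [c] leaves (mu Lf / 2)^2 |u|^6, whence the sixth moment of the Gaussian norm. *)
Let c2S : integrableR P (fun w => c w ^+ 2 * S w) /\
  \int[P]_w (c w ^+ 2 * S w) <= mu ^+ 2 * Lf ^+ 2 / 4 * (N * (N + 2) * (N + 4)).
Proof.
have [iS3 <-] := S3; have [Lf0 _ _] := lip.
pose K := mu ^+ 2 * Lf ^+ 2 / 4.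
have le : {ae P, forall w, `|c w ^+ 2 * S w| <= K * S w ^+ 3}.
  apply: filterS c_bound => w cw /=.
  rewrite normrM normrX (ger0_norm (S_ge0 w)).
  rewrite (_ : K * S w ^+ 3 = (mu * Lf / 2 * S w) ^+ 2 * S w); last by rewrite /K; field.
  rewrite ler_wpM2r// lerXn2r ?nnegrE//.
  by rewrite !mulr_ge0// ltW.
have mcS : measurable_fun setT (fun w => c w ^+ 2 * S w).
  by apply: measurable_funM => //; exact: measurable_funX.
have iKS : integrableR P (fun w => K * S w ^+ 3) by exact: integrableRZ.
have icS := ae_integrableR_le mcS iKS le.
split=> //; rewrite -expectZ//; apply: ae_le_expect => //.
by apply: filterS le => w; apply: le_trans; exact: ler_norm.
Qed.

Let gsq w := dotv (gF y (xi w)) (gF y (xi w)).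

Let mgsqQ : measurable_fun setT (fun z => dotv (gF y z) (gF y z)).
Proof.
by apply: measurable_sum => i; apply: measurable_funM;
  exact/integrableR_measurable/integrable_oracle_gradient.
Qed.

(** Splitting the gradient into its mean and its deviation costs a factor 2, which the stated noise
    constant accommodates. *)
Let gsq_bound : integrableR P gsq /\ \int[P]_w gsq w <= 2 * M ^+ 2 + 2 * sigma ^+ 2.
Proof.
have M0 : 0 <= norm2 (gradient f y) ^+ 2 <= M ^+ 2.
  rewrite sqr_ge0 /= lerXn2r ?nnegrE ?norm2_ge0//; last exact: gradM.
  exact: le_trans (norm2_ge0 _) (gradM Xy).
have [_ _ _ /(_ y Xy)] := unbiased; rewrite unlock => var.
pose V z := norm2 (gF y z - gradient f y) ^+ 2.
have mV : measurable_fun setT V.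
  rewrite /V; under eq_fun do rewrite sqr_norm2; apply: measurable_sum => i.
  have mi : measurable_fun setT (fun z => (gF y z - gradient f y) i 0 : R).
    have e z : (gF y z - gradient f y) i 0 = gF y z i 0 - gradient f y i 0.
      by rewrite [LHS]mxE [X in _ + X]mxE.
    under eq_fun do rewrite e; apply: measurable_funB => //.
    exact/integrableR_measurable/integrable_oracle_gradient.
  exact: measurable_funM.
have iV : integrableR Q V.
  apply/integrableP; split; first exact/measurable_EFinP.
  under eq_integral do rewrite /= ger0_norm ?sqr_ge0//.
  by apply: le_lt_trans var _; exact: ltry.
have V1 : \int[Q]_z V z <= sigma ^+ 2 by rewrite -lee_fin EFin_expect.
have le z : dotv (gF y z) (gF y z) <= 2 * V z + 2 * M ^+ 2.
  have /andP[_ M2] := M0; apply: (@le_trans _ _ (2 * V z + 2 * norm2 (gradient f y) ^+ 2)).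
    (* |a|^2 <= 2 |a - g|^2 + 2 |g|^2 amounts to |a - 2 g|^2 >= 0. *)
    rewrite /V !sqr_norm2; have := dotvv_ge0 (gF y z - gradient f y - gradient f y).
    by rewrite !dotvBl !dotvBr (dotvC (gradient f y) (gF y z)); lra.
  by rewrite lerD2l ler_pM2l.
have i2 : integrableR Q (fun z => 2 * V z + 2 * M ^+ 2).
  by apply: integrableRD; [exact: integrableRZ|exact: integrableR_cst].
have ig : integrableR Q (fun z => dotv (gF y z) (gF y z)).
  by apply: integrableR_le i2 _ => // z; rewrite ger0_norm ?dotvv_ge0.
split; first exact: (integrableR_law mxi lawxi ig).
rewrite [leLHS](expect_law mxi lawxi ig).
apply: le_trans (le_expect ig i2 le) _.
rewrite expectD; [|exact: integrableRZ|exact: integrableR_cst].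
rewrite (expectZ _ iV).
have -> : \int[Q]_z (2 * M ^+ 2) = 2 * M ^+ 2 by exact: expect_cst.
lra.
Qed.

(** Sample and direction are independent: with the sample frozen, the Gaussian quadratic moment
    turns the integrand into (n + 2) |grad F|^2, whose mean is already bounded. *)
Let D2S : integrableR P (fun w => D w ^+ 2 * S w) /\
  \int[P]_w (D w ^+ 2 * S w) <= (N + 2) * (2 * M ^+ 2 + 2 * sigma ^+ 2).
Proof.
have [ig gle] := gsq_bound.
have mDS : measurable_fun setT (fun w => D w ^+ 2 * S w).
  by apply: measurable_funM => //; exact: measurable_funX.
pose h (q : Xi * @BV R n) : \bar R := (dotv (gF y q.1) q.2 ^+ 2 * dotv (q.2 : 'cV[R]_n) q.2)%:E.
have mh : measurable_fun setT h.
  have m2 i : measurable_fun setT (fun q : Xi * @BV R n => (q.2 : 'cV[R]_n) i 0 : R).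
    apply: (measurableT_comp (f := fun v : @BV R n => (v : 'cV[R]_n) i 0 : R)) => //.
    by apply: continuous_BV_measurable; exact: coord_continuous_cV.
  have m1 i : measurable_fun setT (fun q : Xi * @BV R n => gF y q.1 i 0 : R).
    apply: (measurableT_comp (f := fun z => gF y z i 0 : R)) => //.
    exact/integrableR_measurable/integrable_oracle_gradient.
  apply/measurable_EFinP/measurable_funM.
    by apply: measurable_funX; apply: measurable_sum => i; exact: measurable_funM.
  by apply: measurable_sum => i; exact: measurable_funM.
have h0 q : (0 <= h q)%E by rewrite lee_fin mulr_ge0 ?sqr_ge0 ?dotvv_ge0.
have E : (\int[P]_w (D w ^+ 2 * S w)%:E = \int[P]_w ((N + 2) * gsq w)%:E)%E.
  rewrite [LHS](ge0_decouple mxi (measurable_BV mu_) xiu mh h0).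
  apply: eq_integral => w _; rewrite /h /=.
  have [aS aD] := gaussian_norm2_moments gu mu_ (gF y (xi w)).
  rewrite -(gaussian_quadratic_moment gu mu_) EFin_expect//.
  by apply/all_moments_integrable/all_momentsM => //; exact: all_momentsX.
have iNg : integrableR P (fun w => (N + 2) * gsq w) by exact: integrableRZ.
have iDS : integrableR P (fun w => D w ^+ 2 * S w).
  apply/integrableP; split; first exact/measurable_EFinP.
  have nn w : `|D w ^+ 2 * S w| = D w ^+ 2 * S w.
    by rewrite ger0_norm// mulr_ge0 ?sqr_ge0.
  under eq_integral do rewrite /= nn.
  rewrite E; have /integrableP[_] := iNg; apply: le_lt_trans.
  apply: ge0_le_integral => //.
  - by move=> w _; rewrite lee_fin mulr_ge0 ?dotvv_ge0// addr_ge0.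
  - exact/measurable_EFinP/integrableR_measurable/iNg.
  - exact/measurableT_comp/measurable_EFinP/integrableR_measurable/iNg.
  - by move=> w _; rewrite lee_fin ler_norm.
split=> //; rewrite -lee_fin EFin_expect// E -EFin_expect// lee_fin expectZ//.
by rewrite ler_wpM2l// addr_ge0.
Qed.

Let a w := zo_gradient F mu y (xi w) (u w) - gradient f y.

Let aE i w : a w i 0 = D w * u w i 0 + c w * u w i 0 - gradient f y i 0.
Proof. by rewrite /a /zo_gradient 3!mxE -mulrDl /c subrKC. Qed.

Let u_le_S w i : u w i 0 ^+ 2 <= S w.
Proof.
rewrite /S /dotv (bigD1 i)//= expr2 lerDl.
by apply: sumr_ge0 => j _; rewrite -expr2 sqr_ge0.
Qed.

Let mDu i : measurable_fun setT (fun w => D w * u w i 0).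
Proof. exact: measurable_funM. Qed.

Let mcu i : measurable_fun setT (fun w => c w * u w i 0).
Proof. exact: measurable_funM. Qed.

Let iDu2 i : integrableR P (fun w => (D w * u w i 0) ^+ 2).
Proof.
apply: integrableR_le D2S.1 _ => [|w]; first exact: measurable_funX.
by rewrite ger0_norm ?sqr_ge0// exprMn ler_wpM2l ?sqr_ge0.
Qed.

Let icu2 i : integrableR P (fun w => (c w * u w i 0) ^+ 2).
Proof.
apply: integrableR_le c2S.1 _ => [|w]; first exact: measurable_funX.
by rewrite ger0_norm ?sqr_ge0// exprMn ler_wpM2l ?sqr_ge0.
Qed.

Lemma sample_error_measurable i : measurable_fun setT (fun w => a w i 0 : R).
Proof.
under eq_fun do rewrite aE.
by apply: measurable_funB => //; exact: measurable_funD.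
Qed.

Let a2_le w : \sum_(i < n) a w i 0 ^+ 2 <=
  4 * (D w ^+ 2 * S w) + 4 * (c w ^+ 2 * S w) + 2 * M ^+ 2.
Proof.
have M2 : \sum_(i < n) gradient f y i 0 ^+ 2 <= M ^+ 2.
  rewrite (_ : \sum_(i < n) _ = norm2 (gradient f y) ^+ 2); last first.
    by rewrite sqr_norm2; apply: eq_bigr => i _; rewrite expr2.
  rewrite lerXn2r ?nnegrE ?norm2_ge0//; last exact: gradM.
  exact: le_trans (norm2_ge0 _) (gradM Xy).
apply: (@le_trans _ _ (4 * (D w ^+ 2 * S w) + 4 * (c w ^+ 2 * S w)
    + 2 * \sum_(i < n) gradient f y i 0 ^+ 2)); last by rewrite lerD2l ler_pM2l.
rewrite /S /dotv !mulr_sumr -!big_split /=; apply: ler_sum => i _.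
rewrite aE; set p := D w * _; set q := c w * _; set g := gradient f y i 0.
rewrite (_ : D w ^+ 2 * _ = p ^+ 2); last by rewrite /p exprMn expr2.
rewrite (_ : c w ^+ 2 * _ = q ^+ 2); last by rewrite /q exprMn expr2.
(* (p + q - g)^2 + (p + q + g)^2 = 2 (p + q)^2 + 2 g^2, and 2 (p + q)^2 <= 4 p^2 + 4 q^2. *)
have := sqr_ge0 (p + q + g); have := sqr_ge0 (p - q); lra.
Qed.

Let ibound : integrableR P (fun w => 4 * (D w ^+ 2 * S w) + 4 * (c w ^+ 2 * S w) + 2 * M ^+ 2).
Proof.
have [[iD _] [ic _]] := (D2S, c2S).
by apply: integrableRD; [apply: integrableRD; exact: integrableRZ|exact: integrableR_cst].
Qed.

Lemma sample_error_sqr_integrable i : integrableR P (fun w => a w i 0 ^+ 2).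
Proof.
apply: integrableR_le ibound _ => [|w].
  by apply: measurable_funX; exact: sample_error_measurable.
rewrite ger0_norm ?sqr_ge0//; apply: le_trans (a2_le w).
by rewrite (bigD1 i)//= lerDl; apply: sumr_ge0 => j _; exact: sqr_ge0.
Qed.

Lemma sample_error_second_moment :
  \sum_(i < n) \int[P]_w (a w i 0 ^+ 2) <=
    8 * (N + 2) * (M ^+ 2 + sigma ^+ 2)
    + mu ^+ 2 * Lf ^+ 2 * (N * (N + 2) * (N + 4)) + 2 * M ^+ 2.
Proof.
have [[iD De] [ic ce]] := (D2S, c2S).
rewrite -expect_sum; last exact: sample_error_sqr_integrable.
have ia : integrableR P (fun w => \sum_(i < n) a w i 0 ^+ 2).
  by apply: integrableR_sum; exact: sample_error_sqr_integrable.
apply: le_trans (le_expect ia ibound a2_le) _.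
have i4D : integrableR P (fun w => 4 * (D w ^+ 2 * S w)) by exact: integrableRZ.
have i4c : integrableR P (fun w => 4 * (c w ^+ 2 * S w)) by exact: integrableRZ.
have iM := integrableR_cst P (2 * M ^+ 2).
rewrite expectD//; last exact: integrableRD.
rewrite expectD// (expectZ _ iD) (expectZ _ ic).
have -> : \int[P]_w (2 * M ^+ 2) = 2 * M ^+ 2 by exact: expect_cst.
lra.
Qed.

(** E[<grad F, u> u] = E[u u^T] E[grad F], and the identity covariance selects coordinate i. *)
Let expect_Du i : \int[P]_w (D w * u w i 0) = gradient f y i 0.
Proof.
have au j := gaussian_coord_moments gu mu_ j.
have ig j : integrableR P (fun w => gF y (xi w) j 0).
  exact: (integrableR_law mxi lawxi (integrable_oracle_gradient y j)).
have iu j : integrableR P (fun w => u w j 0 * u w i 0).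
  by apply/all_moments_integrable/all_momentsM; exact: au.
have ind j : independent_maps P (fun w => gF y (xi w) j 0 : R) (fun w => u w j 0 * u w i 0 : R).
  have mg : measurable_fun setT (fun z => gF y z j 0 : R).
    exact/integrableR_measurable/integrable_oracle_gradient.
  have muu : measurable_fun setT (fun v : @BV R n => (v : 'cV[R]_n) j 0 * (v : 'cV[R]_n) i 0 : R).
    by apply: measurable_funM; apply: continuous_BV_measurable; exact: coord_continuous_cV.
  exact: (independent_maps_comp xiu mg muu).
transitivity (\int[P]_w \sum_(j < n) gF y (xi w) j 0 * (u w j 0 * u w i 0)).
  apply: eq_Rintegral => w _; rewrite /D /dotv mulr_suml; apply: eq_bigr => j _.
  by rewrite mulrA.
rewrite expect_sum; last first.
  by move=> j; exact: (independent_integrableM (ind j) (ig j) (iu j)).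
under eq_bigr => j _ do rewrite (expect_indepM (ind j) (ig j) (iu j)) (gaussian_cov gu mu_).
rewrite (bigD1 i)//= eqxx mulr1 [X in _ + X]big1 ?addr0; last first.
  by move=> j /negbTE ->; rewrite mulr0.
by rewrite (expect_law mxi lawxi (integrable_oracle_gradient y i)) expect_oracle_gradient.
Qed.

(** The linear part has no bias, and coordinatewise Jensen bounds |E[c u]|^2 by E[c^2 |u|^2]. *)
Lemma sample_error_bias :
  \sum_(i < n) (\int[P]_w a w i 0) ^+ 2 <=
    mu ^+ 2 * Lf ^+ 2 / 4 * (N * (N + 2) * (N + 4)).
Proof.
have [ic ce] := c2S; apply: le_trans ce.
have e i : \int[P]_w a w i 0 = \int[P]_w (c w * u w i 0).
  under eq_Rintegral do rewrite aE.
  have iD := integrableR_sqr (mDu i) (iDu2 i); have icu := integrableR_sqr (mcu i) (icu2 i).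
  have -> : \int[P]_w (D w * u w i 0 + c w * u w i 0 - gradient f y i 0) =
     \int[P]_w (D w * u w i 0) + \int[P]_w (c w * u w i 0) + - gradient f y i 0.
    rewrite expectD//; [|exact: integrableRD|exact: integrableR_cst].
    by rewrite expectD//; congr (_ + _); exact: expect_cst.
  by rewrite expect_Du; lra.
apply: (@le_trans _ _ (\sum_(i < n) \int[P]_w ((c w * u w i 0) ^+ 2))).
  by apply: ler_sum => i _; rewrite e; exact: sqr_expect_le.
rewrite -expect_sum//; apply: le_expect => //; first exact: integrableR_sum.
move=> w; rewrite /S /dotv mulr_sumr le_eqVlt; apply/orP; left; apply/eqP.
by apply: eq_bigr => i _; rewrite exprMn -expr2.
Qed.

End SingleSample.
End Oracle.

(** * Second moments of sums of uncorrelated variables *)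

Section UncorrelatedSums.
Context {R : realType} {d : measure_display} {Omega : measurableType d}.
Variable P : probability Omega R.

Lemma sqr_sum_le (I : Type) (s : seq I) (e : I -> R) :
  (\sum_(i <- s) e i) ^+ 2 <= (size s)%:R * \sum_(i <- s) e i ^+ 2.
Proof.
elim: s => [|i s IH]; first by rewrite !big_nil expr0n mulr0.
rewrite !big_cons /= -natr1; set E := \sum_(j <- s) e j; set S := \sum_(j <- s) _ ^+ 2.
rewrite -/E -/S in IH.
have cross : 2 * (e i * E) <= (size s)%:R * e i ^+ 2 + S.
  rewrite /E /S; elim: s {IH E S} => [|j s IH] /=.
    by rewrite !big_nil !mulr0 mul0r addr0.
  rewrite !big_cons -natr1; have := sqr_ge0 (e i - e j); lra.
lra.
Qed.

(** The summands may be biased, so the cross terms need not vanish; they recombine into the square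
    of the total mean, and the squared individual means are dropped. *)
Lemma expect_sqr_sum (I : eqType) (s : seq I) (a : I -> Omega -> R) : uniq s ->
  (forall i, i \in s -> measurable_fun setT (a i)) ->
  (forall i, i \in s -> integrableR P (fun w => a i w ^+ 2)) ->
  (forall i j, i \in s -> j \in s -> i != j ->
     \int[P]_w (a i w * a j w) = \int[P]_w a i w * \int[P]_w a j w) ->
  integrableR P (fun w => (\sum_(i <- s) a i w) ^+ 2) /\
  \int[P]_w ((\sum_(i <- s) a i w) ^+ 2) <=
    \sum_(i <- s) \int[P]_w (a i w ^+ 2) + (\sum_(i <- s) \int[P]_w a i w) ^+ 2.
Proof.
elim: s => [_ _ _ _|i s IH /= /andP[si us] ma ia uncor].
  rewrite !big_nil expr0n addr0; split.
    by under eq_fun do rewrite big_nil expr0n; exact: integrableR_cst.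
  under eq_Rintegral do rewrite big_nil expr0n.
  by rewrite (expect_cst P 0).
have mi : i \in i :: s by rewrite mem_head.
have ms j : j \in s -> j \in i :: s by rewrite inE orbC => ->.
have [iS le] := IH us (fun j js => ma j (ms _ js)) (fun j js => ia j (ms _ js))
  (fun j k js ks => uncor j k (ms _ js) (ms _ ks)).
have ij j : j \in s -> i != j by move=> js; apply: contraNneq si => ->.
have iaj j : j \in s -> integrableR P (fun w => a i w * a j w).
  by move=> js; apply: integrableRM2; [exact: ma|exact/ma/ms|exact: ia|exact/ia/ms].
(* The guard [j \in s] makes the family integrable at every index, as the sum lemmas ask. *)
have prodE w : a i w * \sum_(j <- s) a j w = \sum_(j <- s) (if j \in s then a i w * a j w else 0).
  by rewrite mulr_sumr !big_seq; apply: eq_bigr => j ->.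
have iif j : integrableR P (fun w => if j \in s then a i w * a j w else 0).
  by case js : (j \in s); [exact: iaj|exact: integrableR_cst].
have iprod : integrableR P (fun w => a i w * \sum_(j <- s) a j w).
  by under eq_fun do rewrite prodE; exact: integrableR_sum.
have eprod : \int[P]_w (a i w * \sum_(j <- s) a j w) =
    \int[P]_w a i w * \sum_(j <- s) \int[P]_w a j w.
  under eq_Rintegral do rewrite prodE.
  rewrite expect_sum// mulr_sumr !big_seq; apply: eq_bigr => j js.
  by rewrite js uncor// ?ij// ms.
have sqE w : (\sum_(j <- i :: s) a j w) ^+ 2 =
    a i w ^+ 2 + (2 * (a i w * \sum_(j <- s) a j w) + (\sum_(j <- s) a j w) ^+ 2).
  by rewrite big_cons; ring.
have i2 : integrableR P (fun w => 2 * (a i w * \sum_(j <- s) a j w)) by exact: integrableRZ.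
have i3 := integrableRD i2 iS.
split.
  by under eq_fun do rewrite sqE; apply: integrableRD => //; exact: ia.
under eq_Rintegral do rewrite sqE.
rewrite expectD//; last exact: ia.
rewrite expectD// expectZ// eprod !big_cons.
by have := sqr_ge0 (\int[P]_w a i w); lra.
Qed.

End UncorrelatedSums.

(** * One step of the method *)

Section Convexity.
Context {R : realType} {n : nat}.
Implicit Types x y : 'cV[R]_n.

Lemma convex_function_le (g : 'cV[R]_n -> R) (t : R) x y :
  convex_function setT g -> 0 <= t <= 1 ->
  g ((1 - t) *: x + t *: y) <= (1 - t) * g x + t * g y.
Proof.
move=> cg /andP[t0 t1]; have := cg (Itv01 t0 t1) y x (in_setT _) (in_setT _).
by rewrite addrC [leRHS]addrC.
Qed.

Lemma convex_set_mem (A : set 'cV[R]_n) (t : R) x y : convex_set A -> 0 <= t <= 1 ->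
  A x -> A y -> A ((1 - t) *: x + t *: y).
Proof.
move=> cA /andP[t0 t1] Ax Ay.
have := cA y x (Itv01 t0 t1) (mem_set Ay) (mem_set Ax).
by rewrite inE addrC.
Qed.

End Convexity.

(** * The Frank-Wolfe gap by blocks and the one-step inequality *)

Section FrankWolfeGap.
Context {R : realType} {b : nat} {ns : 'I_b -> nat}.
Local Notation n := (\sum_(s < b) ns s)%N.
Variables (f : 'cV[R]_n -> R) (X : forall s, set 'cV[R]_(ns s)).
Variables (chi : forall s, 'cV[R]_(ns s) -> R) (theta : 'cV[R]_n -> 'cV[R]_n).
Arguments X : clear implicits.
Arguments chi : clear implicits.

Definition block_gap (s : 'I_b) (x : 'cV[R]_n) : R :=
  dotv (block s (gradient f x)) (block s x - block s (theta x))
  + chi s (block s x) - chi s (block s (theta x)).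

Lemma fw_gap_block x : fw_gap f chi theta x = \sum_(s < b) block_gap s x.
Proof.
rewrite /fw_gap dotv_block /sepsum -big_split -sumrB /=.
by apply: eq_bigr => s _; rewrite blockB.
Qed.

Lemma prodset_update s (x : 'cV[R]_n) (y : 'cV[R]_(ns s)) : prodset X x -> X s y ->
  prodset X (x + Ublock s *m (y - block s x)).
Proof.
move=> Xx Xy s'; rewrite blockD; have [->|ss'] := eqVneq s' s.
  by rewrite block_Ublock addrC subrK.
by rewrite block_Ublock_neq// addr0; exact: Xx.
Qed.

Lemma sepsum_update s (x : 'cV[R]_n) (y : 'cV[R]_(ns s)) :
  sepsum chi (x + Ublock s *m (y - block s x)) =
  sepsum chi x - chi s (block s x) + chi s y.
Proof.
have e : block s (x + Ublock s *m (y - block s x)) = y.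
  by rewrite blockD block_Ublock addrC subrK.
rewrite /sepsum (bigD1 s)//= [in RHS](bigD1 s)//= e.
rewrite [chi s (block s x) + _]addrC addrK [RHS]addrC; congr (_ + _).
by apply: eq_bigr => s' ss'; rewrite blockD block_Ublock_neq// addr0.
Qed.

Hypothesis fw : fw_oracle X f chi theta.

(** A minimiser over the product minimises in each block: replace that single block of [theta x] by
    [y]. *)
Lemma theta_block_min s x y : prodset X x -> X s y ->
  dotv (block s (gradient f x)) (block s (theta x)) + chi s (block s (theta x)) <=
  dotv (block s (gradient f x)) y + chi s y.
Proof.
move=> Xx Xy; have [Xt tmin] := fw Xx.
have := tmin _ (prodset_update Xt Xy).
rewrite sepsum_update dotvDr dotv_Ublock dotvBr; lra.
Qed.

Lemma theta_block_mem s x : prodset X x -> X s (block s (theta x)).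
Proof. by move=> Xx; have [] := fw Xx. Qed.

(** The current block is the competitor. This sign is what permits replacing every p_s by the
    smallest one. *)
Lemma block_gap_ge0 s x : prodset X x -> 0 <= block_gap s x.
Proof.
move=> Xx; have := theta_block_min Xx (Xx s).
by rewrite /block_gap dotvBr; lra.
Qed.

Lemma fw_gap_ge0 x : prodset X x -> 0 <= fw_gap f chi theta x.
Proof. by move=> Xx; rewrite fw_gap_block sumr_ge0// => s _; exact: block_gap_ge0. Qed.

(** Two terms (L/2) alpha^2 D^2 arise, one from the descent inequality along y - x, one from Young's
    inequality with parameter L for the gradient error against alpha (theta - y). Convexity of the
    regulariser handles the partial move to y. *)
Lemma bccg_step s (x z' g : 'cV[R]_n) (y : 'cV[R]_(ns s)) (alpha Ls Ds : R) :
  prodset X x -> X s y -> 0 <= alpha <= 1 -> 0 < Ls ->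
  convex_function setT (chi s) ->
  (forall h, f (x + Ublock s *m h) <=
    f x + dotv (block s (gradient f x)) h + Ls / 2 * dotv h h) ->
  (forall x y, X s x -> X s y -> norm2 (x - y) <= Ds) ->
  argmin (X s) (fun y => dotv (block s g) y + chi s y) y ->
  z' = x + Ublock s *m (((1 - alpha) *: block s x + alpha *: y) - block s x) ->
  f z' + sepsum chi z' + alpha * block_gap s x <=
  f x + sepsum chi x + Ls * Ds ^+ 2 * alpha ^+ 2
  + norm2 (block s (g - gradient f x)) ^+ 2 / (2 * Ls).
Proof.
move=> Xx Xy a01 L0 cchi des DD [_ ymin] ->.
have /andP[a0 a1] := a01.
rewrite sepsum_update.
have Xt := theta_block_mem s Xx.
set t := block s (theta x) in Xt *; set v := block s (gradient f x).
have ty := ymin _ Xt.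
have cx := convex_function_le (block s x) y cchi a01.
have D2 p q : X s p -> X s q -> dotv (p - q) (p - q) <= Ds ^+ 2.
  move=> Xp Xq; rewrite -sqr_norm2 lerXn2r ?nnegrE ?norm2_ge0 ?DD//.
  exact: le_trans (norm2_ge0 _) (DD _ _ Xp Xq).
have Dxy := D2 _ _ Xy (Xx s); have Dty := D2 _ _ Xt Xy.
have := des (alpha *: (y - block s x)).
have -> : (1 - alpha) *: block s x + alpha *: y - block s x =
    alpha *: (y - block s x).
  by rewrite scalerBl scale1r scalerBr addrAC [_ - _ - _]addrAC subrr add0r addrC.
rewrite dotvZr dotvZl dotvZr -/v => d1.
have yg := dotv_young (block s (g - gradient f x)) (alpha *: (t - y)) L0.
rewrite dotvZr dotvZl dotvZr -sqr_norm2 in yg.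
rewrite blockB -/v in yg *.
have e : dotv (block s g - v) (t - y) = dotv (block s g) t - dotv (block s g) y
   - dotv v t + dotv v y by rewrite dotvBl !dotvBr; ring.
rewrite e in yg.
have k1 : Ls / 2 * (alpha * (alpha * dotv (y - block s x) (y - block s x))) <=
   Ls / 2 * alpha ^+ 2 * Ds ^+ 2.
  rewrite (_ : Ls / 2 * (alpha * (alpha * _)) = Ls / 2 * alpha ^+ 2 * dotv (y - block s x) (y - block s x)); last by ring.
  by rewrite ler_wpM2l// mulr_ge0 ?sqr_ge0// divr_ge0// ltW.
have k2 : Ls / 2 * (alpha * (alpha * dotv (t - y) (t - y))) <=
   Ls / 2 * alpha ^+ 2 * Ds ^+ 2.
  rewrite (_ : Ls / 2 * (alpha * (alpha * _)) = Ls / 2 * alpha ^+ 2 * dotv (t - y) (t - y)); last by ring.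
  by rewrite ler_wpM2l// mulr_ge0 ?sqr_ge0// divr_ge0// ltW.
have k3 := ler_wpM2l a0 ty.
rewrite [dotv v (y - _)]dotvBr in d1.
rewrite /block_gap -/t -/v dotvBr; lra.
Qed.

End FrankWolfeGap.

(** * Borel measurability of the objective and of minimal values *)

Section BorelObjective.
Context {R : realType}.

Lemma coord_BV_measurable n (i : 'I_n) :
  measurable_fun setT (fun x : @BV R n => (x : 'cV[R]_n) i 0 : R).
Proof. by apply: continuous_BV_measurable; exact: coord_continuous_cV. Qed.

Lemma dotv_continuous n (y : 'cV[R]_n) : continuous (fun u : 'cV[R]_n => dotv u y).
Proof.
rewrite /dotv; elim: (index_enum _) => [|i s IH] u.
  rewrite (_ : (fun v : 'cV[R]_n => _) = cst 0); first exact: cst_continuous.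
  by apply/funext => v; rewrite big_nil.
rewrite (_ : (fun v : 'cV[R]_n => _) =
    (fun v => v i 0 * y i 0 + \sum_(j <- s) v j 0 * y j 0)); last first.
  by apply/funext => v; rewrite big_cons.
apply: (@cvgD R R _ (nbhs u)); last exact: IH.
by apply: cvgM; [exact: coord_continuous_cV|exact: cvg_cst].
Qed.

(** A pointwise limit of continuous difference quotients, with steps 1/(k+1). *)
Lemma gradient_BV_measurable n (g : 'cV[R]_n -> R) (i : 'I_n) :
  (forall x, differentiable g x) ->
  measurable_fun setT (fun x : @BV R n => gradient g x i 0 : R).
Proof.
move=> dg; have cg : continuous g by move=> x; exact/differentiable_continuous.
pose e : 'cV[R]_n := delta_mx i 0.
pose q (k : nat) (x : @BV R n) : R := k.+1%:R * (g ((x : 'cV[R]_n) + k.+1%:R^-1 *: e) - g x).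
apply: (measurable_fun_cvg (h := q)) => //.
  move=> k; apply: measurable_funM => //; apply: measurable_funB; last first.
    exact: continuous_BV_measurable.
  apply: (continuous_BV_measurable (g := fun x => g (x + k.+1%:R^-1 *: e))) => x.
  apply: continuous_comp; last exact: cg.
  by apply: (@cvgD R 'cV[R]_n _ (nbhs x) _ id (cst _)); [exact: cvg_id|exact: cvg_cst].
move=> x _; rewrite mxE.
have := diff_derivable (v := e) (dg x); rewrite /derivable /derive => cv.
have /cvgr_dnbhsP/(_ harmonic) := cv; rewrite -/e => H.
have {}H := H (conj (fun k => lt0r_neq0 (harmonic_gt0 k)) cvg_harmonic).
apply: cvg_trans H; apply: near_eq_cvg; near=> k; rewrite /q /harmonic /= invrK.
by rewrite /shift /= [_ + x]addrC.
Unshelve. all: by end_near. Qed.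

(** The set where g > c is the complement of the slice at height c of the closed epigraph. *)
Lemma closed_function_measurable n (g : 'cV[R]_n -> R) : closed_function g ->
  measurable_fun setT (g : @BV R n -> R).
Proof.
move=> cg; apply: (measurability _ (RGenOInfty.measurableE R)) => _ [_ [c ->] <-].
rewrite setTI; apply: sub_sigma_algebra.
have -> : g @^-1` `]c, +oo[ = ~` ((fun x => (x, c)) @^-1` [set p | g p.1 <= p.2]).
  by apply/seteqP; split => x /=; rewrite in_itv /= andbT ltNge => /negP.
apply: closed_openC; apply: preimage_closed cg.
move=> x _; apply: (@cvg_pair _ _ _ (nbhs x) (nbhs x) (nbhs c) _ _ _ id (cst c)).
  exact: cvg_id.
exact: cvg_cst.
Qed.

Lemma dotv_BV_measurable d (T : measurableType d) n (g h : T -> 'cV[R]_n) :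
  measurable_fun setT (g : T -> @BV R n) -> measurable_fun setT (h : T -> @BV R n) ->
  measurable_fun setT (fun w => dotv (g w) (h w)).
Proof.
move=> mg mh; apply: measurable_sum => i; apply: measurable_funM.
  exact: measurableT_comp (coord_BV_measurable i) mg.
exact: measurableT_comp (coord_BV_measurable i) mh.
Qed.

Lemma sqr_norm2_BV_measurable d (T : measurableType d) n (g : T -> 'cV[R]_n) :
  measurable_fun setT (g : T -> @BV R n) ->
  measurable_fun setT (fun w => norm2 (g w) ^+ 2).
Proof.
move=> mg; rewrite (_ : (fun w => _) = (fun w => dotv (g w) (g w))).
  exact: dotv_BV_measurable.
by apply/funext => w; rewrite sqr_norm2.
Qed.

Lemma block_BV_measurable b (ns : 'I_b -> nat) (s : 'I_b) :
  measurable_fun setT (@block R b ns s : @BV R _ -> @BV R _).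
Proof.
apply: measurable_BV => i.
rewrite (_ : (fun w => _) = (fun w : @BV R _ => \sum_k (Ublock s)^T i k * (w : 'cV[R]_ _) k 0)); last first.
  by apply/funext => w; rewrite /block mxE.
by apply: measurable_sum => k; apply: measurable_funM => //; exact: coord_BV_measurable.
Qed.

(* The value function of a linear perturbation is upper semicontinuous: its
   superlevel sets are intersections of closed half spaces. *)
Lemma linear_min_measurable n (A : set 'cV[R]_n) (g : 'cV[R]_n -> R)
    d (T : measurableType d) (v : T -> 'cV[R]_n) (h : T -> R) :
  measurable_fun setT (v : T -> @BV R n) ->
  (forall w y, A y -> h w <= dotv (v w) y + g y) ->
  (forall w, exists2 y, A y & h w = dotv (v w) y + g y) ->
  measurable_fun setT h.
Proof.
move=> mv hle hex; apply: (measurability _ (RGenCInfty.measurableE R)) => _ [_ [c ->] <-].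
rewrite setTI.
pose C : set 'cV[R]_n := \bigcap_(y in A) [set u | c <= dotv u y + g y].
have -> : h @^-1` `[c, +oo[ = v @^-1` C.
  apply/seteqP; split => w /=; rewrite in_itv /= andbT.
    by move=> ch y Ay; exact: le_trans ch (hle w y Ay).
  by move=> Cw; have [y Ay ->] := hex w; exact: Cw.
rewrite -[X in measurable X]setTI; apply: mv => //.
rewrite -[C]setCK; apply: measurableC; apply: sub_sigma_algebra.
apply: closed_openC; apply: closed_bigI => y Ay.
have cd : continuous (fun u : 'cV[R]_n => dotv u y + g y).
  by move=> u; apply: (@cvgD R R _ (nbhs u)); [exact: dotv_continuous|exact: cvg_cst].
have /continuous_closedP/(_ _ (@closed_ge R c)) := cd.
by [].
Qed.

End BorelObjective.

(** * Averaging over the draws *)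

Lemma zo_gradient_measurable {R : realType} {b : nat} {ns : 'I_b -> nat}
    {dXi d} {Xi : measurableType dXi} {S : measurableType d}
    (F : 'cV[R]_(\sum_(s < b) ns s) -> Xi -> R) (mu : R)
    (y : S -> 'cV[R]_(\sum_(s < b) ns s)) (xi : S -> Xi)
    (u : S -> 'cV[R]_(\sum_(s < b) ns s)) :
  oracle_measurable F ->
  measurable_fun setT (y : S -> @BV R _) -> measurable_fun setT xi ->
  measurable_fun setT (u : S -> @BV R _) ->
  measurable_fun setT (fun w => zo_gradient F mu (y w) (xi w) (u w) : @BV R _).
Proof.
move=> mF my mxi mu_.
have cy i : measurable_fun setT (fun w => y w i 0 : R).
  exact: measurableT_comp (coord_BV_measurable i) my.
have cu i : measurable_fun setT (fun w => u w i 0 : R).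
  exact: measurableT_comp (coord_BV_measurable i) mu_.
have mFh (h : S -> 'cV[R]_(\sum_(s < b) ns s)) :
    (forall i, measurable_fun setT (fun w => h w i 0 : R)) ->
    measurable_fun setT (fun w => F (h w) (xi w)).
  move=> mh; have mhx : measurable_fun setT (fun w => (h w : @BV R _, xi w)).
    by apply/measurable_fun_pairP; split => //; exact: measurable_BV.
  exact: (measurableT_comp mF mhx).
apply: measurable_BV => i.
rewrite (_ : (fun w => _) = (fun w =>
    ((F (y w + mu *: u w) (xi w) - F (y w) (xi w)) / mu) * u w i 0)); last first.
  by apply/funext => w; rewrite /zo_gradient mxE.
apply: measurable_funM => //; apply: measurable_funM => //.
apply: measurable_funB; apply: mFh => j //.
rewrite (_ : (fun w => _) = (fun w => y w j 0 + mu * u w j 0)); last first.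
  by apply/funext => w; rewrite !mxE.
by apply: measurable_funD => //; exact: measurable_funM.
Qed.

Section Method.
Context {R : realType} {b : nat} {ns : 'I_b -> nat}.
Local Notation n := (\sum_(s < b) ns s)%N.
Context {dXi dO : measure_display} {Xi : measurableType dXi} {Omega : measurableType dO}.
Variables (Q : probability Xi R) (P : probability Omega R).
Variables (F : 'cV[R]_n -> Xi -> R) (f : 'cV[R]_n -> R).
Variable X : forall s, set 'cV[R]_(ns s).
Arguments X : clear implicits.
Variables (sigma Lf M mu : R) (L p : 'I_b -> R).
Variables (T : nat) (Tb : nat -> nat) (PR : nat -> R) (r : randomness R ns Xi Omega).
Hypotheses (mF : oracle_measurable F)
  (unbiased : unbiased_bounded_variance Q F f X sigma)
  (lip : lipschitz_gradients Q F Lf L)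
  (gradM : bounded_gradient f X M) (mu0 : 0 < mu)
  (Tb_ge1 : forall k, (1 <= k <= T)%N -> (1 <= Tb k)%N)
  (hr : zs_bccg_randomness P Q T Tb p PR r).

Let G := draw_sigma r.
Let V := drawn T Tb.
(** [<<s gen (drawn_before Tb k)>>] is [history r Tb k], so adaptedness reads as [gmeasurable]. *)
Let gen (A : set draw) := \bigcup_(j in A) G j.

Let GT j : V j -> G j setT.
Proof.
move=> _; case: j => [|k|k t|k t]; apply: sigma_of_setT => //.
exact: (@measurableT _ (@BV R n)).
Qed.

Let GI j : V j -> setI_closed (G j).
Proof.
move=> _; case: j => [|k|k t|k t]; apply: sigma_of_setI => //.
  exact: measurableI.
exact: (@measurableI _ (@BV R n)).
Qed.

Let draws_independent {d1 d2} {T1 : measurableType d1} {T2 : measurableType d2}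
    (A B : set draw) (g : Omega -> T1) (h : Omega -> T2) :
  A `<=` V -> B `<=` V -> A `&` B = set0 ->
  gmeasurable (gen A) g -> gmeasurable (gen B) h -> independent_maps P g h.
Proof.
apply: gmeasurable_independent; [exact: draw_independent hr|exact: GT|exact: GI|].
exact: draw_measurable hr.
Qed.

Let draws_measurable {d1} {T1 : measurableType d1} (A : set draw) (g : Omega -> T1) :
  A `<=` V -> gmeasurable (gen A) g -> measurable_fun setT g.
Proof.
move=> AV; apply: gmeasurable_measurable => E [j Aj].
by apply: (draw_measurable hr); exact: AV.
Qed.

Let draw_gmeasurable {d1} {T1 : measurableType d1} (A : set draw) j (g : Omega -> T1) :
  A j -> (forall B, measurable B -> G j (g @^-1` B)) -> gmeasurable (gen A) g.
Proof.
move=> Aj gG; apply/gmeasurableP => B mB; apply: sub_gen_smallest.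
by exists j => //; exact: gG.
Qed.

Let sample_gmeasurable (A : set draw) k t : A (DrawSample k t) ->
  gmeasurable (gen A) (rsample r k t).
Proof. by move=> /draw_gmeasurable; apply=> B mB; exact: sigma_ofP. Qed.

Let dir_gmeasurable (A : set draw) k t : A (DrawDirection k t) ->
  gmeasurable (gen A) (rdir r k t : Omega -> @BV R n).
Proof. by move=> /draw_gmeasurable; apply=> B mB; exact: sigma_ofP. Qed.

Definition step_draws k t : set draw := [set DrawSample k t; DrawDirection k t].

Definition batch_draws k : set draw := \bigcup_(t in [set t | batch Tb k t]) step_draws k t.

Let batch_sub k : (1 <= k <= T)%N -> batch_draws k `<=` V.
Proof.
move=> kT _ [t /= bt [] ->]; right => /=; split=> //.
Qed.

Let drawn_before_sub k : (k <= T.+1)%N -> drawn_before Tb k `<=` V.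
Proof.
move=> kT [|l|l t|l t] //= h; right => //=.
- by move: h => /andP[-> /leq_trans]; apply.
- by case: h => /andP[-> /leq_trans l1] ?; split=> //; exact: l1.
- by case: h => /andP[-> /leq_trans l1] ?; split=> //; exact: l1.
Qed.

Let before_batch_disjoint k : drawn_before Tb k `&` batch_draws k = set0.
Proof.
by apply/seteqP; split => // j [+ [t _ [] e]]; rewrite e /= ltnn andbF => -[].
Qed.

(** The vector [y] is an argument distinct from the sample point, so that the same error is studied
    at a frozen vector and at [z k w]. *)
Definition batch_error k (y : 'cV[R]_n) (w : Omega) : 'cV[R]_n :=
  (Tb k)%:R^-1 *: \sum_(1 <= t < (Tb k).+1)
    zo_gradient F mu y (rsample r k t w) (rdir r k t w) - gradient f y.

Section FixedPoint.
Variables (k : nat) (y : 'cV[R]_n).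
Hypotheses (kT : (1 <= k <= T)%N) (Xy : prodset X y).

Let a t w := zo_gradient F mu y (rsample r k t w) (rdir r k t w) - gradient f y.
Let N : R := n%:R.

Let step_sub t : batch Tb k t -> step_draws k t `<=` V.
Proof. by move=> bt j tj; apply: (batch_sub kT); exists t. Qed.

Let a_gmeasurable t i : gmeasurable (gen (step_draws k t)) (fun w => a t w i 0 : R).
Proof.
rewrite (_ : (fun w => _) = (fun w => zo_gradient F mu y (rsample r k t w) (rdir r k t w) i 0
    - gradient f y i 0)); last first.
  by apply/funext => w; rewrite /a [LHS]mxE [X in _ + X]mxE.
apply: measurable_funB => //.
apply: measurableT_comp (coord_BV_measurable i) _.
apply: zo_gradient_measurable => //.
- by apply: sample_gmeasurable; left.
- by apply: dir_gmeasurable; right.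
Qed.

Let sample_facts t : batch Tb k t ->
  [/\ forall i, integrableR P (fun w => a t w i 0 ^+ 2),
      \sum_(i < n) \int[P]_w (a t w i 0 ^+ 2) <=
        8 * (N + 2) * (M ^+ 2 + sigma ^+ 2)
        + mu ^+ 2 * Lf ^+ 2 * (N * (N + 2) * (N + 4)) + 2 * M ^+ 2 &
      \sum_(i < n) (\int[P]_w a t w i 0) ^+ 2 <=
        mu ^+ 2 * Lf ^+ 2 / 4 * (N * (N + 2) * (N + 4))].
Proof.
move=> bt; have [/andP[t1 tT]] := (bt, kT).
have Vs : V (DrawSample k t) by apply: (step_sub bt); left.
have Vd : V (DrawDirection k t) by apply: (step_sub bt); right.
have gs : gmeasurable (gen [set DrawSample k t]) (rsample r k t) by exact: sample_gmeasurable.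
have gd : gmeasurable (gen [set DrawDirection k t]) (rdir r k t : Omega -> @BV R n).
  exact: dir_gmeasurable.
have sub1 j : V j -> [set j] `<=` V by move=> Vj _ ->.
have mxi := draws_measurable (sub1 _ Vs) gs.
have mu_ i : measurable_fun setT (fun w => rdir r k t w i 0 : R).
  exact: measurableT_comp (coord_BV_measurable i) (draws_measurable (sub1 _ Vd) gd).
have xiu : independent_maps P (rsample r k t) (rdir r k t : Omega -> @BV R n).
  apply: draws_independent (sub1 _ Vs) (sub1 _ Vd) _ gs gd.
  by apply/seteqP; split => // j [/= ->].
have lawxi A (mA : measurable A) := rsample_law hr kT bt mA.
have gu := rdir_law hr kT bt.
split.
- exact: (sample_error_sqr_integrable mF unbiased lip gradM mu0 mxi lawxi gu mu_ xiu Xy).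
- exact: (sample_error_second_moment mF unbiased lip gradM mu0 mxi lawxi gu mu_ xiu Xy).
- exact: (sample_error_bias mF unbiased lip gradM mu0 mxi lawxi gu mu_ xiu Xy).
Qed.

Let batch_iota t : t \in index_iota 1 (Tb k).+1 -> batch Tb k t.
Proof. by rewrite mem_index_iota ltnS. Qed.

Let uncorrelated t t' i : batch Tb k t -> batch Tb k t' -> t != t' ->
  \int[P]_w (a t w i 0 * a t' w i 0) = \int[P]_w a t w i 0 * \int[P]_w a t' w i 0.
Proof.
move=> bt bt' tt'; have [i1 _ _] := sample_facts bt; have [i2 _ _] := sample_facts bt'.
have g1 := @a_gmeasurable t i; have g2 := @a_gmeasurable t' i.
apply: expect_indepM.
- apply: draws_independent (step_sub bt) (step_sub bt') _ g1 g2.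
  apply/seteqP; split => // j [[] -> [] []] e; move: tt'; rewrite ?e ?eqxx//.
- exact: integrableR_sqr (draws_measurable (step_sub bt) g1) (i1 i).
- exact: integrableR_sqr (draws_measurable (step_sub bt') g2) (i2 i).
Qed.

Lemma batch_error_second_moment :
  integrableR P (fun w => norm2 (batch_error k y w) ^+ 2) /\
  \int[P]_w (norm2 (batch_error k y w) ^+ 2) <=
    (8 * (N + 2) * (M ^+ 2 + sigma ^+ 2)
      + mu ^+ 2 * Lf ^+ 2 * (N * (N + 2) * (N + 4)) + 2 * M ^+ 2) / (Tb k)%:R
    + mu ^+ 2 * Lf ^+ 2 / 4 * (N * (N + 2) * (N + 4)).
Proof.
set A := 8 * _ * _ + _ + _; set B := _ / 4 * _.
pose m : R := (Tb k)%:R; have m0 : 0 < m by rewrite ltr0n Tb_ge1.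
pose s := index_iota 1 (Tb k).+1.
have ss : size s = Tb k by rewrite size_iota subSS subn0.
pose Z i w := (\sum_(t <- s) a t w i 0) ^+ 2.
have normE w : norm2 (batch_error k y w) ^+ 2 = m ^- 2 * \sum_(i < n) Z i w.
  rewrite /batch_error.
  have -> : m^-1 *: \sum_(1 <= t < (Tb k).+1)
      zo_gradient F mu y (rsample r k t w) (rdir r k t w) - gradient f y =
      m^-1 *: \sum_(t <- s) a t w.
    rewrite /a sumrB scalerBr sumr_const_nat subSS subn0 -scaler_nat scalerA.
    by rewrite mulVf ?scale1r// gt_eqF.
  rewrite sqr_norm2 dotvZl dotvZr mulrA -expr2 exprVn; congr (_ * _).
  by apply: eq_bigr => i _; rewrite -expr2 /Z summxE.
have us : uniq s by exact: iota_uniq.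
have ma t i : t \in s -> measurable_fun setT (fun w => a t w i 0 : R).
  by move=> /batch_iota bt; exact: draws_measurable (step_sub bt) (@a_gmeasurable t i).
have Zb i : integrableR P (Z i) /\ \int[P]_w Z i w <=
    \sum_(t <- s) \int[P]_w (a t w i 0 ^+ 2) + (\sum_(t <- s) \int[P]_w a t w i 0) ^+ 2.
  apply: (expect_sqr_sum (a := fun t w => a t w i 0) us).
  - by move=> t ts; exact: ma.
  - by move=> t /batch_iota /sample_facts[].
  - by move=> t t' /batch_iota bt /batch_iota bt'; exact: uncorrelated.
have iZ : integrableR P (fun w => \sum_(i < n) Z i w).
  by apply: integrableR_sum => i; have [] := Zb i.
split; first by under eq_fun do rewrite normE; exact: integrableRZ.
under eq_Rintegral do rewrite normE.
rewrite expectZ// expect_sum; last by move=> i; have [] := Zb i.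
(* [m * A] collects the individual second moments; the squared sum of m means costs another factor
   m. Division by m^2 leaves A / m + B. *)
have S1 : \sum_(i < n) \int[P]_w Z i w <= m * A + m * (m * B).
  apply: (@le_trans _ _ (\sum_(i < n) (\sum_(t <- s) \int[P]_w (a t w i 0 ^+ 2)
      + m * \sum_(t <- s) (\int[P]_w a t w i 0) ^+ 2))).
    apply: ler_sum => i _; have [_ le] := Zb i; apply: le_trans le _.
    by rewrite lerD2l /m -ss; exact: sqr_sum_le.
  rewrite big_split /= -mulr_sumr [X in X + _ <= _]exchange_big /=.
  rewrite [X in _ + m * X <= _]exchange_big /=.
  have ub (g : nat -> R) K : (forall t, t \in s -> g t <= K) -> \sum_(t <- s) g t <= m * K.
    move=> gK; apply: (@le_trans _ _ (\sum_(t <- s) K)).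
      by rewrite !big_seq; apply: ler_sum => t; exact: gK.
    by rewrite big_const_seq count_predT iter_addr_0 ss -mulr_natl.
  apply: lerD; first by apply: ub => t /batch_iota /sample_facts[].
  rewrite ler_pM2l//; apply: ub => t /batch_iota /sample_facts[_ _ h]; exact: h.
apply: le_trans (ler_wpM2l _ S1) _; first by rewrite invr_ge0 sqr_ge0.
by rewrite le_eqVlt; apply/orP; left; apply/eqP; field; rewrite gt_eqF.
Qed.

End FixedPoint.

Let Tb_batch k t : t \in index_iota 1 (Tb k).+1 -> batch Tb k t.
Proof. by rewrite mem_index_iota ltnS. Qed.

Let batch_error_measurable {d} {S : measurableType d} k (y : S -> 'cV[R]_n) (g : S -> Omega) :
  measurable_fun setT (y : S -> @BV R n) ->
  (forall t, batch Tb k t -> measurable_fun setT (rsample r k t \o g)) ->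
  (forall t, batch Tb k t -> measurable_fun setT (rdir r k t \o g : S -> @BV R n)) ->
  measurable_fun setT (fun q => batch_error k (y q) (g q) : @BV R n).
Proof.
move=> my mxi mu_; apply: measurable_BV => i.
rewrite (_ : (fun w => _) = (fun w => (Tb k)%:R^-1 * (\sum_(t <- index_iota 1 (Tb k).+1)
    zo_gradient F mu (y w) (rsample r k t (g w)) (rdir r k t (g w)) i 0)
    - gradient f (y w) i 0)); last first.
  apply/funext => w; rewrite /batch_error [LHS]mxE [X in _ + X]mxE; congr (_ - _).
  by rewrite [LHS]mxE summxE.
apply: measurable_funB; last first.
  have [_ df _ _] := unbiased.
  exact: measurableT_comp (gradient_BV_measurable i df) my.
apply: measurable_funM => //; apply: measurable_sum_seq => t /Tb_batch bt.
apply: measurableT_comp (coord_BV_measurable i) _.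
exact: zo_gradient_measurable mF my (mxi t bt) (mu_ t bt).
Qed.

Let norm2_block_measurable {d} {S : measurableType d} (g : S -> 'cV[R]_n) s :
  measurable_fun setT (g : S -> @BV R n) ->
  measurable_fun setT (fun q => norm2 (block s (g q)) ^+ 2).
Proof.
move=> mg; apply: sqr_norm2_BV_measurable.
exact: measurableT_comp (@block_BV_measurable R b ns s) mg.
Qed.

Section RandomPoint.
Variables (k : nat) (y : Omega -> 'cV[R]_n).
Hypotheses (kT : (1 <= k <= T)%N) (Xy : forall w, prodset X (y w))
  (my : gmeasurable (gen (drawn_before Tb k)) (y : Omega -> @BV R n)).

Let kT1 : (k <= T.+1)%N. Proof. by have /andP[_ /leqW] := kT. Qed.

Let C : R := let N : R := n%:R in
  (8 * (N + 2) * (M ^+ 2 + sigma ^+ 2)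
    + mu ^+ 2 * Lf ^+ 2 * (N * (N + 2) * (N + 4)) + 2 * M ^+ 2) / (Tb k)%:R
  + mu ^+ 2 * Lf ^+ 2 / 4 * (N * (N + 2) * (N + 4)).

(* The samples of step k are independent of the past, so the point can be frozen. *)
Lemma random_batch_error_second_moment :
  (\int[P]_w (norm2 (batch_error k (y w) w) ^+ 2)%:E <= C%:E)%E.
Proof.
(* [S] is [Omega] with only the events of the batch of step k: the identity into [S] stands for all
   the draws of the batch at once. *)
pose S := g_sigma_algebraType (gen (batch_draws k)).
pose h (q : @BV R n * S) : \bar R := (norm2 (batch_error k q.1 q.2) ^+ 2)%:E.
have mh : measurable_fun setT h.
  apply/measurable_EFinP.
  have mb : measurable_fun setT (fun q : @BV R n * S => batch_error k q.1 q.2 : @BV R n).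
    apply: batch_error_measurable => // t bt.
      apply: measurableT_comp _ measurable_snd; apply: sample_gmeasurable.
      by exists t => //; left.
    apply: (measurableT_comp (f := rdir r k t : S -> @BV R n)) => //.
    by apply: dir_gmeasurable; exists t => //; right.
  exact: sqr_norm2_BV_measurable.
have h0 q : (0 <= h q)%E by rewrite lee_fin sqr_ge0.
have mY := draws_measurable (drawn_before_sub kT1) my.
have gid : gmeasurable (gen (batch_draws k)) (fun w => w : S) by exact: measurable_id.
have mid := draws_measurable (batch_sub kT) gid.
have ind := draws_independent (drawn_before_sub kT1) (batch_sub kT)
  (before_batch_disjoint k) my gid.
apply: (ge0_decouple_le mY mid ind mh h0) => w.
have [i le] := batch_error_second_moment kT (Xy w).
by rewrite /h /= -EFin_expect// lee_fin.
Qed.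

End RandomPoint.

(** Split along the values of [c]: each indicator is independent of [phi i] and has mean [q i]. It
    serves both the drawn block and the random output. *)
Let choice_average (I : finType) (c : Omega -> I) (q : I -> R) (A B : set draw) j
    (phi : I -> Omega -> R) :
  B j -> sigma_of setT c `<=` G j -> (forall i, P (c @^-1` [set i]) = (q i)%:E) ->
  A `<=` V -> B `<=` V -> A `&` B = set0 ->
  (forall i, gmeasurable (gen A) (phi i)) -> (forall i w, 0 <= phi i w) ->
  measurable_fun setT (fun w => phi (c w) w) /\
  (\int[P]_w (phi (c w) w)%:E = \int[P]_w (\sum_(i : I) q i * phi i w)%:E)%E.
Proof.
move=> Bj Gj qE AV BV AB mphi phi0.
pose ind i w : R := (c w == i)%:R.
have mset i : measurable (c @^-1` [set i]).
  by apply: (draw_measurable hr (BV _ Bj)); apply: Gj; exact: sigma_ofP.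
have indE i : ind i = \1_(c @^-1` [set i]).
  apply/funext => w; rewrite /ind indicE; congr (nat_of_bool _)%:R.
  apply/idP/idP => [/eqP e|]; first by rewrite inE.
  by rewrite inE => /= ->.
have gind i : gmeasurable (gen B) (ind i).
  by apply: (draw_gmeasurable Bj) => E _; apply: Gj;
    exists ((fun i' => (i' == i)%:R : R) @^-1` E) => //; rewrite setTI.
have ph i := draws_measurable AV (mphi i).
have mi i := draws_measurable BV (gind i).
have q0 i : 0 <= q i by rewrite -lee_fin -qE.
have lhs w : phi (c w) w = \sum_(i : I) phi i w * ind i w.
  rewrite (bigD1 (c w))//= /ind eqxx mulr1 big1 ?addr0// => i ic.
  by rewrite eq_sym (negbTE ic) mulr0.
split.
  under eq_fun do rewrite lhs.
  by apply: measurable_sum => i; exact: measurable_funM.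
transitivity (\int[P]_w (\sum_(i : I) (phi i w * ind i w)%:E))%E.
  by apply: eq_integral => w _; rewrite lhs sumEFin.
transitivity (\int[P]_w (\sum_(i : I) (q i * phi i w)%:E))%E; last first.
  by apply: eq_integral => w _; rewrite sumEFin.
rewrite !ge0_integral_sum//; last 4 first.
- by move=> i; exact/measurable_EFinP/measurable_funM.
- by move=> i w _; rewrite lee_fin mulr_ge0.
- by move=> i; exact/measurable_EFinP/measurable_funM.
- by move=> i w _; rewrite lee_fin mulr_ge0// /ind ler0n.
apply: eq_bigr => i _.
rewrite ge0_expectationM//; last exact: draws_independent AV BV AB (mphi i) (gind i).
have -> : (\int[P]_w (ind i w)%:E = (q i)%:E)%E.
  by rewrite indE integral_indic// setIT; exact: qE.
under [RHS]eq_integral do rewrite EFinM.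
rewrite ge0_integralZl//; first by rewrite muleC.
- exact/measurable_EFinP.
- by move=> w _; rewrite lee_fin.
- by rewrite lee_fin.
Qed.

(** The block index is independent of the past and the batch jointly, so [phi s] may involve the
    batch error of step k in a fixed block s. *)
Lemma block_average k (phi : 'I_b -> Omega -> R) : (1 <= k <= T)%N ->
  (forall s, gmeasurable (gen (drawn_before Tb k `|` batch_draws k)) (phi s)) ->
  (forall s w, 0 <= phi s w) ->
  measurable_fun setT (fun w => phi (rblock r k w) w) /\
  (\int[P]_w (phi (rblock r k w) w)%:E = \int[P]_w (\sum_(s < b) p s * phi s w)%:E)%E.
Proof.
move=> kT mphi phi0; have /andP[k1 kT'] := kT.
apply: (choice_average (B := [set DrawBlock k]) (j := DrawBlock k) _ _ _ _ _ _ mphi) => //.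
- by move=> s; exact: (rblock_law hr s kT).
- by rewrite subUset; split; [exact/drawn_before_sub/leqW|exact: batch_sub].
- by move=> j ->; right => /=; rewrite k1 ltnS.
- apply/seteqP; split => // j [h /= e]; move: h; rewrite e => -[/=|[t _ []//]].
  by rewrite ltnn andbF.
Qed.

Lemma output_average (phi : nat -> Omega -> R) :
  (forall k, (1 <= k <= T)%N -> gmeasurable (gen (drawn_before Tb T.+1)) (phi k)) ->
  (forall k w, (1 <= k <= T)%N -> 0 <= phi k w) ->
  (\int[P]_w (phi (rout r w) w)%:E =
   \int[P]_w (\sum_(1 <= k < T.+1) PR k * phi k w)%:E)%E.
Proof.
move=> mphi phi0.
(* Outputs run over 1..T; slot 0 of ['I_T.+1] is never taken and receives weight 0. *)
pose c w : 'I_T.+1 := inord (rout r w).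
pose psi (i : 'I_T.+1) w := if (0 < i)%N then phi i w else 0.
pose q (i : 'I_T.+1) := if (0 < i)%N then PR i else 0.
have cE w : c w = rout r w :> nat.
  by rewrite inordK// ltnS; have /andP[] := rout_range hr w.
have phi_psi w : phi (rout r w) w = psi (c w) w.
  by rewrite /psi cE; have /andP[-> _] := rout_range hr w.
transitivity (\int[P]_w (\sum_(i < T.+1) q i * psi i w)%:E)%E; last first.
  apply: eq_integral => w _; congr _%:E.
  rewrite big_ord_recl /= /q /psi /= mul0r add0r -(big_mkord xpredT (fun i =>
    (if (0 < i.+1)%N then PR i.+1 else 0) * (if (0 < i.+1)%N then phi i.+1 w else 0))).
  by rewrite [RHS]big_add1.
under eq_integral do rewrite phi_psi.
apply: (proj2 (choice_average (A := drawn_before Tb T.+1) (B := [set DrawOutput]) (j := DrawOutput) _ _ _ _ _ _ _ _)) => //.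
- move=> _ [E _ <-]; exists (inord @^-1` E : set nat) => //.
- move=> i; rewrite /q; case: ifP => i0.
    rewrite -(rout_law hr (k := i)); last by rewrite i0 -ltnS ltn_ord.
    congr (P _); apply/seteqP; split => w /=; first by move=> <-; rewrite cE.
    by move=> e; apply: val_inj; rewrite /= cE.
  rewrite (_ : c @^-1` _ = set0) ?measure0//; apply/seteqP; split => // w /= e.
  by have := rout_range hr w; rewrite -cE e i0.
- exact: drawn_before_sub.
- by move=> j ->; left.
- by apply/seteqP; split => // j [h /= e]; move: h; rewrite e.
- move=> i; have [i0|i0] := boolP (0 < i)%N.
    rewrite (_ : psi i = phi i); last by apply/funext => w; rewrite /psi i0.
    by apply: mphi; rewrite i0 -ltnS ltn_ord.
  rewrite (_ : psi i = cst 0); first exact: measurable_cst.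
  by apply/funext => w; rewrite /psi (negbTE i0).
- move=> i w; rewrite /psi; case: ifP => i0 //.
  by apply: phi0; rewrite i0 -ltnS ltn_ord.
Qed.

(** * Telescoping along the iterates and the random output *)

Section Iterates.
Variable chi : forall s, 'cV[R]_(ns s) -> R.
Arguments chi : clear implicits.
Variables (alpha : nat -> R) (D : 'I_b -> R) (z1 : 'cV[R]_n).
Variables (x z : nat -> Omega -> 'cV[R]_n) (theta : 'cV[R]_n -> 'cV[R]_n).
Variable Phistar : R.
Let Phi y := f y + sepsum chi y.
Hypotheses (feas : feasible_blocks X) (reg : regularizers chi)
  (bdd : bounded_blocks X D) (Phimin : is_min (prodset X) Phi Phistar)
  (alpha01 : forall k, (1 <= k <= T)%N -> 0 < alpha k <= 1)
  (p01 : forall s, 0 <= p s <= 1)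
  (Xz1 : prodset X z1) (hz : zs_bccg_iterates F X chi mu T alpha Tb r z1 x z)
  (fw : fw_oracle X f chi theta).

Let z_feasible k w : (1 <= k <= T.+1)%N -> prodset X (z k w).
Proof.
elim: k => // k IH /andP[_]; rewrite ltnS => kT.
case: k IH kT => [_ _|k IH kT]; first by rewrite (z_init hz).
have k1T : (1 <= k.+1 <= T)%N by [].
have Xz := IH (leqW kT) => s.
have [->|si] := eqVneq s (rblock r k.+1 w); last by rewrite (z_frozen hz k1T si).
have /andP[a0 a1] := alpha01 k1T.
rewrite (z_step hz w k1T); apply: convex_set_mem; [exact: (feas _).2|by rewrite ltW|exact: Xz|].
by have [] := x_step hz w k1T.
Qed.

Let z_update k w : (1 <= k <= T)%N -> z k.+1 w = z k w + Ublock (rblock r k w) *m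
  (((1 - alpha k) *: block (rblock r k w) (z k w)
    + alpha k *: block (rblock r k w) (x k.+1 w)) - block (rblock r k w) (z k w)).
Proof.
move=> kT; rewrite [LHS]sum_Ublock [RHS]sum_Ublock; apply: eq_bigr => s _; congr (_ *m _).
rewrite blockD; have [->|si] := eqVneq s (rblock r k w).
  by rewrite block_Ublock addrC subrK (z_step hz w kT).
by rewrite block_Ublock_neq// addr0 (z_frozen hz kT si).
Qed.

Let step_pointwise k w (i := rblock r k w) : (1 <= k <= T)%N ->
  Phi (z k.+1 w) + alpha k * block_gap f chi theta i (z k w) <=
  Phi (z k w) + (L i * D i ^+ 2 * alpha k ^+ 2
    + norm2 (block i (batch_error k (z k w) w)) ^+ 2 / (2 * L i)).
Proof.
move=> kT; rewrite addrA.
have Xz : prodset X (z k w) by apply: z_feasible; case/andP: kT => -> /leqW ->.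
have [_ L0 _] := lip; have /andP[a0 a1] := alpha01 kT.
apply: (bccg_step (X := X) fw (y := block i (x k.+1 w)) Xz) => //.
- by have [] := x_step hz w kT.
- by rewrite ltW.
- exact: (reg i).2.
- by move=> h; exact: (block_descent unbiased lip).
- exact: (bdd i).2.
- have := x_step hz w kT; rewrite /batch_gradient -/i.
  by rewrite blockZ block_sum.
- exact: z_update.
Qed.

Let z_gmeasurable k : (1 <= k <= T)%N ->
  gmeasurable (gen (drawn_before Tb k)) (z k : Omega -> @BV R n).
Proof.
move=> kT; apply/gmeasurableP => A mA.
by apply: (z_adapted hz kT); exact: sigma_ofP.
Qed.

Let gradient_measurable : measurable_fun setT (gradient f : @BV R n -> @BV R n).
Proof.
have [_ df _ _] := unbiased.
by apply: measurable_BV => i; exact: gradient_BV_measurable.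
Qed.

Let Phi_measurable : measurable_fun setT (Phi : @BV R n -> R).
Proof.
have [_ df _ _] := unbiased.
apply: measurable_funD.
  by apply: continuous_BV_measurable => y; exact: differentiable_continuous.
apply: measurable_sum => s.
exact: measurableT_comp (closed_function_measurable (reg s).1) (@block_BV_measurable R b ns s).
Qed.

(** [theta] is an arbitrary selection; the gap involves it only through the minimal value of the
    linearised block problem, and that value is measurable. *)
Let block_gap_measurable {d} {S : measurableType d} (y : S -> 'cV[R]_n) s :
  measurable_fun setT (y : S -> @BV R n) -> (forall w, prodset X (y w)) ->
  measurable_fun setT (fun w => block_gap f chi theta s (y w)).
Proof.
move=> my Xy; pose v w := block s (gradient f (y w)).
have mv : measurable_fun setT (v : S -> @BV R _).
  apply: measurableT_comp (@block_BV_measurable R b ns s) _.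
  exact: measurableT_comp gradient_measurable my.
have mb : measurable_fun setT (fun w => block s (y w) : @BV R _).
  exact: measurableT_comp (@block_BV_measurable R b ns s) my.
have mm : measurable_fun setT (fun w => dotv (v w) (block s (theta (y w)))
    + chi s (block s (theta (y w)))).
  apply: (linear_min_measurable (A := X s) (g := chi s) mv).
    by move=> w y' Xy'; exact: (theta_block_min fw (Xy w) Xy').
  move=> w; exists (block s (theta (y w))) => //; exact: (theta_block_mem fw s (Xy w)).
rewrite (_ : (fun w => _) = (fun w => dotv (v w) (block s (y w)) + chi s (block s (y w))
    - (dotv (v w) (block s (theta (y w))) + chi s (block s (theta (y w)))))); last first.
  by apply/funext => w; rewrite /block_gap dotvBr -/(v w); ring.
apply: measurable_funB => //; apply: measurable_funD; first exact: dotv_BV_measurable.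
exact: measurableT_comp (closed_function_measurable (reg s).1) mb.
Qed.

(** Centring at the minimum makes [Psi] nonnegative on feasible points, so that its integrals add in
    the extended reals. *)
Let Psi k w := Phi (z k w) - Phistar.
Let gap k w := fw_gap f chi theta (z k w).
Let pmin : R := \big[Num.min/1]_(s < b) p s.
Let pl : R := \big[Num.max/0]_(s < b) (p s / L s).
Let sigmat2 : R := 4 * (n%:R + 4)
    * (2 * M ^+ 2 + sigma ^+ 2 + mu ^+ 2 * Lf ^+ 2 * (n%:R + 4) ^+ 2).
Let noise k : R := sigmat2 / (Tb k)%:R + mu ^+ 2 / 4 * Lf ^+ 2 * (n%:R + 3) ^+ 3.
Let cost k : R := (\sum_(s < b) p s * L s * D s ^+ 2) * alpha k ^+ 2 + pl * noise k.

Let Psi_ge0 k w : (1 <= k <= T.+1)%N -> 0 <= Psi k w.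
Proof.
move=> kT; have [y [_ ymin] e] := Phimin; rewrite /Psi e subr_ge0.
by apply: ymin; exact: z_feasible.
Qed.

Let le_T1 k : (1 <= k <= T)%N -> (1 <= k <= T.+1)%N.
Proof. by move=> /andP[-> /leqW ->]. Qed.

Let gap_ge0 k w : (1 <= k <= T)%N -> 0 <= gap k w.
Proof. by move=> kT; exact/(fw_gap_ge0 fw)/z_feasible/le_T1. Qed.

Let L_gt0 s : 0 < L s. Proof. by have [] := lip. Qed.

Let p_ge0 s : 0 <= p s. Proof. by have /andP[] := p01 s. Qed.

Let pmin_ge0 : 0 <= pmin.
Proof. by apply/bigmin_geP; split => // s _; exact: p_ge0. Qed.

Let pmin_le s : pmin <= p s. Proof. exact: bigmin_le. Qed.

Let pl_ge s : p s / L s <= pl. Proof. exact: le_bigmax. Qed.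

Let pl_ge0 : 0 <= pl. Proof. exact: bigmax_ge_id. Qed.

Let z_measurable k : (1 <= k <= T)%N -> measurable_fun setT (z k : Omega -> @BV R n).
Proof.
move=> kT; apply: draws_measurable (z_gmeasurable kT).
by apply: drawn_before_sub; case/andP: (le_T1 kT).
Qed.

Let Psi_measurable k : (1 <= k <= T)%N -> measurable_fun setT (Psi k).
Proof.
move=> kT; apply: measurable_funB => //.
exact: measurableT_comp Phi_measurable (z_measurable kT).
Qed.

(** The factor 2 is the one in |e|^2 / (2 L). *)
Let noise_bound k : (1 <= k <= T)%N ->
  (\int[P]_w (norm2 (batch_error k (z k w) w) ^+ 2)%:E <= (2 * noise k)%:E)%E.
Proof.
move=> kT; apply: le_trans (random_batch_error_second_moment kT
  (fun w => z_feasible w (le_T1 kT)) (z_gmeasurable kT)) _.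
rewrite lee_fin /noise /sigmat2; set N : R := n%:R.
have N0 : 0 <= N by exact: ler0n.
have m0 : 0 < (Tb k)%:R :> R by rewrite ltr0n Tb_ge1.
pose mL := mu ^+ 2 * Lf ^+ 2; have mL0 : 0 <= mL by rewrite mulr_ge0 ?sqr_ge0.
rewrite [leRHS]mulrDr lerD//.
  rewrite [leRHS]mulrA ler_pM2r ?invr_gt0// -/mL -subr_ge0.
  (* [2 * sigmat2] minus the computed variance constant, expanded into visibly nonnegative terms. *)
  rewrite [leRHS](_ : _ = (8 * N + 46) * M ^+ 2 + 16 * sigma ^+ 2
      + mL * ((N + 4) * (7 * N ^+ 2 + 62 * N + 128))); last by ring.
  by do ?[exact: mL0|exact: N0|exact: sqr_ge0|exact: ler0n|apply: addr_ge0|apply: mulr_ge0].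
rewrite -/mL (_ : 2 * _ = mL / 4 * (2 * (N + 3) ^+ 3)); last by rewrite /mL; ring.
rewrite ler_wpM2l ?divr_ge0// -subr_ge0.
(* The surplus 2 (N + 3)^3 - N (N + 2) (N + 4). *)
rewrite [leRHS](_ : _ = N ^+ 3 + 12 * N ^+ 2 + 46 * N + 54); last by ring.
by do ?[exact: N0|exact: exprn_ge0|exact: ler0n|apply: addr_ge0|apply: mulr_ge0].
Qed.

(** [h] is a measurable minorant of the next value: [Psi k.+1] before the last step, and 0 at step
    T, because z_(T+1) carries no adaptedness. *)
Let one_step k (h : Omega -> R) : (1 <= k <= T)%N -> measurable_fun setT h ->
  (forall w, 0 <= h w <= Psi k.+1 w) ->
  (\int[P]_w (h w)%:E + (alpha k * pmin)%:E * \int[P]_w (gap k w)%:E <=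
   \int[P]_w (Psi k w)%:E + (cost k)%:E)%E.
Proof.
move=> kT mh hP; have kT1 := le_T1 kT; have /andP[a0 a1] := alpha01 kT.
pose phi1 s w := alpha k * block_gap f chi theta s (z k w).
pose phi2 s w := L s * D s ^+ 2 * alpha k ^+ 2
    + norm2 (block s (batch_error k (z k w) w)) ^+ 2 / (2 * L s).
pose S := gen (drawn_before Tb k `|` batch_draws k).
have Sz : gmeasurable S (z k : Omega -> @BV R n).
  apply: gmeasurable_sub (z_gmeasurable kT) => E [j Aj GE].
  by apply: sub_gen_smallest; exists j => //; left.
have Xz w := z_feasible w kT1.
have mphi1 s : gmeasurable S (phi1 s).
  by apply: measurable_funM => //; exact: block_gap_measurable.
have Serr : gmeasurable S (fun w => batch_error k (z k w) w : @BV R n).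
  apply: (batch_error_measurable (S := g_sigma_algebraType S) (g := id)) => // t bt.
    by apply: sample_gmeasurable; right; exists t => //; left.
  by apply: dir_gmeasurable; right; exists t => //; right.
have mphi2 s : gmeasurable S (phi2 s).
  apply: measurable_funD => //; apply: measurable_funM => //.
  exact: norm2_block_measurable.
have phi1_ge0 s w : 0 <= phi1 s w.
  by rewrite mulr_ge0 ?(block_gap_ge0 fw)// ltW.
have phi2_ge0 s w : 0 <= phi2 s w.
  apply: addr_ge0; last by rewrite divr_ge0 ?sqr_ge0// mulr_ge0// ltW.
  by do ?[exact: sqr_ge0|exact/ltW/L_gt0|apply: mulr_ge0].
have [m1 e1] := block_average kT mphi1 phi1_ge0.
have [m2 e2] := block_average kT mphi2 phi2_ge0.
have UV : drawn_before Tb k `|` batch_draws k `<=` V.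
  by rewrite subUset; split; [apply: drawn_before_sub; case/andP: kT1|exact: batch_sub].
have mgap : measurable_fun setT (gap k).
  rewrite (_ : gap k = fun w => \sum_(s < b) block_gap f chi theta s (z k w)); last first.
    by apply/funext => w; rewrite /gap fw_gap_block.
  by apply: measurable_sum => s; exact: block_gap_measurable (z_measurable kT) Xz.
have merr : measurable_fun setT (fun w => norm2 (batch_error k (z k w) w) ^+ 2).
  by apply: sqr_norm2_BV_measurable; exact: draws_measurable UV Serr.
have lhs : ((alpha k * pmin)%:E * \int[P]_w (gap k w)%:E <=
    \int[P]_w (phi1 (rblock r k w) w)%:E)%E.
  rewrite e1 -ge0_integralZl//; last 3 first.
  - exact/measurable_EFinP.
  - by move=> w _; rewrite lee_fin gap_ge0.
  - by rewrite lee_fin mulr_ge0// ltW.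
  apply: ge0_le_integral => //.
  - by move=> w _; rewrite lee_fin !mulr_ge0 ?gap_ge0// ltW.
  - by apply/measurable_EFinP; exact: measurable_funM.
  - apply/measurable_EFinP/measurable_sum => s; apply: measurable_funM => //.
    exact: draws_measurable UV (mphi1 s).
  - move=> w _; rewrite lee_fin /gap fw_gap_block mulr_sumr; apply: ler_sum => s _.
    rewrite /phi1 mulrA ler_wpM2r ?(block_gap_ge0 fw)// [leRHS]mulrC.
    by rewrite ler_wpM2l// ltW.
have rhs : (\int[P]_w (phi2 (rblock r k w) w)%:E <= (cost k)%:E)%E.
  rewrite e2.
  pose c1 := (\sum_(s < b) p s * L s * D s ^+ 2) * alpha k ^+ 2.
  (* Once each p_s / (2 L_s) is bounded by [pl / 2], the squared block errors add up to the full
     squared norm. *)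
  apply: (@le_trans _ _ (\int[P]_w (c1 + pl / 2 * norm2 (batch_error k (z k w) w) ^+ 2)%:E))%E.
    apply: ge0_le_integral => //.
    - by move=> w _; rewrite lee_fin sumr_ge0// => s _; rewrite mulr_ge0.
    - apply/measurable_EFinP/measurable_sum => s; apply: measurable_funM => //.
      exact: draws_measurable UV (mphi2 s).
    - by apply/measurable_EFinP; apply: measurable_funD => //; exact: measurable_funM.
    - move=> w _; rewrite lee_fin; set e := batch_error _ _ _.
      rewrite sqr_norm2 dotv_block mulr_sumr /c1 mulr_suml -big_split /=.
      apply: ler_sum => s _; rewrite /phi2 -/e mulrDr lerD//.
        by rewrite !mulrA.
      rewrite sqr_norm2 [leLHS](_ : _ = (p s / L s) / 2 * dotv (block s e) (block s e)); last first.
        by field; rewrite gt_eqF.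
      by rewrite ler_wpM2r ?dotvv_ge0// ler_pM2r// invr_gt0.
  under eq_integral do rewrite EFinD (EFinM (pl / 2)).
  have c10 : 0 <= c1.
    rewrite mulr_ge0 ?sqr_ge0// sumr_ge0// => s _.
    by do ?[exact: sqr_ge0|exact: p_ge0|exact/ltW/L_gt0|apply: mulr_ge0].
  have c1E : (\int[P]_w c1%:E = c1%:E)%E.
    by have := expectation_cst P c1; rewrite unlock.
  rewrite ge0_integralD//; last 2 first.
  - by move=> w _; rewrite mule_ge0// lee_fin ?divr_ge0 ?sqr_ge0.
  - by apply: emeasurable_funM => //; exact/measurable_EFinP.
  rewrite c1E ge0_integralZl//; last 3 first.
  - exact/measurable_EFinP.
  - by move=> w _; rewrite lee_fin sqr_ge0.
  - by rewrite lee_fin divr_ge0.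
  rewrite /cost EFinD leeD2l//.
  apply: (@le_trans _ _ ((pl / 2)%:E * (2 * noise k)%:E))%E.
    by rewrite lee_wpmul2l ?noise_bound// lee_fin divr_ge0.
  by rewrite -EFinM lee_fin mulrA divfK.
apply: (@le_trans _ _ (\int[P]_w (h w + phi1 (rblock r k w) w)%:E))%E.
  under [leRHS]eq_integral do rewrite EFinD.
  rewrite ge0_integralD//; last 4 first.
  - by move=> w _; rewrite lee_fin; have /andP[] := hP w.
  - exact/measurable_EFinP.
  - by move=> w _; rewrite lee_fin.
  - exact/measurable_EFinP.
  by rewrite leeD2l.
apply: (@le_trans _ _ (\int[P]_w (Psi k w + phi2 (rblock r k w) w)%:E))%E.
  apply: ge0_le_integral => //.
  - by move=> w _; rewrite lee_fin addr_ge0//; have /andP[] := hP w.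
  - by apply/measurable_EFinP; exact: measurable_funD.
  - by apply/measurable_EFinP; apply: measurable_funD => //; exact: Psi_measurable.
  - move=> w _; rewrite lee_fin; have /andP[_ hw] := hP w.
    have := step_pointwise w kT; rewrite /phi1 /phi2; move: hw; rewrite /Psi; lra.
under eq_integral do rewrite EFinD.
rewrite ge0_integralD//; last 4 first.
- by move=> w _; rewrite lee_fin Psi_ge0.
- by apply/measurable_EFinP; exact: Psi_measurable.
- by move=> w _; rewrite lee_fin.
- exact/measurable_EFinP.
by rewrite leeD2l.
Qed.

(** The restriction m < T keeps every [Psi] that occurs among the adapted iterates. *)
Let telescope m : (m < T)%N ->
  (\int[P]_w (Psi m.+1 w)%:E
   + \sum_(1 <= k < m.+1) (alpha k * pmin)%:E * \int[P]_w (gap k w)%:E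
   <= (Phi z1 - Phistar + \sum_(1 <= k < m.+1) cost k)%:E)%E.
Proof.
elim: m => [|m IH] mT.
  rewrite !big_geq// adde0 addr0 /Psi.
  under eq_integral do rewrite (z_init hz).
  by have := expectation_cst P (Phi z1 - Phistar); rewrite unlock => ->.
rewrite big_nat_recr//= [in leRHS]big_nat_recr//=.
have H := @one_step m.+1 (Psi m.+2) (ltnW mT) (@Psi_measurable m.+2 mT).
apply: (@le_trans _ _ (\int[P]_w (Psi m.+1 w)%:E + (cost m.+1)%:E
   + \sum_(1 <= k < m.+1) (alpha k * pmin)%:E * \int[P]_w (gap k w)%:E)%E).
  rewrite [X in (_ + X <= _)%E]addeC addeA leeD2r//.
  by apply: H => w; rewrite lexx andbT Psi_ge0//= ltnW.
rewrite addeAC; apply: le_trans (leeD2r _ (IH (ltnW mT))) _.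
by rewrite [in leRHS]addrA [in leRHS]EFinD.
Qed.

(** The output lies in 1..T at every sample point, and one exists because the total mass is 1. *)
Let T_gt0 : (0 < T)%N.
Proof.
have [w _] : exists w : Omega, True.
  apply: contrapT => nw; have := probability_setT P.
  rewrite (_ : setT = set0) ?measure0; first by move=> /eqP; rewrite eq_sym onee_eq0.
  by apply/seteqP; split => // w _; apply: nw; exists w.
by have /andP[] := rout_range hr w; exact: leq_trans.
Qed.

Let descent_bound :
  (\sum_(1 <= k < T.+1) (alpha k * pmin)%:E * \int[P]_w (gap k w)%:E
   <= (Phi z1 - Phistar + \sum_(1 <= k < T.+1) cost k)%:E)%E.
Proof.
have T1 : (T.-1 < T)%N by rewrite prednK.
have TT : (1 <= T <= T)%N by rewrite T_gt0 leqnn.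
have := telescope T1; rewrite prednK// => IH.
rewrite !big_nat_recr//= addrA EFinD.
apply: le_trans (leeD2r _ IH).
(* The last step uses the minorant 0 in place of [Psi T.+1]. *)
have H := @one_step T (cst 0) TT (@measurable_cst _ _ _ _ _ _).
have {H} : ((alpha T * pmin)%:E * \int[P]_w (gap T w)%:E <=
    \int[P]_w (Psi T w)%:E + (cost T)%:E)%E.
  move: H; rewrite integral0 add0e; apply => w /=.
  by rewrite lexx Psi_ge0//= leqnn.
move=> /(leeD2l (\sum_(1 <= i < T) (alpha i * pmin)%:E * \int[P]_w (gap i w)%:E)%E).
by move=> /le_trans; apply; rewrite addeA [X in (X + _)%E]addeC.
Qed.

Hypothesis PRE : forall k, (1 <= k <= T)%N -> PR k = alpha k / \sum_(1 <= l < T.+1) alpha l.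

Let alpha_sum_gt0 : 0 < \sum_(1 <= l < T.+1) alpha l.
Proof.
rewrite big_ltn// ltr_wpDr//; last by have /andP[] := @alpha01 1%N T_gt0.
rewrite big_nat_cond; apply: sumr_ge0 => k /andP[/andP[k2 kT] _].
by have /andP[/ltW] := @alpha01 k (introT andP (conj (ltnW k2) kT)).
Qed.

Let output_gap : ('E_P[fun w => fw_gap f chi theta (z (rout r w) w)] =
  \sum_(1 <= k < T.+1) (PR k)%:E * \int[P]_w (gap k w)%:E)%E.
Proof.
have mz k : (1 <= k <= T)%N ->
    gmeasurable (gen (drawn_before Tb T.+1)) (z k : Omega -> @BV R n).
  move=> kT; apply: gmeasurable_sub (z_gmeasurable kT) => E [j Aj GE].
  apply: sub_gen_smallest; exists j => //; case/andP: kT => _ kT.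
  move: Aj; case: j {GE} => [|l|l t|l t] //=.
  - by move=> /andP[-> /leq_trans]; apply; exact: leqW.
  - by move=> [/andP[-> /leq_trans h] ?]; split => //; exact/h/leqW.
  - by move=> [/andP[-> /leq_trans h] ?]; split => //; exact/h/leqW.
have mgap k : (1 <= k <= T)%N -> gmeasurable (gen (drawn_before Tb T.+1)) (gap k).
  move=> kT; rewrite (_ : gap k = fun w => \sum_(s < b) block_gap f chi theta s (z k w)); last first.
    by apply/funext => w; rewrite /gap fw_gap_block.
  apply: measurable_sum => s; apply: block_gap_measurable (mz k kT) _ => w.
  exact/z_feasible/le_T1.
rewrite unlock (output_average (phi := fun k w => gap k w))//.
(* Zero outside 1..T, because the exchange of sum and integral asks for nonnegativity and
   measurability at every index. *)
pose phi k := if (1 <= k <= T)%N then fun w => (PR k * gap k w)%:E else cst 0%E.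
have PR0 k : (1 <= k <= T)%N -> 0 <= PR k.
  move=> kT; rewrite PRE// divr_ge0 ?(ltW alpha_sum_gt0)//.
  by have /andP[/ltW] := alpha01 kT.
have mgapT k : (1 <= k <= T)%N -> measurable_fun setT (gap k).
  by move=> kT; apply: draws_measurable (mgap k kT); exact: drawn_before_sub.
transitivity (\int[P]_w \sum_(1 <= k < T.+1) phi k w)%E.
  apply: eq_integral => w _; rewrite -sumEFin; apply: eq_big_nat => k kT.
  by rewrite /phi kT.
rewrite ge0_integral_sum//; first last.
- by move=> k w _; rewrite /phi; case: ifP => // kT; rewrite lee_fin mulr_ge0 ?PR0 ?gap_ge0.
- move=> k; rewrite /phi; case: ifP => kT; last exact: measurable_cst.
  by apply/measurable_EFinP; apply: measurable_funM => //; exact: mgapT.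
apply: eq_big_nat => k kT; rewrite /phi kT.
under eq_integral do rewrite EFinM.
rewrite ge0_integralZl//.
- exact/measurable_EFinP/mgapT.
- by move=> w _; rewrite lee_fin gap_ge0.
- by rewrite lee_fin PR0.
Qed.

Hypothesis p1 : \sum_(s < b) p s = 1.

(** The weights sum to 1, so one of them is positive; this feeds the strict positivity of the
    numerator. *)
Let pl_gt0 : 0 < pl.
Proof.
have [s ps] : exists s, 0 < p s.
  apply: contrapT => np; have : 0 < \sum_(s < b) p s by rewrite p1.
  rewrite big1 ?ltxx// => s _; apply/eqP; rewrite eq_le p_ge0 andbT leNgt.
  by apply/negP => ps; apply: np; exists s.
by apply: lt_le_trans (pl_ge s); rewrite divr_gt0.
Qed.

Let noise_gt0 k : (1 <= k <= T)%N -> 0 < noise k.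
Proof.
move=> kT; have [Lf0 _ _] := lip.
have N0 : 0 <= n%:R :> R by exact: ler0n.
apply: ltr_wpDl; last by rewrite !mulr_gt0 ?exprn_gt0// ltr_wpDl.
apply: divr_ge0 => //; apply: mulr_ge0; first by rewrite mulr_ge0// addr_ge0.
by do ?[exact: sqr_ge0|exact: ler0n|apply: addr_ge0|apply: mulr_ge0].
Qed.

Let cost_sum : \sum_(1 <= k < T.+1) cost k =
  (\sum_(s < b) p s * L s * D s ^+ 2) * \sum_(1 <= k < T.+1) alpha k ^+ 2
  + pl * \sum_(1 <= k < T.+1) noise k.
Proof. by rewrite big_split /= !mulr_sumr. Qed.

(** Strict positivity makes the bound +oo when the smallest p_s is 0; it comes from the smoothing
    term of the noise, as mu and Lf are positive. *)
Let cost_sum_gt0 : 0 < Phi z1 - Phistar + \sum_(1 <= k < T.+1) cost k.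
Proof.
apply: ltr_wpDl.
  have [y [_ ymin] ->] := Phimin; rewrite subr_ge0; exact: ymin.
rewrite big_ltn//.
have cost_gt0 k : (1 <= k <= T)%N -> 0 < cost k.
  move=> kT; apply: ltr_wpDl; last by rewrite mulr_gt0 ?noise_gt0.
  rewrite mulr_ge0 ?sqr_ge0// sumr_ge0// => s _.
  by do ?[exact: sqr_ge0|exact: p_ge0|exact/ltW/L_gt0|apply: mulr_ge0].
apply: ltr_wpDr; last by apply: cost_gt0; rewrite T_gt0.
rewrite big_nat_cond; apply: sumr_ge0 => k /andP[/andP[k2 kT] _].
by apply/ltW/cost_gt0; rewrite (ltnW k2).
Qed.

Lemma expected_fw_gap_bound :
  ('E_P[fun w => fw_gap f chi theta (z (rout r w) w)]
   <= (Phi z1 - Phistar + (\sum_(s < b) p s * L s * D s ^+ 2)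
         * \sum_(1 <= k < T.+1) alpha k ^+ 2
       + pl * \sum_(1 <= k < T.+1) noise k)%:E
      / (pmin * \sum_(1 <= k < T.+1) alpha k)%:E)%E.
Proof.
rewrite -addrA -cost_sum.
have [pmin0|pmin_neq0] := eqVneq pmin 0.
  by rewrite pmin0 mul0r inve0 gt0_muley ?leey// lte_fin cost_sum_gt0.
have pmin_gt0 : 0 < pmin by rewrite lt_neqAle eq_sym pmin_neq0 pmin_ge0.
have c0 : 0 < pmin * \sum_(1 <= k < T.+1) alpha k by rewrite mulr_gt0.
rewrite inver gt_eqF// lee_pdivlMr// output_gap.
apply: le_trans descent_bound; rewrite muleC [X in (_ * X)%E]big_nat_cond.
rewrite ge0_sume_distrr => [|k /andP[kT _]]; last first.
  have /andP[/ltW a0 _] := alpha01 kT.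
  rewrite mule_ge0 ?lee_fin ?PRE ?divr_ge0 ?(ltW alpha_sum_gt0)//.
  by apply: integral_ge0 => w _; rewrite lee_fin gap_ge0.
(* [PR k] is [alpha k] over the sum of the stepsizes, which cancels against the denominator of the
   claim. *)
rewrite -big_nat_cond le_eqVlt; apply/orP; left; apply/eqP; apply: eq_big_nat => k kT.
rewrite muleA -EFinM PRE//; congr (_%:E * _)%E.
by field; rewrite gt_eqF.
Qed.

End Iterates.
End Method.

(* The bound is stated in the extended reals, where num / 0 = +oo for num > 0
   (the case min_s p_s = 0).  The neutral elements 1 and 0 of the iterated min
   and max do not affect the values, since p_s <= 1 and p_s / L_s >= 0. *)
Theorem theorem6 (R : realType) (b : nat) (ns : 'I_b -> nat)
  (dXi dO : measure_display) (Xi : measurableType dXi)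
  (Omega : measurableType dO)
  (Q : probability Xi R) (P : probability Omega R)
  (F : 'cV[R]_(\sum_(s < b) ns s) -> Xi -> R)
  (f : 'cV[R]_(\sum_(s < b) ns s) -> R)
  (X : forall s, set 'cV[R]_(ns s))
  (chi : forall s, 'cV[R]_(ns s) -> R)
  (sigma Lf : R) (L : 'I_b -> R) (M : R) (D : 'I_b -> R)
  (mu : R) (T : nat) (alpha : nat -> R) (Tb : nat -> nat) (p : 'I_b -> R)
  (r : randomness R ns Xi Omega)
  (z1 : 'cV[R]_(\sum_(s < b) ns s))
  (x z : nat -> Omega -> 'cV[R]_(\sum_(s < b) ns s))
  (theta : 'cV[R]_(\sum_(s < b) ns s) -> 'cV[R]_(\sum_(s < b) ns s))
  (Phistar : R) :
  let n := (\sum_(s < b) ns s)%N in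
  let Phi := fun y => f y + sepsum chi y in
  let PR := fun k => alpha k / \sum_(1 <= l < T.+1) alpha l in
  let sigmat2 := 4 * (n%:R + 4)
    * (2 * M ^+ 2 + sigma ^+ 2 + mu ^+ 2 * Lf ^+ 2 * (n%:R + 4) ^+ 2) in
  feasible_blocks X ->
  regularizers chi ->
  oracle_measurable F ->
  unbiased_bounded_variance Q F f X sigma ->
  lipschitz_gradients Q F Lf L ->
  bounded_gradient f X M ->
  bounded_blocks X D ->
  is_min (prodset X) Phi Phistar ->
  zs_bccg_parameters mu T alpha Tb p ->
  zs_bccg_randomness P Q T Tb p PR r ->
  prodset X z1 ->
  zs_bccg_iterates F X chi mu T alpha Tb r z1 x z ->
  fw_oracle X f chi theta ->
  ('E_P[fun w => fw_gap f chi theta (z (rout r w) w)]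
   <= (Phi z1 - Phistar
       + (\sum_(s < b) p s * L s * D s ^+ 2)
         * \sum_(1 <= k < T.+1) alpha k ^+ 2
       + \big[Num.max/0]_(s < b) (p s / L s)
         * \sum_(1 <= k < T.+1)
             (sigmat2 / (Tb k)%:R + mu ^+ 2 / 4 * Lf ^+ 2 * (n%:R + 3) ^+ 3))%:E
      / (\big[Num.min/1]_(s < b) p s * \sum_(1 <= k < T.+1) alpha k)%:E)%E.
Proof.
move=> n Phi PR sigmat2 feas reg mF unbiased lip gradM bdd Phimin.
move=> [mu0 alpha01 Tb1 p01 p1] hr Xz1 hz fw.
exact: (expected_fw_gap_bound mF unbiased lip gradM mu0 Tb1 hr feas reg bdd Phimin
  alpha01 p01 Xz1 hz fw _ p1).
Qed.
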